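(* Let $d\ge 1$ be an integer, assume $\lambda>d$ and fix a positive integer $n$. Let $\phi$ be a function on $\mathbb{B}^d$ that is $2n$ times continuously differentiable and for which $\bar{N}^{k}N^{l}\phi$ is bounded for all $0\leq k,l\leq n$. Then $$\left\langle f,T_{\phi}g\right\rangle_{\mathcal{H}L^{2}(\mathbb{B}^{d},\mu_{\lambda})}=c_{\lambda+2n}\int_{\mathbb{B}^{d}}C\left[\overline{f(z)}\phi(z)g(z)\right]\left(1-|z|^{2}\right)^{\lambda+2n}d\tau(z)$$ for all $f,g\in\mathcal{H}L^{2}(\mathbb{B}^{d},\mu_{\lambda})$, where $C$ is the operator given by $$C=\left(I+\frac{\bar{N}}{\lambda+2n-1}\right)\cdots\left(I+\frac{\bar{N}}{\lambda+n}\right)\left(I+\frac{N}{\lambda+n-1}\right)\cdots\left(I+\frac{N}{\lambda}\right).$$ Thus, there exist constants $A_{jklm}$ (depending on $n$ and $\lambda$) such that for all such $\phi$ and all $f,g\in\mathcal{H}L^{2}(\mathbb{B}^{d},\mu_{\lambda})$, $$\left\langle f,T_{\phi}g\right\rangle_{\mathcal{H}L^{2}(\mathbb{B}^{d},\mu_{\lambda})}=\sum_{j,k,l,m=0}^{n}A_{jklm}\left\langle N^{j}f,\left(\bar{N}^{k}N^{l}\phi\right)N^{m}g\right\rangle_{L^{2}(\mathbb{B}^{d},\mu_{\lambda+2n})}.$$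
   Context: $\mathbb{B}^{d}$ is the open unit ball in $\mathbb{C}^{d}$, $dz$ is $2d$-dimensional Lebesgue measure, and $d\tau(z)=(1-|z|^{2})^{-(d+1)}\,dz$. For $\sigma>d$, $c_{\sigma}=\Gamma(\sigma)/(\pi^{d}\Gamma(\sigma-d))$ and $\mu_\sigma$ is the probability measure $d\mu_{\sigma}(z)=c_{\sigma}(1-|z|^{2})^{\sigma}\,d\tau(z)$; $\mathcal{H}L^{2}(\mathbb{B}^{d},\mu_{\sigma})$ is the space of holomorphic functions on $\mathbb{B}^d$ that are square-integrable with respect to $\mu_\sigma$, with the $L^2$ inner product. Inner products are conjugate-linear in the first variable. $N=\sum_{j=1}^{d}z_{j}\,\partial/\partial z_{j}$ and $\bar N=\sum_{j=1}^{d}\bar z_{j}\,\partial/\partial \bar z_{j}$. For $\lambda>d$ and $\phi$ bounded measurable, the Toeplitz operator is $T_{\phi}f=P_{\lambda}(\phi f)$ for $f\in\mathcal{H}L^{2}(\mathbb{B}^{d},\mu_{\lambda})$, where $P_\lambda$ is the orthogonal projection from $L^{2}(\mathbb{B}^{d},\mu_{\lambda})$ onto $\mathcal{H}L^{2}(\mathbb{B}^{d},\mu_{\lambda})$. *)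

(* Defs.v *)
From HB Require Import structures.
From mathcomp Require Import all_boot all_order all_algebra.
From mathcomp Require Import complex.
From mathcomp Require Import all_classical all_reals all_analysis.
Set Implicit Arguments.
Unset Strict Implicit.
Unset Printing Implicit Defensive.
Import Order.TTheory GRing.Theory Num.Theory.
Import numFieldNormedType.Exports.
Import ComplexField.Normc.
Local Open Scope classical_set_scope.
Local Open Scope ring_scope.
Local Open Scope complex_scope.

(* The product sigma-algebra on R^n. *)
Definition measure_rV_display : measure_display.
Proof. exact. Qed.

Section measurable_rV.
Context {R : realType} (n : nat).
Let coors : 'I_n -> 'rV[R]_n -> R := fun i x => x ord0 i.

Let rV_set0 : g_sigma_preimage coors set0.
Proof. exact: sigma_algebra0. Qed.

Let rV_setC A : g_sigma_preimage coors A -> g_sigma_preimage coors (~` A).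
Proof. exact: sigma_algebraC. Qed.

Let rV_bigcup (F : _^nat) : (forall i, g_sigma_preimage coors (F i)) ->
  g_sigma_preimage coors (\bigcup_i (F i)).
Proof. exact: sigma_algebra_bigcup. Qed.

HB.instance Definition _ := @isMeasurable.Build measure_rV_display
  'rV[R]_n (g_sigma_preimage coors) rV_set0 rV_setC rV_bigcup.
End measurable_rV.

Lemma measurable_coord {R : realType} n (i : 'I_n) :
  measurable_fun [set: 'rV[R]_n] (fun x : 'rV[R]_n => x ord0 i).
Proof.
move=> _ Y mY; rewrite setTI; apply: sub_sigma_algebra => /=.
rewrite -bigcup_seq/=; exists i => /=; first by rewrite mem_index_enum.
by exists Y => //; rewrite setTI.
Qed.

Lemma measurable_fun_rVP {R : realType} d1 (T1 : measurableType d1) n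
    (f : T1 -> 'rV[R]_n) :
  (forall i, measurable_fun [set: T1] (fun t => f t ord0 i)) ->
  measurable_fun [set: T1] f.
Proof.
move=> mf.
have h : g_sigma_preimage (fun i t => f t ord0 i : R) `<=` @measurable _ T1.
  apply: smallest_sub; first exact: sigma_algebra_measurable.
  case: n => [|n] in f mf *; first by rewrite big_ord0.
  rewrite -bigcup_mkord_ord; apply: bigcup_sub => i Ii.
  by move=> A [B mB <-]; exact: mf.
move=> _ A mA; apply: h.
rewrite (_ : (fun i t => f t ord0 i) =
  (fun i => (fun x : 'rV[R]_n => x ord0 i) \o f))//.
by rewrite (@g_sigma_preimage_comp _ _ n _ (fun i (x : 'rV[R]_n) => x ord0 i : R) _ f); exists A.
Qed.

Section lebesgue_rV.
Context {R : realType}.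

Definition rV_cons n (p : R * 'rV[R]_n) : 'rV[R]_n.+1 :=
  row_mx (const_mx p.1 : 'rV_1) p.2.

Definition rV_uncons n (v : 'rV[R]_n.+1) : R * 'rV[R]_n :=
  (v ord0 ord0, rsubmx (v : 'rV_(1 + n))).

Lemma rV_consK n : cancel (@rV_cons n) (@rV_uncons n).
Proof.
move=> [x v]; rewrite /rV_uncons /rV_cons /= row_mxKr; congr pair.
rewrite (_ : @ord0 n = lshift n (@ord0 0)); last exact/val_inj.
by apply: etrans (row_mxEl _ _ _ _) _; rewrite mxE.
Qed.

Lemma measurable_rV_cons n : measurable_fun setT (@rV_cons n).
Proof.
apply: measurable_fun_rVP => i.
rewrite -(@splitK 1 n i); case: (@fintype.split 1 n i) => j.
- rewrite (_ : (fun _ => _) = fst); first exact: measurable_fst.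
  by apply/funext => p; apply: etrans (row_mxEl _ _ _ _) _; rewrite mxE.
- rewrite (_ : (fun _ => _) = (fun v : 'rV[R]_n => v ord0 j) \o snd).
    exact: (measurableT_comp (measurable_coord j) measurable_snd).
  by apply/funext => p; exact: row_mxEr.
Qed.

Lemma measurable_rV_uncons n : measurable_fun setT (@rV_uncons n).
Proof.
apply: measurable_fun_pair; first exact: measurable_coord.
apply: measurable_fun_rVP => i.
by under eq_fun do rewrite mxE; exact: measurable_coord.
Qed.

Section step.
Variables (n : nat) (m : {sigma_finite_measure set 'rV[R]_n -> \bar R}).

Definition rV_step : set 'rV[R]_n.+1 -> \bar R :=
  pushforward (@lebesgue_measure R \x m)%E (@rV_cons n).

Let rV_step0 : rV_step set0 = 0%E.
Proof. by rewrite /rV_step /pushforward preimage_set0 measure0. Qed.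

Let rV_step_ge0 A : (0 <= rV_step A)%E.
Proof. by rewrite /rV_step /pushforward; exact: measure_ge0. Qed.

Let rV_step_sigma_additive : semi_sigma_additive rV_step.
Proof.
move=> F mF tF mUF; rewrite /rV_step /pushforward preimage_bigcup.
apply: measure_semi_sigma_additive.
- by move=> k; rewrite -[X in measurable X]setTI; exact: measurable_rV_cons.
- apply/trivIsetP => /= i j _ _ ij; rewrite -preimage_setI.
  by move/trivIsetP : tF => /(_ _ _ _ _ ij) ->//; rewrite preimage_set0.
- by rewrite -preimage_bigcup -[X in measurable X]setTI;
    exact: measurable_rV_cons.
Qed.

HB.instance Definition _ := isMeasure.Build _ _ _ rV_step
  rV_step0 rV_step_ge0 rV_step_sigma_additive.

Let rV_step_sigma_finite : sigma_finite setT rV_step.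
Proof.
have /sigma_finiteP[F [TF ndF Foo]] := sigma_finiteT (@lebesgue_measure R).
have /sigma_finiteP[G [TG ndG Goo]] := sigma_finiteT m.
exists (fun k => @rV_uncons n @^-1` (F k `*` G k)).
  rewrite -preimage_bigcup -(preimage_setT (@rV_uncons n)); congr (_ @^-1` _).
  rewrite -setXTT TF TG predeqE => -[x y]; split.
    move=> [/= [i _ Fix] [k _ Gky]]; exists (maxn i k) => //; split.
    - by move: x Fix; exact/subsetPset/ndF/leq_maxl.
    - by move: y Gky; exact/subsetPset/ndG/leq_maxr.
  by move=> [i _ []/= ? ?]; split; exists i.
move=> k; have [mF Fk] := Foo k; have [mG Gk] := Goo k; split.
  by rewrite -[X in measurable X]setTI; apply: measurable_rV_uncons => //;
    exact: measurableX.
rewrite /rV_step /pushforward -comp_preimage.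
rewrite (_ : _ \o _ = id) ?preimage_id; last first.
  by apply/funext => p; exact: rV_consK.
by rewrite product_measure1E// lte_mul_pinfty// ge0_fin_numE.
Qed.

HB.instance Definition _ := Measure_isSigmaFinite.Build _ _ _ rV_step
  rV_step_sigma_finite.
End step.

(* Lebesgue measure on R^n: the n-fold product of Lebesgue measure on R,
   transported along R * R^n = R^(n+1). *)
Fixpoint lebesgue_rV (n : nat) : {sigma_finite_measure set 'rV[R]_n -> \bar R} :=
  match n with
  | 0 => dirac (0 : 'rV[R]_0)
  | n'.+1 => rV_step (lebesgue_rV n')
  end.

End lebesgue_rV.

(* C^d with its real coordinates: (x, y) stands for x + i y. *)
Notation Cspace R d := ('rV[R%type]_d * 'rV[R%type]_d)%type.

Section complex_space.
Context {R : realType} {d : nat}.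
Local Notation Cd := (Cspace R d).

Definition lebesgue_C : {measure set Cd -> \bar R} :=
  (lebesgue_rV d \x lebesgue_rV d)%E.

Definition coordC (z : Cd) (j : 'I_d) : R[i] := z.1 ord0 j +i* z.2 ord0 j.

Definition sqnorm (z : Cd) : R :=
  \sum_(j < d) ((z.1 ord0 j) ^+ 2 + (z.2 ord0 j) ^+ 2).

Definition unit_ball : set Cd := [set z | sqnorm z < 1].

(* The unit vector of the coordinate x_j (b = false) or y_j (b = true). *)
Definition real_dir (b : bool) (j : 'I_d) : Cd :=
  if b then (0, delta_mx ord0 j) else (delta_mx ord0 j, 0).

Definition derivableC (f : Cd -> R[i]) (z v : Cd) : Prop :=
  derivable (fun w => complex.Re (f w)) z v /\
  derivable (fun w => complex.Im (f w)) z v.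

Definition deriveC (v : Cd) (f : Cd -> R[i]) : Cd -> R[i] := fun z =>
  'D_v (fun w => complex.Re (f w)) z +i* 'D_v (fun w => complex.Im (f w)) z.

Definition continuousC_at (f : Cd -> R[i]) (z : Cd) : Prop :=
  {for z, continuous (fun w => complex.Re (f w))} /\
  {for z, continuous (fun w => complex.Im (f w))}.

(* k times continuously differentiable on the unit ball. The ball is open, so
   continuity and derivatives at its points ignore the values outside it. *)
Fixpoint Ck (k : nat) (f : Cd -> R[i]) : Prop :=
  (forall z, unit_ball z -> continuousC_at f z) /\
  match k with
  | 0 => True
  | k'.+1 => forall b j,
      (forall z, unit_ball z -> derivableC f z (real_dir b j)) /\
      Ck k' (deriveC (real_dir b j) f)
  end.

(* The Wirtinger derivatives d/dz_j and d/d\bar z_j. *)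
Definition dz (j : 'I_d) (f : Cd -> R[i]) : Cd -> R[i] := fun z =>
  (deriveC (real_dir false j) f z - (0 +i* 1) * deriveC (real_dir true j) f z)
  / 2.

Definition dzbar (j : 'I_d) (f : Cd -> R[i]) : Cd -> R[i] := fun z =>
  (deriveC (real_dir false j) f z + (0 +i* 1) * deriveC (real_dir true j) f z)
  / 2.

Definition opN (f : Cd -> R[i]) : Cd -> R[i] := fun z =>
  \sum_(j < d) coordC z j * dz j f z.

Definition opNbar (f : Cd -> R[i]) : Cd -> R[i] := fun z =>
  \sum_(j < d) conjc (coordC z j) * dzbar j f z.

(* On the unit ball: continuously differentiable with d/d\bar z_j f = 0. *)
Definition holomorphic (f : Cd -> R[i]) : Prop :=
  Ck 1 f /\ forall z j, unit_ball z -> dzbar j f z = 0.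

Definition integrableC (F : Cd -> R[i]) : Prop :=
  lebesgue_C.-integrable unit_ball (fun z => (complex.Re (F z))%:E) /\
  lebesgue_C.-integrable unit_ball (fun z => (complex.Im (F z))%:E).

Definition integralC (F : Cd -> R[i]) : R[i] :=
  Rintegral lebesgue_C unit_ball (fun z => complex.Re (F z)) +i*
  Rintegral lebesgue_C unit_ball (fun z => complex.Im (F z)).

Definition tau_density (z : Cd) : R := (1 - sqnorm z) ^- d.+1.

Definition integrable_tau (F : Cd -> R[i]) : Prop :=
  integrableC (fun z => F z * (tau_density z)%:C).

Definition integral_tau (F : Cd -> R[i]) : R[i] :=
  integralC (fun z => F z * (tau_density z)%:C).

Definition weight (sigma : R) (z : Cd) : R := (1 - sqnorm z) `^ sigma.

End complex_space.

Definition Gamma {R : realType} (s : R) : R :=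
  Rintegral lebesgue_measure `]0, +oo[ (fun t => t `^ (s - 1) * expR (- t)).

Definition cst_c {R : realType} (d : nat) (sigma : R) : R :=
  Gamma sigma / (pi ^+ d * Gamma (sigma - d%:R)).

Section bergman.
Context {R : realType} {d : nat}.
Local Notation Cd := (Cspace R d).

(* dmu_sigma = c_sigma (1 - |z|^2)^sigma dtau and dtau = (1 - |z|^2)^-(d+1) dz
   are used through their densities on the ball. *)
Definition integral_mu (sigma : R) (F : Cd -> R[i]) : R[i] :=
  (cst_c d sigma)%:C * integral_tau (fun z => F z * (weight sigma z)%:C).

Definition L2 (sigma : R) (f : Cd -> R[i]) : Prop :=
  [/\ measurable_fun unit_ball (fun z => complex.Re (f z)),
      measurable_fun unit_ball (fun z => complex.Im (f z)) &
      (\int[lebesgue_C]_(z in unit_ball)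
        (cst_c d sigma *
          (normc (f z) ^+ 2 * weight sigma z * tau_density z))%:E < +oo)%E].

Definition inner (sigma : R) (f g : Cd -> R[i]) : R[i] :=
  integral_mu sigma (fun z => conjc (f z) * g z).

Definition HL2 (sigma : R) (f : Cd -> R[i]) : Prop :=
  holomorphic f /\ L2 sigma f.

(* P is the orthogonal projection of L^2 onto HL^2, acting on functions; as
   holomorphic functions are continuous, this determines P h on the ball. *)
Definition is_orthogonal_projection (sigma : R)
    (P : (Cd -> R[i]) -> Cd -> R[i]) : Prop :=
  forall h, L2 sigma h ->
    HL2 sigma (P h) /\
    forall k, HL2 sigma k -> inner sigma k (fun z => h z - P h z) = 0.

Definition toeplitz (P : (Cd -> R[i]) -> Cd -> R[i]) (phi f : Cd -> R[i]) :
  Cd -> R[i] := P (fun z => phi z * f z).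

(* (I + D/(a+k-1)) ... (I + D/(a+1)) (I + D/a) h *)
Fixpoint prodI (D : (Cd -> R[i]) -> Cd -> R[i]) (a : R) (k : nat)
    (h : Cd -> R[i]) : Cd -> R[i] :=
  match k with
  | 0 => h
  | k'.+1 => let u := prodI D a k' h in
      fun z => u z + D u z / (a + k'%:R)%:C
  end.

Definition opC (n : nat) (lambda : R) (h : Cd -> R[i]) : Cd -> R[i] :=
  prodI opNbar (lambda + n%:R) n (prodI opN lambda n h).

Definition symbol_class (n : nat) (phi : Cd -> R[i]) : Prop :=
  Ck (2 * n) phi /\
  forall k l, (k <= n)%N -> (l <= n)%N ->
    exists M : R, forall z, unit_ball z ->
      normc (iter k opNbar (iter l opN phi) z) <= M.

End bergman.

(* Main.v *)
(* Integrating by parts against w^s, w = 1 - |z|^2, gives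
     int (N psi) w^s = s int psi w^(s-1) - (s+d) int psi w^s,
   and the same for \bar N. Since c_(sigma+1) (sigma - d) = sigma c_sigma, this
   says that a factor I + N/sigma raises the weight sigma to sigma + 1 without
   changing c_sigma int psi w^sigma dtau; the factors of C are applied one at a
   time to psi = \bar f phi g. As N \bar f = 0 and \bar N g = 0, Leibniz' rule
   only produces the terms \bar{N^j f} (\bar N^k N^l phi) N^m g, with j + m at
   most the number of factors applied, so they are integrable as soon as
   f in L^2(w^q) implies N f in L^2(w^(q+2)). That estimate follows from
   |N f|^2 = \bar N (\bar f N f) and \bar f N f = N |f|^2 by two integrations by
   parts against a truncation of w^(q+2).
   Since holomorphic only means C^1 with vanishing d/d\bar z_j, one also needs
   that N f is holomorphic: the mean value property for a C^1 radial kernel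
   (obtained by radial integration by parts against an approximate identity)
   allows all derivatives to be moved onto the kernel. *)
Require Import Defs.
From HB Require Import structures.
From mathcomp Require Import all_boot all_order all_algebra.
From mathcomp Require Import complex.
From mathcomp Require Import all_classical all_reals all_analysis.
From mathcomp Require Import measurable_realfun.
From mathcomp Require Import ring lra zify.
Import Order.TTheory GRing.Theory Num.Theory.
Import numFieldNormedType.Exports.
Import ComplexField.Normc.
Set Implicit Arguments.
Unset Strict Implicit.
Unset Printing Implicit Defensive.
Local Open Scope classical_set_scope.
Local Open Scope ring_scope.
Local Open Scope complex_scope.

(** * Lebesgue measure on C^d *)

Section translation.
Context {R : realType}.

Lemma lebesgue_measure_shift (a : R) (A : set (measurableTypeR R)) :
  measurable A ->
  @lebesgue_measure R ((fun x => x + a) @^-1` A) = lebesgue_measure A.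
Proof.
move=> mA.
have mf : measurable_fun [set: measurableTypeR R] (fun x : R => x + a : measurableTypeR R).
  by apply: measurable_funD => //; exact: measurable_id.
pose mf' : {mfun (measurableTypeR R) >-> (measurableTypeR R)} :=
  HB.pack (fun x : R => x + a : measurableTypeR R)
  (@isMeasurableFun.Build _ _ _ _ _ mf).
apply/esym; apply: (@lebesgue_measure_unique R (pushforward (@lebesgue_measure R) mf')) => //.
move=> _ [[u v] _ <-]; rewrite /= /pushforward.
rewrite (_ : _ @^-1` _ = `](u - a), (v - a)]%classic); last first.
  by apply/seteqP; split => x /=; rewrite !in_itv/= ltrBlDr lerBrDr.
by rewrite !lebesgue_measure_itv/= !lte_fin ltrD2r -!EFinB opprB addrA subrK.
Qed.

Lemma product_measure_preimage d1 d2 (T1 : measurableType d1)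
    (T2 : measurableType d2) (m1 : {sigma_finite_measure set T1 -> \bar R})
    (m2 : {sigma_finite_measure set T2 -> \bar R}) (f1 : T1 -> T1) (f2 : T2 -> T2) :
  measurable_fun setT f1 -> measurable_fun setT f2 ->
  (forall A, measurable A -> m1 (f1 @^-1` A) = m1 A) ->
  (forall A, measurable A -> m2 (f2 @^-1` A) = m2 A) ->
  forall X, measurable X ->
    (m1 \x m2)%E ((fun z => (f1 z.1, f2 z.2)) @^-1` X) = (m1 \x m2)%E X.
Proof.
move=> mf1 mf2 h1 h2 X mX.
have mf : measurable_fun [set: T1 * T2] (fun z : T1 * T2 => (f1 z.1, f2 z.2)).
  apply: measurable_fun_pair.
  - exact: (measurableT_comp mf1 measurable_fst).
  - exact: (measurableT_comp mf2 measurable_snd).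
pose mf' : {mfun (T1 * T2)%type >-> (T1 * T2)%type} :=
  HB.pack (fun z : T1 * T2 => (f1 z.1, f2 z.2)) (@isMeasurableFun.Build _ _ _ _ _ mf).
apply/esym; apply: (@product_measure_unique _ _ _ _ _ m1 m2
  (pushforward (m1 \x m2)%E mf')) => // A B mA mB.
rewrite /= /pushforward.
rewrite (_ : _ @^-1` _ = (f1 @^-1` A) `*` (f2 @^-1` B)); last first.
  by apply/seteqP; split => x.
have mA' : measurable (f1 @^-1` A) by rewrite -[f1 @^-1` A]setTI; exact: mf1.
have mB' : measurable (f2 @^-1` B) by rewrite -[f2 @^-1` B]setTI; exact: mf2.
by apply: etrans (product_measure1E _ _ mA' mB') _; congr (_ * _)%E; [exact: h1|exact: h2].
Qed.

Lemma rV_cons0 n (p : R * 'rV[R]_n) i : rV_cons p i ord0 = p.1.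
Proof.
rewrite (_ : ord0 = lshift n (ord0 : 'I_1)); last exact/val_inj.
by rewrite /rV_cons [LHS]row_mxEl mxE.
Qed.

Lemma rV_consS n (p : R * 'rV[R]_n) i j : rV_cons p i (rshift 1 j) = p.2 i j.
Proof. by rewrite /rV_cons [LHS]row_mxEr. Qed.

Lemma forall_ordS n (P : 'I_n.+1 -> Prop) :
  P ord0 -> (forall j : 'I_n, P (rshift 1 j)) -> forall i, P i.
Proof.
move=> P0 PS i; rewrite -(@splitK 1 n i); case: (@fintype.split 1 n i) => j /=.
  by rewrite [_ j](_ : _ = ord0 :> 'I_n.+1)//; apply/val_inj; rewrite /= ord1.
exact: PS.
Qed.

Lemma rV_consD n (p : R * 'rV[R]_n) (v : 'rV[R]_n.+1) :
  rV_cons p + v = rV_cons (p.1 + v ord0 ord0, p.2 + rsubmx (v : 'rV_(1 + n))).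
Proof.
apply/rowP; apply: forall_ordS => [|j].
  by rewrite mxE !rV_cons0.
by rewrite mxE !rV_consS !mxE.
Qed.

Lemma measurable_shift_rV n (v : 'rV[R]_n) :
  measurable_fun setT (fun x : 'rV[R]_n => x + v).
Proof.
apply: measurable_fun_rVP => i; under eq_fun do rewrite mxE.
by apply: measurable_funD => //; exact: measurable_coord.
Qed.

Lemma lebesgue_rV_shift n (v : 'rV[R]_n) (A : set 'rV[R]_n) : measurable A ->
  lebesgue_rV n ((fun x => x + v) @^-1` A) = lebesgue_rV n A.
Proof.
elim: n v A => [|n IH] v A mA.
  congr (lebesgue_rV 0 _); apply/seteqP; split => x /=;
    by rewrite (_ : x + v = x)//; apply/rowP => -[].
rewrite /= /rV_step /pushforward.
rewrite -[RHS](@product_measure_preimage _ _ _ _ lebesgue_measure (lebesgue_rV n)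
  (fun x => x + v ord0 ord0) (fun x => x + rsubmx (v : 'rV_(1 + n)))).
- congr ((_ \x _)%E _); apply/seteqP; split => -[x y] /=; by rewrite rV_consD.
- by apply: measurable_funD => //; exact: measurable_id.
- exact: measurable_shift_rV.
- exact: lebesgue_measure_shift.
- by move=> B mB; exact: IH.
- by rewrite -[X in measurable X]setTI; exact: measurable_rV_cons.
Qed.

Lemma measurable_shiftC d (v : Cspace R d) :
  measurable_fun setT (fun z : Cspace R d => z + v).
Proof.
apply: measurable_fun_pair.
- exact: (measurableT_comp (measurable_shift_rV v.1) measurable_fst).
- exact: (measurableT_comp (measurable_shift_rV v.2) measurable_snd).
Qed.

Lemma lebesgue_C_shift d (v : Cspace R d) (A : set (Cspace R d)) :
  measurable A ->
  lebesgue_C ((fun z => z + v) @^-1` A) = lebesgue_C A.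
Proof.
move=> mA; rewrite /lebesgue_C.
apply: (@product_measure_preimage _ _ _ _ (lebesgue_rV d) (lebesgue_rV d)
  (fun x => x + v.1) (fun x => x + v.2)) => //.
- exact: measurable_shift_rV.
- exact: measurable_shift_rV.
- by move=> B mB; exact: lebesgue_rV_shift.
- by move=> B mB; exact: lebesgue_rV_shift.
Qed.

Definition cube n (a b : R) : set 'rV[R]_n :=
  [set x | forall i, a <= x ord0 i <= b].

Lemma measurable_cube n a b : measurable (@cube n a b).
Proof.
rewrite (_ : cube _ _ = \bigcap_(i in [set: 'I_n])
    (setT `&` (fun x : 'rV[R]_n => x ord0 i) @^-1` `[a, b]%classic)).
  apply: fin_bigcap_measurable => // i _.
  by apply: measurable_coord => //; exact: measurable_itv.
apply/seteqP; split => x /=.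
  by move=> h i _; split => //=; rewrite in_itv/=.
by move=> h i; have /= := (h i Logic.I).2; rewrite in_itv.
Qed.

Lemma lebesgue_rV_cube n a b : a <= b ->
  lebesgue_rV n (@cube n a b) = ((b - a) ^+ n)%:E.
Proof.
move=> ab; elim: n => [|n IH].
  rewrite expr0 /= diracE (_ : _ \in _)// inE => -[]//.
rewrite /= /rV_step /pushforward.
rewrite (_ : _ @^-1` _ = `[a, b]%classic `*` @cube n a b); last first.
  apply/seteqP; split => -[x y] /=; rewrite /cube/= in_itv/=.
  - move=> h; split; first by have := h ord0; rewrite rV_cons0.
    by move=> i; have := h (rshift 1 i); rewrite rV_consS.
  - move=> [h1 h2]; apply: forall_ordS => [|j]; first by rewrite rV_cons0.
    by rewrite rV_consS.
rewrite product_measure1E//; last exact: measurable_cube.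
rewrite [X in (_ * X)%E]IH [X in (X * _)%E]lebesgue_measure_itv/= lte_fin exprS EFinM.
move: ab; rewrite le_eqVlt => /orP[/eqP <-|->]; last by rewrite -EFinB.
by rewrite ltxx subrr.
Qed.

Lemma lebesgue_C_cube d a b : a <= b ->
  lebesgue_C (@cube d a b `*` @cube d a b) = (((b - a) ^+ d) ^+ 2)%:E.
Proof.
move=> ab; rewrite /lebesgue_C/= product_measure1E; try exact: measurable_cube.
by rewrite [X in (X * _)%E]lebesgue_rV_cube// [X in (_ * X)%E]lebesgue_rV_cube// -EFinM.
Qed.

End translation.

Section Borel.
Context {R : realType} {d : nat}.
Local Notation Cd := (Cspace R d).

Definition grid (k : nat) (x : 'rV[R]_d) : 'rV[int]_d :=
  \row_i Num.floor (k.+1%:R * x ord0 i).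

Lemma measurable_grid k q : measurable [set x | grid k x = q].
Proof.
rewrite (_ : [set x | _] = \bigcap_(i in [set: 'I_d])
    (setT `&` (fun x : 'rV[R]_d => k.+1%:R * x ord0 i) @^-1`
       `[(q ord0 i)%:~R, (q ord0 i + 1)%:~R[%classic)).
  apply: fin_bigcap_measurable => // i _.
  have : measurable_fun setT (fun x : 'rV[R]_d => k.+1%:R * x ord0 i).
    apply: measurable_funM => //; exact: measurable_coord.
  by apply => //; exact: measurable_itv.
apply/seteqP; split => x /=.
  by move=> <- i _; split => //=; rewrite in_itv/= mxE floor_le floorD1_gt.
move=> h; apply/rowP => i; rewrite mxE; apply: floor_def.
by have /= := (h i Logic.I).2; rewrite in_itv.
Qed.

Lemma open_measurableC (U : set Cd) : open U -> measurable U.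
Proof.
move=> oU.
pose box (p : nat * ('rV[int]_d * 'rV[int]_d)) : set Cd :=
  [set x | grid p.1 x = p.2.1] `*` [set y | grid p.1 y = p.2.2].
have -> : U = \bigcup_p (if `[< box p `<=` U >] then box p else set0).
  apply/seteqP; split => z; last by move=> [p _]; case: asboolP => // + bz; exact.
  move=> Uz; have [e /= e0 eU] : nbhs_ball z U.
    by apply/nbhs_ballP; apply: open_nbhs_nbhs; split.
  pose k := Num.truncn e^-1.
  have ke : k.+1%:R^-1 < e.
    by rewrite invf_plt ?posrE// truncnS_gt.
  have close (x y : 'rV[R]_d) : grid k x = grid k y -> ball x e y.
    move=> /rowP g; split => // i j; rewrite ord1 /ball/=.
    have := g j; rewrite !mxE => gj.
    apply: lt_trans ke.
    rewrite -(ltr_pM2l (x:=k.+1%:R))// mulfV// -[X in X * _]ger0_norm// -normrM mulrBr.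
    have := floor_le (k.+1%:R * x ord0 j).
    have := floorD1_gt (k.+1%:R * x ord0 j).
    have := floor_le (k.+1%:R * y ord0 j).
    have := floorD1_gt (k.+1%:R * y ord0 j).
    rewrite gj intrD; move: (_%:~R) => m h1 h2 h3 h4.
    by rewrite ltr_norml; apply/andP; split; lra.
  exists (k, (grid k z.1, grid k z.2)) => //=; case: asboolP => // -[].
  by move=> y [/= y1 y2]; apply: eU; split; apply: close.
apply: countable_bigcupT_measurable => [|p]; first exact: countableP.
by case: asboolP => // _; apply: measurableX; exact: measurable_grid.
Qed.

Lemma continuous_measurableC (U : set Cd) (f : Cd -> R) : open U ->
  (forall z, U z -> {for z, continuous f}) -> measurable_fun U f.
Proof.
move=> oU cf; apply: (measurability _ (RGenOpens.measurableE R)).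
move=> _ [_ [a [b ->] <-]].
apply: open_measurableC.
rewrite openE => z [Uz /= fz].
apply: filterI; first exact: open_nbhs_nbhs.
by apply: cf => //; apply: open_nbhs_nbhs; split => //; exact: interval_open.
Qed.

Lemma coord_re_continuous (j : 'I_d) : continuous (fun z : Cd => z.1 ord0 j).
Proof.
move=> z; apply: (@continuous_comp _ _ _ fst (fun x : 'rV[R]_d => x ord0 j)).
  exact: cvg_fst.
exact: coord_continuous.
Qed.

Lemma coord_im_continuous (j : 'I_d) : continuous (fun z : Cd => z.2 ord0 j).
Proof.
move=> z; apply: (@continuous_comp _ _ _ snd (fun x : 'rV[R]_d => x ord0 j)).
  exact: cvg_snd.
exact: coord_continuous.
Qed.

Lemma sqnorm_continuous : continuous (@sqnorm R d).
Proof.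
rewrite /sqnorm => z; apply: cvg_big => [|j _]; first exact: add_continuous.
by under eq_fun do rewrite !expr2; apply: cvgD; apply: cvgM; (exact: coord_re_continuous || exact: coord_im_continuous).
Qed.

Lemma open_unit_ball : open (@unit_ball R d).
Proof.
rewrite (_ : unit_ball = @sqnorm R d @^-1` [set x | x < 1])//.
apply: open_comp; first by move=> z _; exact: sqnorm_continuous.
exact: open_lt.
Qed.

Lemma measurable_unit_ball : measurable (@unit_ball R d).
Proof. by apply: open_measurableC; exact: open_unit_ball. Qed.

Lemma sqnorm_ge0 (z : Cd) : 0 <= sqnorm z.
Proof. by apply: sumr_ge0 => j _; rewrite addr_ge0// sqr_ge0. Qed.

Lemma sqr_coord_le (z : Cd) j : (z.1 ord0 j) ^+ 2 + (z.2 ord0 j) ^+ 2 <= sqnorm z.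
Proof.
rewrite /sqnorm (bigD1 j)//= lerDl; apply: sumr_ge0 => i _.
by rewrite addr_ge0// sqr_ge0.
Qed.

Lemma unit_ball_cube : @unit_ball R d `<=` @cube R d (-1) 1 `*` @cube R d (-1) 1.
Proof.
move=> z z1; split => j /=; rewrite -ler_norml -(@expr_le1 _ 2)// real_normK ?num_real//;
  apply: ltW; apply: le_lt_trans z1; apply: le_trans (sqr_coord_le z j).
- by rewrite lerDl sqr_ge0.
- by rewrite lerDr sqr_ge0.
Qed.

Lemma lebesgue_C_ball_lty : (lebesgue_C (@unit_ball R d) < +oo)%E.
Proof.
apply: (@le_lt_trans _ _ (lebesgue_C (@cube R d (-1) 1 `*` @cube R d (-1) 1))).
  apply: le_measure; rewrite ?inE; [exact: measurable_unit_ball| |exact: unit_ball_cube].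
  by apply: measurableX; exact: measurable_cube.
by rewrite lebesgue_C_cube ?ltry// gerN// lerN10.
Qed.

End Borel.

(** * Integrals of derivatives of compactly supported functions *)

Section Rdominated.
Context {R : realType} d {T : measurableType d} (mu : {measure set T -> \bar R}).
Variables (D : set T) (f_ : nat -> T -> R) (f g : T -> R).
Hypothesis mD : measurable D.
Hypothesis mf_ : forall n, measurable_fun D (f_ n).
Hypothesis f_f : forall x, D x -> f_ n x @[n --> \oo] --> f x.
Hypothesis ig : mu.-integrable D (EFin \o g).
Hypothesis f_g : forall n x, D x -> `|f_ n x| <= g x.

Lemma Rdominated_convergence : mu.-integrable D (EFin \o f) /\
  Rintegral mu D (f_ n) @[n --> \oo] --> Rintegral mu D f.
Proof.
have mf : measurable_fun D f by exact: (measurable_fun_cvg mf_ f_f).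
have mEf n : measurable_fun D (EFin \o f_ n) by exact/measurable_EFinP.
have mEf' : measurable_fun D (EFin \o f) by exact/measurable_EFinP.
have cE : {ae mu, forall x, D x -> (EFin \o f_ n) x @[n --> \oo] --> (EFin \o f) x}.
  apply: aeW => x Dx; apply: cvg_EFin; first by apply: nearW.
  exact: f_f.
have bE : {ae mu, forall x n, D x -> (`|(EFin \o f_ n) x| <= (EFin \o g) x)%E}.
  by apply: aeW => x n Dx /=; rewrite lee_fin; exact: f_g.
have [intf _ cf] := @dominated_convergence _ _ _ mu D mD (fun n => EFin \o f_ n)
  (EFin \o f) (EFin \o g) mEf mEf' cE ig bE.
split => //; apply: fine_cvg; rewrite fineK//.
exact: integrable_fin_num.
Qed.

End Rdominated.

Section ibp.
Context {R : realType} {d : nat}.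
Local Notation Cd := (Cspace R d).
Local Notation mu := (@lebesgue_C R d).
Local Notation ball := (@unit_ball R d).

Lemma compact_cube (a b : R) : compact (@cube R d a b `*` @cube R d a b).
Proof.
have h : compact (@cube R d a b).
  rewrite (_ : @cube R d a b = [set v | forall i, `[a, b]%classic (v ord0 i)]).
    by apply: (@rV_compact R d (fun=> `[a, b]%classic)) => _; exact: segment_compact.
  by apply/seteqP; split => x /= h i; have := h i; rewrite in_itv.
exact: compact_setX.
Qed.

Lemma sqnorm_le_cube (r : R) (z : Cd) : sqnorm z <= r ->
  (@cube R d (- (1 + r)) (1 + r) `*` @cube R d (- (1 + r)) (1 + r)) z.
Proof.
move=> zr; have r0 := le_trans (sqnorm_ge0 z) zr.
have r1 : r <= (1 + r) ^+ 2 by nra.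
have h (x : R) : x ^+ 2 <= sqnorm z -> - (1 + r) <= x <= 1 + r.
  move=> xz; rewrite -ler_norml -ler_sqr ?nnegrE ?addr_ge0// real_normK ?num_real//.
  exact: le_trans xz (le_trans zr r1).
split => j /=; apply: h; apply: le_trans (sqr_coord_le z j).
- by rewrite lerDl sqr_ge0.
- by rewrite lerDr sqr_ge0.
Qed.

Lemma compact_sqnorm_le (r : R) : compact [set z : Cd | sqnorm z <= r].
Proof.
apply: (subclosed_compact _ (@compact_cube (- (1 + r)) (1 + r))).
  apply: (@closed_comp _ _ (@sqnorm R d) [set x | x <= r]) => [z _|].
    exact: sqnorm_continuous.
  exact: closed_le.
by move=> z; exact: sqnorm_le_cube.
Qed.

Lemma continuous_bounded_on (A : set Cd) (f : Cd -> R) : compact A ->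
  (forall z, A z -> {for z, continuous f}) ->
  exists M, 0 <= M /\ forall z, A z -> `|f z| <= M.
Proof.
move=> cA cf.
have /ex_strict_bound_gt0[M M0 /= h] : bounded_set (f @` A).
  apply/compact_bounded/continuous_compact => //.
  apply: continuous_in_subspaceT => z /[!inE]; exact: cf.
by exists M; split => [|z Az]; [exact: ltW|apply/ltW/h; exists z].
Qed.

Lemma bounded_integrable_ball (f : Cd -> R) (M : R) : measurable_fun ball f ->
  (forall z, ball z -> `|f z| <= M) -> mu.-integrable ball (EFin \o f).
Proof.
move=> mf fM; apply: measurable_bounded_integrable => //.
- exact: measurable_unit_ball.
- exact: lebesgue_C_ball_lty.
- exists M; split; first exact: num_real.
  by move=> x Mx z Bz; apply: le_trans (fM z Bz) (ltW Mx).
Qed.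

Lemma is_derive_line (u : Cd -> R) (z v : Cd) (t : R) :
  derivable u (z + t *: v) v ->
  is_derive t 1 (fun s : R => u (z + s *: v)) ('D_v u (z + t *: v)).
Proof.
move=> du.
have E : (fun h : R => h^-1 *: (((fun s : R => u (z + s *: v)) \o shift t) (h *: 1) -
     (fun s : R => u (z + s *: v)) t)) =
  (fun h : R => h^-1 *: ((u \o shift (z + t *: v)) (h *: v) - u (z + t *: v))).
  apply/funext => h /=; congr (_ *: (u _ - _)).
  by rewrite scalerDl addrCA [h *: 1]mulr1.
by split; rewrite /derivable /derive E.
Qed.

Lemma mean_value_bound (u : Cd -> R) (v : Cd) (M : R) :
  (forall z, derivable u z v) -> (forall z, `|'D_v u z| <= M) ->
  forall z t, `|u (z + t *: v) - u z| <= M * `|t|.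
Proof.
move=> du bu z t.
wlog t0 : z t / 0 <= t => [hw|].
  have [/hw//|t0] := leP 0 t.
  have := hw (z + t *: v) (- t); rewrite -addrA -scalerDl subrr scale0r addr0.
  by rewrite distrC normrN; apply; lra.
have [c _] := @MVT_segment R (fun s => u (z + s *: v)) (fun s => 'D_v u (z + s *: v))
  0 t t0 (fun s _ => is_derive_line (du _)) (derivable_within_continuous
  (fun s _ => @ex_derive _ _ _ _ _ _ _ (is_derive_line (du (z + s *: v))))).
rewrite scale0r addr0 subr0 => ->; rewrite normrM.
by rewrite ler_wpM2r.
Qed.

Lemma measurable_continuousC (f : Cd -> R) : continuous f -> measurable_fun setT f.
Proof. by move=> cf; apply: continuous_measurableC => [|z _]; [exact: openT|exact: cf]. Qed.

Lemma integrable_bounded_support (f : Cd -> R) (a M : R) : 0 <= a ->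
  measurable_fun setT f ->
  (forall z, `|f z| <= M) ->
  (forall z, ~ (@cube R d (- a) a `*` @cube R d (- a) a) z -> f z = 0) ->
  mu.-integrable setT (EFin \o f).
Proof.
move=> a0 mf fM f0; set K := _ `*` _ in f0.
have mK : measurable K by apply: measurableX; exact: measurable_cube.
have -> : EFin \o f = (EFin \o f) \_ K.
  apply/funext => z; rewrite patchE; case: ifPn => //.
  by rewrite notin_setE => /f0 /= ->.
apply/(integrable_mkcond _ mK); apply: measurable_bounded_integrable => //.
- by rewrite /K [X in (X < _)%E]lebesgue_C_cube ?ltry//; lra.
- exact: measurable_funTS.
- exists M; split; first exact: num_real.
  by move=> x Mx z Kz; apply: le_trans (fM z) (ltW Mx).
Qed.

Lemma Rintegral_shift (f : Cd -> R) (v : Cd) : measurable_fun setT f ->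
  mu.-integrable setT (EFin \o (fun z => f (z + v))) ->
  Rintegral mu setT (fun z => f (z + v)) = Rintegral mu setT f.
Proof.
move=> mf intf; rewrite /Rintegral; congr fine.
have := @integral_pushforward _ _ _ _ R _ (measurable_shiftC v) mu setT (EFin \o f)
  ((measurable_EFinP _ _).2 mf).
rewrite preimage_setT => /(_ intf measurableT) <-.
apply: eq_measure_integral; first exact: measurable_shiftC.
by move=> mD A mA _; exact: lebesgue_C_shift.
Qed.

Lemma derive_out (u : Cd -> R) (v : Cd) (b : R) :
  (forall z, b < sqnorm z -> u z = 0) -> forall z, b < sqnorm z -> 'D_v u z = 0.
Proof.
move=> u0 z bz; rewrite -(@derive_cst R Cd R 0 z v).
apply: near_eq_derive.
have : open [set z : Cd | b < sqnorm z].
  apply: (@open_comp _ _ (@sqnorm R d) [set x | b < x]) => [y _|].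
    exact: sqnorm_continuous.
  exact: open_gt.
move=> ob; have : nbhs z [set y : Cd | b < sqnorm y] by apply: open_nbhs_nbhs; split.
by apply: filterS; exact: u0.
Qed.

Lemma Rintegral_ball_setT (f : Cd -> R) : (forall z, ~ ball z -> f z = 0) ->
  Rintegral mu ball f = Rintegral mu setT f.
Proof.
move=> f0; rewrite Rintegral_mkcond; congr (Rintegral _ _ _); apply/funext => z.
by rewrite patchE; case: ifPn => //; rewrite notin_setE => /f0.
Qed.

Lemma Rintegral_derive0 (u : Cd -> R) (v : Cd) (b : R) : b < 1 ->
  continuous u -> (forall z, derivable u z v) -> continuous ('D_v u) ->
  (forall z, b < sqnorm z -> u z = 0) ->
  Rintegral mu ball ('D_v u) = 0.
Proof.
move=> b1 cu du cdu u0.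
have du0 := derive_out v u0.
rewrite Rintegral_ball_setT; last first.
  by move=> z /negP zb; apply: du0; move: zb; rewrite -leNgt; exact: lt_le_trans.
have [M0 [M00 uM]] : exists M, 0 <= M /\ forall z, `|u z| <= M.
  have [M [M0 h]] := continuous_bounded_on (@compact_sqnorm_le b) (fun z _ => cu z).
  exists M; split => // z; have [/h//|/u0 ->] := leP (sqnorm z) b.
  by rewrite normr0.
have [M1 [M10 duM]] : exists M, 0 <= M /\ forall z, `|'D_v u z| <= M.
  have [M [M0' h]] := continuous_bounded_on (@compact_sqnorm_le b) (fun z _ => cdu z).
  exists M; split => // z; have [/h//|/du0 ->] := leP (sqnorm z) b.
  by rewrite normr0.
pose a := 2 + `|b| + `|v.1| + `|v.2|.
have a0 : 0 <= a by rewrite !addr_ge0.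
pose K := @cube R d (- a) a `*` @cube R d (- a) a.
have u0K (t : R) z : `|t| <= 1 -> ~ K z -> u (z + t *: v) = 0.
  move=> t1 Kz; apply: u0; rewrite ltNge; apply/negP => /sqnorm_le_cube h; apply: Kz.
  have bb := ler_norm b.
  have v1 j : `|v.1 ord0 j| <= `|v.1|.
    by rewrite [leRHS]mx_normrE (le_bigmax _ (fun i => `|v.1 i.1 i.2|) (ord0, j)).
  have v2 j : `|v.2 ord0 j| <= `|v.2|.
    by rewrite [leRHS]mx_normrE (le_bigmax _ (fun i => `|v.2 i.1 i.2|) (ord0, j)).
  have n1 := normr_ge0 v.1. have n2 := normr_ge0 v.2.
  split => j; rewrite -ler_norml.
  - have := h.1 j; rewrite -ler_norml /= !mxE => hj.
    rewrite -[X in `|X|](addrK (t * v.1 ord0 j)); apply: le_trans (ler_normB _ _) _.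
    have : `|t * v.1 ord0 j| <= `|v.1|.
      by rewrite normrM; apply: le_trans (v1 j); rewrite ler_piMl.
    by rewrite /a; lra.
  - have := h.2 j; rewrite -ler_norml /= !mxE => hj.
    rewrite -[X in `|X|](addrK (t * v.2 ord0 j)); apply: le_trans (ler_normB _ _) _.
    have : `|t * v.2 ord0 j| <= `|v.2|.
      by rewrite normrM; apply: le_trans (v2 j); rewrite ler_piMl.
    by rewrite /a; lra.
have mu_ := measurable_continuousC cu.
have mus (w : Cd) : measurable_fun setT (fun z : Cd => u (z + w)).
  exact: (measurableT_comp mu_ (measurable_shiftC w)).
have iu (t : R) : `|t| <= 1 -> mu.-integrable setT (EFin \o (fun z => u (z + t *: v))).
  move=> t1; apply: (@integrable_bounded_support _ a M0) => // z.
  exact: u0K.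
pose U k z := k.+1%:R * (u (z + k.+1%:R^-1 *: v) - u z).
have k1 k : `|k.+1%:R^-1 : R| <= 1 by rewrite ger0_norm// invf_le1 ?ler1n.
have iu0 : mu.-integrable setT (EFin \o u).
  have := iu 0; rewrite normr0 ler01 => /(_ isT).
  by congr (mu.-integrable _ (EFin \o _)); apply/funext => z; rewrite scale0r addr0.
have U0 k : Rintegral mu setT (U k) = 0.
  rewrite /U RintegralZl//.
    rewrite RintegralB//; last exact: iu.
    by rewrite Rintegral_shift ?subrr ?mulr0//; exact: iu.
  exact: (integrableB _ (iu _ (k1 k)) iu0).
have UM k z : `|U k z| <= M1.
  rewrite /U normrM ger0_norm// mulrC -ler_pdivlMr//.
  apply: le_trans (mean_value_bound du duM _ _) _.
  by rewrite ger0_norm.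
have [||||iD cvgD] := @Rdominated_convergence R _ _ mu setT U ('D_v u) (fun z => M1 * \1_K z) measurableT.
- move=> k; apply: measurable_funM => //.
  exact: measurable_funB.
- move=> z _.
  have /cvg_ex[l hl] := du z.
  have -> : 'D_v u z = l by apply/cvg_lim.
  have /cvgr_dnbhsP := hl => /(_ (fun k => k.+1%:R^-1)) h.
  have : (forall n : nat, (n.+1%:R^-1 : R) != 0) /\ (n.+1%:R^-1 : R) @[n --> \oo] --> 0.
    split; first by move=> n; rewrite invr_neq0.
    exact: cvg_harmonic.
  move/h; apply: cvg_trans; apply: near_eq_cvg; apply: nearW => k /=.
  by rewrite /U invrK; congr (_ * (u _ - _)); rewrite addrC.
- apply: (@integrable_bounded_support _ a M1) => //.
  + apply: measurable_funM => //.
    apply: measurable_indic; apply: measurableX; exact: measurable_cube.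
  + move=> z; rewrite indicE; case: (_ \in _) => /=; rewrite ?mulr1 ?mulr0 ?normr0//.
    by rewrite ger0_norm.
  + by move=> z Kz; rewrite indicE memNset// mulr0.
- move=> k z _; rewrite indicE; case: (boolP (z \in K)) => [|/negP Kz]; rewrite ?mulr1//.
  rewrite mulr0 /U (u0K _ _ (k1 k)); last by move=> ?; apply: Kz; rewrite inE.
  have := @u0K 0 z; rewrite scale0r addr0 normr0 ler01 => /(_ isT) ->.
    by rewrite subrr mulr0 normr0.
  by move=> ?; apply: Kz; rewrite inE.
have : (fun n : nat => 0 : R) @ \oo --> Rintegral mu setT ('D_v u).
  by move: cvgD; under eq_fun do rewrite U0.
by move=> /(cvg_unique _ (@cvg_cst _ _ _ _ _)) => <-.
Qed.

End ibp.

(** * Wirtinger calculus *)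

Section ring_identities.
Variable K : comPzRingType.
Implicit Types a b c e f g i h : K.
Lemma wirtD a b c e i h : (a + b + i * (c + e)) * h = (a + i * c) * h + (b + i * e) * h.
Proof. by ring. Qed.
Lemma wirtM a b c e f g i h : (a * g + f * b + i * (c * g + f * e)) * h =
  (a + i * c) * h * g + f * ((b + i * e) * h).
Proof. by ring. Qed.
End ring_identities.

Section complex_parts.
Context {R : realType}.
Implicit Types x y : R[i].
Lemma ReCD x y : complex.Re (x + y) = complex.Re x + complex.Re y.
Proof. by case: x y => ? ? []. Qed.
Lemma ImCD x y : complex.Im (x + y) = complex.Im x + complex.Im y.
Proof. by case: x y => ? ? []. Qed.
Lemma ReCN x : complex.Re (- x) = - complex.Re x. Proof. by case: x. Qed.
Lemma ImCN x : complex.Im (- x) = - complex.Im x. Proof. by case: x. Qed.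
Lemma ReCM x y :
  complex.Re (x * y) = complex.Re x * complex.Re y - complex.Im x * complex.Im y.
Proof. by case: x y => ? ? []. Qed.
Lemma ImCM x y :
  complex.Im (x * y) = complex.Re x * complex.Im y + complex.Im x * complex.Re y.
Proof. by case: x y => a b [c e]; rewrite /=; ring. Qed.
Lemma ReCJ x : complex.Re (conjc x) = complex.Re x. Proof. by case: x. Qed.
Lemma ImCJ x : complex.Im (conjc x) = - complex.Im x. Proof. by case: x. Qed.
Lemma complexP x y : complex.Re x = complex.Re y -> complex.Im x = complex.Im y -> x = y.
Proof. by case: x y => ? ? [] ? ? /= -> ->. Qed.
Lemma conjcM x y : conjc (x * y) = conjc x * conjc y.
Proof. by apply: complexP; rewrite ?(ReCJ, ImCJ, ReCM, ImCM); ring. Qed.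
Lemma conjcD x y : conjc (x + y) = conjc x + conjc y.
Proof. by apply: complexP; rewrite ?(ReCJ, ImCJ, ReCD, ImCD)//; ring. Qed.
Lemma conjcN x : conjc (- x) = - conjc x.
Proof. by apply: complexP; rewrite ?(ReCJ, ImCJ, ReCN, ImCN). Qed.
Lemma conjc_sum (I : Type) (s : seq I) (P : pred I) (F : I -> R[i]) :
  conjc (\sum_(i <- s | P i) F i) = \sum_(i <- s | P i) conjc (F i).
Proof. by elim/big_rec2: _ => [|i y1 y2 _ <-]; rewrite ?conjcD// conjc0. Qed.
Lemma Re_real (r : R) : complex.Re (r%:C) = r. Proof. by []. Qed.
Lemma Im_real (r : R) : complex.Im (r%:C) = 0. Proof. by []. Qed.
End complex_parts.

Section derive_rules.
Context {R : realType} {V : normedModType R}.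
Implicit Types (z v : V).

Lemma is_derive_addf (f g : V -> R) z v a b : is_derive z v f a -> is_derive z v g b ->
  is_derive z v (fun w => f w + g w) (a + b).
Proof. exact: is_deriveD. Qed.

Lemma is_derive_mulf (f g : V -> R) z v a b : is_derive z v f a -> is_derive z v g b ->
  is_derive z v (fun w => f w * g w) (a * g z + f z * b).
Proof.
move=> hf hg; apply: is_derive_eq (is_deriveM hf hg) _.
by rewrite /GRing.scale/= addrC [a * _]mulrC.
Qed.

Lemma is_derive_oppf (f : V -> R) z v a : is_derive z v f a ->
  is_derive z v (fun w => - f w) (- a).
Proof. exact: is_deriveN. Qed.

Lemma is_derive_sumf n (f : 'I_n -> V -> R) z v (a : 'I_n -> R) :
  (forall i, is_derive z v (f i) (a i)) ->
  is_derive z v (fun w => \sum_(i < n) f i w) (\sum_(i < n) a i).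
Proof.
elim: n f a => [|n IH] f a h.
  rewrite big_ord0; under eq_fun do rewrite big_ord0; exact: is_derive_cst.
rewrite big_ord_recl; under eq_fun do rewrite big_ord_recl.
by apply: is_derive_addf => //; apply: IH.
Qed.

Lemma is_derive_dirP (u : V -> R) z v (l : R) : is_derive z v u l <->
  is_derive (0 : R) (1 : R) (fun h : R => u (h *: v + z)) l.
Proof.
have EE : (fun h : R => h^-1 *: (((fun h : R => u (h *: v + z)) \o shift 0) (h *: 1)
    - (fun h : R => u (h *: v + z)) 0)) =
    (fun h : R => h^-1 *: ((u \o shift z) (h *: v) - u z)).
  apply/funext => h /=; rewrite scale0r add0r addr0.
  by rewrite [h *: 1]mulr1.
split => -[h1 h2]; split; move: h1 h2; rewrite /derivable /derive.
- by rewrite -EE.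
- by rewrite -EE.
- by rewrite EE.
- by rewrite EE.
Qed.

Lemma is_derive_comp1 (k : R -> R) (s : V -> R) z v dk ds :
  is_derive (s z) (1 : R) k dk -> is_derive z v s ds -> is_derive z v (k \o s) (dk * ds).
Proof.
move=> hk /is_derive_dirP hs; apply/is_derive_dirP.
apply: (@is_derive1_comp _ k (fun h : R => s (h *: v + z))).
by rewrite scale0r add0r.
Qed.

End derive_rules.

Section calculus.
Context {R : realType} {d : nat}.
Local Notation Cd := (Cspace R d).
Local Notation ball := (@unit_ball R d).
Implicit Types (F G f g : Cd -> R[i]) (z v : Cd).

Lemma is_derive_affine (L : Cd -> R) z v :
  (forall h : R, L (h *: v + z) = h * L v + L z) -> is_derive z v L (L v).
Proof.
move=> LE.
have cL : h^-1 *: ((L \o shift z) (h *: v) - L z) @[h --> 0^'] --> L v.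
  apply: cvg_near_cst; near=> h => /=.
  rewrite LE addrK scalerA mulVf ?scale1r//.
  by near: h; exact: nbhs_dnbhs_neq.
split; first by apply/cvg_ex; exists (L v).
exact/cvg_lim.
Unshelve. all: by end_near. Qed.

Lemma is_derive_re_coord z v j : is_derive z v (fun w : Cd => w.1 ord0 j) (v.1 ord0 j).
Proof. by apply: (@is_derive_affine (fun w : Cd => w.1 ord0 j)) => h; rewrite /= !mxE. Qed.

Lemma is_derive_im_coord z v j : is_derive z v (fun w : Cd => w.2 ord0 j) (v.2 ord0 j).
Proof. by apply: (@is_derive_affine (fun w : Cd => w.2 ord0 j)) => h; rewrite /= !mxE. Qed.

Lemma is_derive_sqnorm z v : is_derive z v (@sqnorm R d)
  (\sum_(j < d) (2 * (z.1 ord0 j * v.1 ord0 j + z.2 ord0 j * v.2 ord0 j))).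
Proof.
rewrite /sqnorm; apply: is_derive_sumf => j; under eq_fun do rewrite !expr2.
have h1 := is_derive_re_coord z v j; have h2 := is_derive_im_coord z v j.
apply: is_derive_eq (is_derive_addf (is_derive_mulf h1 h1) (is_derive_mulf h2 h2)) _.
by ring.
Qed.

Definition is_deriveC z v F (l : R[i]) :=
  is_derive z v (fun w => complex.Re (F w)) (complex.Re l) /\
  is_derive z v (fun w => complex.Im (F w)) (complex.Im l).

Lemma is_deriveC_val z v F l : is_deriveC z v F l -> deriveC v F z = l.
Proof.
by move=> [[_ h1] [_ h2]]; apply: complexP; rewrite /deriveC /= ?h1 ?h2.
Qed.

Lemma is_deriveC_ex z v F l : is_deriveC z v F l -> derivableC F z v.
Proof. by move=> [[h1 _] [h2 _]]; split. Qed.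

Lemma derivableCP z v F : derivableC F z v -> is_deriveC z v F (deriveC v F z).
Proof. by move=> [h1 h2]; split; exact: derivableP. Qed.

Lemma is_deriveC_cst z v c : is_deriveC z v (fun=> c) 0.
Proof. by split; exact: is_derive_cst. Qed.

Lemma is_deriveC_add z v F G l m : is_deriveC z v F l -> is_deriveC z v G m ->
  is_deriveC z v (fun w => F w + G w) (l + m).
Proof.
move=> [h1 h2] [h3 h4]; split; rewrite ?ReCD ?ImCD.
- by under eq_fun do rewrite ReCD; exact: is_deriveD.
- by under eq_fun do rewrite ImCD; exact: is_deriveD.
Qed.

Lemma is_deriveC_conj z v F l : is_deriveC z v F l ->
  is_deriveC z v (fun w => conjc (F w)) (conjc l).
Proof.
move=> [h1 h2]; split; rewrite ?ReCJ ?ImCJ.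
- by under eq_fun do rewrite ReCJ.
- by under eq_fun do rewrite ImCJ; exact: is_deriveN.
Qed.

Lemma is_deriveC_mul z v F G l m : is_deriveC z v F l -> is_deriveC z v G m ->
  is_deriveC z v (fun w => F w * G w) (l * G z + F z * m).
Proof.
move=> [h1 h2] [h3 h4]; split; rewrite ?ReCD ?ImCD ?ReCM ?ImCM.
- under eq_fun do rewrite ReCM.
  apply: is_derive_eq (is_derive_addf (is_derive_mulf h1 h3) (is_derive_oppf (is_derive_mulf h2 h4))) _.
  by ring.
- under eq_fun do rewrite ImCM.
  apply: is_derive_eq (is_derive_addf (is_derive_mulf h1 h4) (is_derive_mulf h2 h3)) _.
  by ring.
Qed.

Lemma is_deriveC_sum z v n (F : 'I_n -> Cd -> R[i]) l :
  (forall i, is_deriveC z v (F i) (l i)) ->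
  is_deriveC z v (fun w => \sum_(i < n) F i w) (\sum_(i < n) l i).
Proof.
elim: n F l => [|n IH] F l h.
  rewrite big_ord0; under eq_fun do rewrite big_ord0; exact: is_deriveC_cst.
rewrite big_ord_recl; under eq_fun do rewrite big_ord_recl.
by apply: is_deriveC_add => //; apply: IH.
Qed.

Lemma is_deriveC_real z v (u : Cd -> R) l : is_derive z v u l ->
  is_deriveC z v (fun w => (u w)%:C) l%:C.
Proof. by move=> h; split => //=; exact: is_derive_cst. Qed.

Lemma is_deriveC_coord z v j :
  is_deriveC z v (fun w => coordC w j) (coordC v j).
Proof. by split => /=; [exact: is_derive_re_coord|exact: is_derive_im_coord]. Qed.

Lemma is_deriveC_near z v F G l : (\near z, F z = G z) ->
  is_deriveC z v F l -> is_deriveC z v G l.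
Proof.
move=> FG [h1 h2]; split.
- by apply: near_eq_is_derive h1; apply: filterS FG => w ->.
- by apply: near_eq_is_derive h2; apply: filterS FG => w ->.
Qed.

Lemma near_deriveC z v F G : (\near z, F z = G z) -> deriveC v F z = deriveC v G z.
Proof.
move=> FG; rewrite /deriveC; congr (_ +i* _); apply: near_eq_derive;
  by apply: filterS FG => w ->.
Qed.

Lemma near_derivableC z v F G : (\near z, F z = G z) ->
  derivableC F z v -> derivableC G z v.
Proof.
by move=> FG /derivableCP h; apply: is_deriveC_ex; exact: is_deriveC_near FG h.
Qed.

Lemma near_continuousC z F G : (\near z, F z = G z) ->
  continuousC_at F z -> continuousC_at G z.
Proof.
move=> FG [h1 h2]; have FGz := nbhs_singleton FG.
split; rewrite /prop_for /continuous_at -FGz; [apply: cvg_trans h1|apply: cvg_trans h2];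
  by apply: near_eq_cvg; apply: filterS FG => w ->.
Qed.

Lemma near_ball z F G : ball z -> (forall w, ball w -> F w = G w) -> \near z, F z = G z.
Proof.
move=> zb FG; have : nbhs z ball by apply: open_nbhs_nbhs; split=> //; exact: open_unit_ball.
by apply: filterS.
Qed.

Lemma continuousCP F z : continuousC_at F z <->
  (complex.Re (F w) @[w --> z] --> complex.Re (F z)) /\
  (complex.Im (F w) @[w --> z] --> complex.Im (F z)).
Proof. by split. Qed.

Lemma continuousC_add z F G : continuousC_at F z -> continuousC_at G z ->
  continuousC_at (fun w => F w + G w) z.
Proof.
move=> /continuousCP[h1 h2] /continuousCP[h3 h4]; apply/continuousCP; split.
- by under eq_fun do rewrite ReCD; rewrite ReCD; exact: cvgD.
- by under eq_fun do rewrite ImCD; rewrite ImCD; exact: cvgD.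
Qed.

Lemma continuousC_mul z F G : continuousC_at F z -> continuousC_at G z ->
  continuousC_at (fun w => F w * G w) z.
Proof.
move=> /continuousCP[h1 h2] /continuousCP[h3 h4]; apply/continuousCP; split.
- by under eq_fun do rewrite ReCM; rewrite ReCM; apply: cvgB; apply: cvgM.
- by under eq_fun do rewrite ImCM; rewrite ImCM; apply: cvgD; apply: cvgM.
Qed.

Lemma continuousC_conj z F : continuousC_at F z ->
  continuousC_at (fun w => conjc (F w)) z.
Proof.
move=> /continuousCP[h1 h2]; apply/continuousCP; split.
- by under eq_fun do rewrite ReCJ; rewrite ReCJ.
- by under eq_fun do rewrite ImCJ; rewrite ImCJ; exact: cvgN.
Qed.

Lemma continuousC_real z (u : Cd -> R) : {for z, continuous u} ->
  continuousC_at (fun w => (u w)%:C) z.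
Proof. by move=> h; split => //=; exact: cvg_cst. Qed.

Lemma continuousC_cst z c : continuousC_at (fun=> c) z.
Proof. by split; exact: cvg_cst. Qed.

Lemma continuousC_coord z j : continuousC_at (fun w => coordC w j) z.
Proof. by split; [exact: coord_re_continuous|exact: coord_im_continuous]. Qed.

Lemma Ck_cont k f : Ck k f -> forall z, ball z -> continuousC_at f z.
Proof. by case: k => [|k] []. Qed.

Lemma Ck_derivable k f z b j : Ck k.+1 f -> ball z -> derivableC f z (real_dir b j).
Proof. by move=> [_ /(_ b j) [h _]]; exact: h. Qed.

Lemma Ck_deriveC k f b j : Ck k.+1 f -> Ck k (deriveC (real_dir b j) f).
Proof. by move=> [_ /(_ b j) []]. Qed.

Lemma Ck_ext k f g : (forall z, ball z -> f z = g z) -> Ck k f -> Ck k g.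
Proof.
elim: k f g => [|k IH] f g fg [cf df]; split=> //;
  try by move=> z zb; exact: near_continuousC (near_ball zb fg) (cf z zb).
move=> b j.
have [h1 h2] := df b j; split.
  by move=> z zb; apply: near_derivableC (near_ball zb fg) (h1 z zb).
by apply: IH h2 => z zb; exact: near_deriveC (near_ball zb fg).
Qed.

Lemma CkS k f : Ck k.+1 f -> Ck k f.
Proof.
elim: k f => [|k IH] f [cf df]; split => // b j.
by have [h1 h2] := df b j; split => //; exact: IH.
Qed.

Lemma Ck_le k l f : (k <= l)%N -> Ck l f -> Ck k f.
Proof.
move=> /subnK <-; elim: (l - k)%N => // m IH; rewrite addSn => /CkS; exact: IH.
Qed.

Lemma Ck_build k f (Df : bool -> 'I_d -> Cd -> R[i]) :
  (forall z, ball z -> continuousC_at f z) ->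
  (forall b j z, ball z -> is_deriveC z (real_dir b j) f (Df b j z)) ->
  (forall b j, Ck k (Df b j)) -> Ck k.+1 f.
Proof.
move=> cf df cD; split => // b j; split.
  by move=> z zb; exact: is_deriveC_ex (df b j z zb).
by apply: Ck_ext (cD b j) => z zb; rewrite (is_deriveC_val (df b j z zb)).
Qed.

Lemma Ck_cst k c : Ck k (fun _ : Cd => c : R[i]).
Proof.
elim: k c => [|k IH] c; first by split => // z _; exact: continuousC_cst.
apply: (@Ck_build k _ (fun _ _ _ => 0)) => // [z _|b j z _].
- exact: continuousC_cst.
- exact: is_deriveC_cst.
Qed.

Lemma Ck_add k f g : Ck k f -> Ck k g -> Ck k (fun z => f z + g z).
Proof.
elim: k f g => [|k IH] f g hf hg.
  by split => // z zb; apply: continuousC_add; [apply: Ck_cont hf _ _|apply: Ck_cont hg _ _].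
apply: (@Ck_build k _ (fun b j z => deriveC (real_dir b j) f z + deriveC (real_dir b j) g z)).
- by move=> z zb; apply: continuousC_add; [apply: Ck_cont hf _ _|apply: Ck_cont hg _ _].
- by move=> b j z zb; apply: is_deriveC_add; apply: derivableCP;
    [exact: Ck_derivable hf zb|exact: Ck_derivable hg zb].
- by move=> b j; apply: IH; exact: Ck_deriveC.
Qed.

Lemma Ck_mul k f g : Ck k f -> Ck k g -> Ck k (fun z => f z * g z).
Proof.
elim: k f g => [|k IH] f g hf hg.
  by split => // z zb; apply: continuousC_mul; [apply: Ck_cont hf _ _|apply: Ck_cont hg _ _].
apply: (@Ck_build k _ (fun b j z => deriveC (real_dir b j) f z * g z +
    f z * deriveC (real_dir b j) g z)).
- by move=> z zb; apply: continuousC_mul; [apply: Ck_cont hf _ _|apply: Ck_cont hg _ _].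
- by move=> b j z zb; apply: is_deriveC_mul; apply: derivableCP;
    [exact: Ck_derivable hf zb|exact: Ck_derivable hg zb].
- move=> b j; apply: Ck_add; apply: IH; do ?[exact: Ck_deriveC|exact: CkS].
Qed.

Lemma Ck_conj k f : Ck k f -> Ck k (fun z => conjc (f z)).
Proof.
elim: k f => [|k IH] f hf.
  by split => // z zb; apply: continuousC_conj; apply: Ck_cont hf _ _.
apply: (@Ck_build k _ (fun b j z => conjc (deriveC (real_dir b j) f z))).
- by move=> z zb; apply: continuousC_conj; apply: Ck_cont hf _ _.
- by move=> b j z zb; apply: is_deriveC_conj; apply: derivableCP; exact: Ck_derivable hf zb.
- by move=> b j; apply: IH; exact: Ck_deriveC.
Qed.

Lemma Ck_coord k j : Ck k (fun z : Cd => coordC z j).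
Proof.
case: k => [|k]; first by split => // z _; exact: continuousC_coord.
apply: (@Ck_build k _ (fun b i _ => coordC (real_dir b i) j)).
- by move=> z _; exact: continuousC_coord.
- by move=> b i z _; exact: is_deriveC_coord.
- by move=> b i; exact: Ck_cst.
Qed.

Lemma Ck_sum k n (F : 'I_n -> Cd -> R[i]) :
  (forall i, Ck k (F i)) -> Ck k (fun z => \sum_(i < n) F i z).
Proof.
elim: n F => [|n IH] F h.
  by under eq_fun do rewrite big_ord0; exact: Ck_cst.
by under eq_fun do rewrite big_ord_recl; apply: Ck_add => //; exact: IH.
Qed.

Lemma Ck_dz k f j : Ck k.+1 f -> Ck k (dz j f).
Proof.
move=> hf; apply: Ck_mul; last exact: Ck_cst.
apply: Ck_add; first exact: Ck_deriveC.
under eq_fun do rewrite -mulNr; apply: Ck_mul; [exact: Ck_cst|exact: Ck_deriveC].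
Qed.

Lemma Ck_dzbar k f j : Ck k.+1 f -> Ck k (dzbar j f).
Proof.
move=> hf; apply: Ck_mul; last exact: Ck_cst.
apply: Ck_add; first exact: Ck_deriveC.
apply: Ck_mul; [exact: Ck_cst|exact: Ck_deriveC].
Qed.

Lemma Ck_opN k f : Ck k.+1 f -> Ck k (opN f).
Proof.
by move=> hf; apply: Ck_sum => j; apply: Ck_mul; [exact: Ck_coord|exact: Ck_dz].
Qed.

Lemma Ck_opNbar k f : Ck k.+1 f -> Ck k (opNbar f).
Proof.
move=> hf; apply: Ck_sum => j; apply: Ck_mul; last exact: Ck_dzbar.
by apply: Ck_conj; exact: Ck_coord.
Qed.

Lemma dz_ext f g z j : ball z -> (forall w, ball w -> f w = g w) -> dz j f z = dz j g z.
Proof. by move=> zb fg; rewrite /dz !(near_deriveC _ (near_ball zb fg)). Qed.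

Lemma dzbar_ext f g z j : ball z -> (forall w, ball w -> f w = g w) ->
  dzbar j f z = dzbar j g z.
Proof. by move=> zb fg; rewrite /dzbar !(near_deriveC _ (near_ball zb fg)). Qed.

Lemma opN_ext f g z : ball z -> (forall w, ball w -> f w = g w) -> opN f z = opN g z.
Proof. by move=> zb fg; apply: eq_bigr => j _; rewrite (dz_ext _ zb fg). Qed.

Lemma opNbar_ext f g z : ball z -> (forall w, ball w -> f w = g w) ->
  opNbar f z = opNbar g z.
Proof. by move=> zb fg; apply: eq_bigr => j _; rewrite (dzbar_ext _ zb fg). Qed.

Definition diff1 z f := forall b j, derivableC f z (real_dir b j).

Lemma Ck_diff1 k f z : Ck k.+1 f -> ball z -> diff1 z f.
Proof. by move=> hf zb b j; exact: Ck_derivable hf zb. Qed.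

Lemma dz_add f g z j : diff1 z f -> diff1 z g ->
  dz j (fun w => f w + g w) z = dz j f z + dz j g z.
Proof.
move=> hf hg; rewrite /dz.
have h b := is_deriveC_val (is_deriveC_add (derivableCP (hf b j)) (derivableCP (hg b j))).
by rewrite !h -!mulNr wirtD.
Qed.

Lemma dzbar_add f g z j : diff1 z f -> diff1 z g ->
  dzbar j (fun w => f w + g w) z = dzbar j f z + dzbar j g z.
Proof.
move=> hf hg; rewrite /dzbar.
have h b := is_deriveC_val (is_deriveC_add (derivableCP (hf b j)) (derivableCP (hg b j))).
by rewrite !h wirtD.
Qed.

Lemma dz_mul f g z j : diff1 z f -> diff1 z g ->
  dz j (fun w => f w * g w) z = dz j f z * g z + f z * dz j g z.
Proof.
move=> hf hg; rewrite /dz.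
have h b := is_deriveC_val (is_deriveC_mul (derivableCP (hf b j)) (derivableCP (hg b j))).
by rewrite !h -!mulNr wirtM.
Qed.

Lemma dzbar_mul f g z j : diff1 z f -> diff1 z g ->
  dzbar j (fun w => f w * g w) z = dzbar j f z * g z + f z * dzbar j g z.
Proof.
move=> hf hg; rewrite /dzbar.
have h b := is_deriveC_val (is_deriveC_mul (derivableCP (hf b j)) (derivableCP (hg b j))).
by rewrite !h wirtM.
Qed.

Lemma conjc_half : conjc (2^-1 : R[i]) = 2^-1.
Proof. by rewrite conjc_inv conjc_nat. Qed.

Lemma dz_conj f z j : diff1 z f ->
  dz j (fun w => conjc (f w)) z = conjc (dzbar j f z).
Proof.
move=> hf; rewrite /dz /dzbar.
have h b := is_deriveC_val (is_deriveC_conj (derivableCP (hf b j))).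
rewrite !h conjcM conjc_half conjcD conjcM -mulNr; congr ((_ + _ * _) * _).
by apply: complexP; rewrite /= ?oppr0.
Qed.

Lemma dzbar_conj f z j : diff1 z f ->
  dzbar j (fun w => conjc (f w)) z = conjc (dz j f z).
Proof.
move=> hf; rewrite /dz /dzbar.
have h b := is_deriveC_val (is_deriveC_conj (derivableCP (hf b j))).
rewrite !h conjcM conjc_half conjcD conjcN conjcM -mulNr; congr ((_ + _ * _) * _).
by apply: complexP; rewrite /= ?oppr0 ?opprK.
Qed.

Lemma diff1_cst z c : diff1 z (fun=> c).
Proof. by move=> b j; exact: is_deriveC_ex (is_deriveC_cst z _ c). Qed.

Lemma dz_cst c z j : dz j (fun=> c) z = 0.
Proof. by rewrite /dz !(is_deriveC_val (is_deriveC_cst _ _ _)) mulr0 subr0 mul0r. Qed.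

Lemma dzbar_cst c z j : dzbar j (fun=> c) z = 0.
Proof. by rewrite /dzbar !(is_deriveC_val (is_deriveC_cst _ _ _)) mulr0 addr0 mul0r. Qed.

Lemma opN_add f g z : diff1 z f -> diff1 z g ->
  opN (fun w => f w + g w) z = opN f z + opN g z.
Proof.
move=> hf hg; rewrite /opN -big_split/=; apply: eq_bigr => j _.
by rewrite dz_add// mulrDr.
Qed.

Lemma opNbar_add f g z : diff1 z f -> diff1 z g ->
  opNbar (fun w => f w + g w) z = opNbar f z + opNbar g z.
Proof.
move=> hf hg; rewrite /opNbar -big_split/=; apply: eq_bigr => j _.
by rewrite dzbar_add// mulrDr.
Qed.

Lemma opN_mul f g z : diff1 z f -> diff1 z g ->
  opN (fun w => f w * g w) z = opN f z * g z + f z * opN g z.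
Proof.
move=> hf hg; rewrite /opN mulr_suml mulr_sumr -big_split/=; apply: eq_bigr => j _.
by rewrite dz_mul//; ring.
Qed.

Lemma opNbar_mul f g z : diff1 z f -> diff1 z g ->
  opNbar (fun w => f w * g w) z = opNbar f z * g z + f z * opNbar g z.
Proof.
move=> hf hg; rewrite /opNbar mulr_suml mulr_sumr -big_split/=; apply: eq_bigr => j _.
by rewrite dzbar_mul//; ring.
Qed.

Lemma opN_cst c z : opN (fun=> c) z = 0.
Proof. by rewrite /opN big1// => j _; rewrite dz_cst mulr0. Qed.

Lemma opNbar_cst c z : opNbar (fun=> c) z = 0.
Proof. by rewrite /opNbar big1// => j _; rewrite dzbar_cst mulr0. Qed.

Lemma opN_conj f z : diff1 z f ->
  opN (fun w => conjc (f w)) z = conjc (opNbar f z).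
Proof.
move=> hf; rewrite /opN /opNbar conjc_sum; apply: eq_bigr => j _.
rewrite dz_conj// [RHS]conjcM; congr (_ * _); by rewrite conjcK.
Qed.

Lemma opNbar_conj f z : diff1 z f ->
  opNbar (fun w => conjc (f w)) z = conjc (opN f z).
Proof.
move=> hf; rewrite /opN /opNbar conjc_sum; apply: eq_bigr => j _.
by rewrite dzbar_conj// [RHS]conjcM.
Qed.

Lemma dz_coord z i j : dz j (fun w => coordC w i) z = (i == j)%:R.
Proof.
rewrite /dz !(is_deriveC_val (is_deriveC_coord _ _ _)) /real_dir /coordC /= !mxE !eqxx/=.
case: (i == j) => /=.
- by apply: (@mulIf _ 2); rewrite ?divfK ?pnatr_eq0//; apply: complexP => /=; ring.
- by apply: (@mulIf _ 2); rewrite ?divfK ?pnatr_eq0//; apply: complexP => /=; ring.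
Qed.

Lemma dzbar_coord z i j : dzbar j (fun w => coordC w i) z = 0.
Proof.
rewrite /dzbar !(is_deriveC_val (is_deriveC_coord _ _ _)) /real_dir /coordC /= !mxE !eqxx/=.
case: (i == j) => /=.
- by apply: (@mulIf _ 2); rewrite ?divfK ?pnatr_eq0//; apply: complexP => /=; ring.
- by apply: (@mulIf _ 2); rewrite ?divfK ?pnatr_eq0//; apply: complexP => /=; ring.
Qed.

Lemma diff1_coord z i : diff1 z (fun w => coordC w i).
Proof. by move=> b j; exact: is_deriveC_ex (is_deriveC_coord z _ i). Qed.

Lemma sqnorm_coordE z : (sqnorm z)%:C = \sum_(j < d) coordC z j * conjc (coordC z j).
Proof.
rewrite /sqnorm rmorph_sum/=; apply: eq_bigr => j _.
by apply: complexP; rewrite /coordC/=; ring.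
Qed.

End calculus.

(** * Radial integration by parts *)

Section normc.
Context {R : realType}.
Implicit Types x y : R[i].

Lemma normc_ge0 x : 0 <= normc x.
Proof. by case: x => a b; exact: sqrtr_ge0. Qed.

Lemma sqr_normc x : normc x ^+ 2 = complex.Re x ^+ 2 + complex.Im x ^+ 2.
Proof. by case: x => a b /=; rewrite sqr_sqrtr// addr_ge0 ?sqr_ge0. Qed.

Lemma Re_le_normc x : `|complex.Re x| <= normc x.
Proof.
rewrite -ler_sqr ?nnegrE ?normc_ge0// sqr_normc real_normK ?num_real//.
by rewrite lerDl sqr_ge0.
Qed.

Lemma Im_le_normc x : `|complex.Im x| <= normc x.
Proof.
rewrite -ler_sqr ?nnegrE ?normc_ge0// sqr_normc real_normK ?num_real//.
by rewrite lerDr sqr_ge0.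
Qed.

Lemma normc_le_sum x : normc x <= `|complex.Re x| + `|complex.Im x|.
Proof.
rewrite -ler_sqr ?nnegrE ?normc_ge0// ?addr_ge0// sqr_normc sqrrD !real_normK ?num_real//.
by rewrite addrAC lerDl mulrn_wge0// mulr_ge0.
Qed.

Lemma normc_conj x : normc (conjc x) = normc x.
Proof. by case: x => a b /=; rewrite sqrrN. Qed.

Lemma normc_real (r : R) : normc r%:C = `|r|.
Proof. by rewrite /= expr0n/= addr0 sqrtr_sqr. Qed.

Lemma conjc_mul_self x : conjc x * x = (normc x ^+ 2)%:C.
Proof. by rewrite sqr_normc; case: x => a b; apply: complexP => /=; ring. Qed.

Lemma realCM (a b : R) : (a * b)%:C = a%:C * b%:C.
Proof. exact: rmorphM. Qed.

Lemma realCD (a b : R) : (a + b)%:C = a%:C + b%:C.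
Proof. exact: rmorphD. Qed.

Lemma realC_inv (a : R) : (a^-1)%:C = (a%:C)^-1.
Proof. exact: fmorphV. Qed.

Lemma realC_neq0 (a : R) : a != 0 -> a%:C != 0.
Proof. by move=> a0; rewrite eq_complex /= negb_and a0. Qed.

Lemma realC_nat n : (n%:R : R)%:C = n%:R.
Proof. exact: rmorph_nat. Qed.

End normc.

Section integralC.
Context {R : realType} {d : nat}.
Local Notation Cd := (Cspace R d).
Local Notation mu := (@lebesgue_C R d).
Local Notation ball := (@unit_ball R d).
Implicit Types (F G f g : Cd -> R[i]) (z v : Cd).

Definition measurable_cfun F :=
  measurable_fun ball (fun z => complex.Re (F z)) /\
  measurable_fun ball (fun z => complex.Im (F z)).

Lemma measurable_cfun_continuous F : (forall z, ball z -> continuousC_at F z) -> measurable_cfun F.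
Proof.
move=> cF; split; apply: continuous_measurableC;
  by [exact: open_unit_ball|move=> z /cF[]].
Qed.

Lemma measurable_cfun_mul F G : measurable_cfun F -> measurable_cfun G ->
  measurable_cfun (fun z => F z * G z).
Proof.
move=> [h1 h2] [h3 h4]; split.
- by under eq_fun do rewrite ReCM; apply: measurable_funB; apply: measurable_funM.
- by under eq_fun do rewrite ImCM; apply: measurable_funD; apply: measurable_funM.
Qed.

Lemma measurable_cfun_conj F : measurable_cfun F -> measurable_cfun (fun z => conjc (F z)).
Proof.
move=> [h1 h2]; split.
- by under eq_fun do rewrite ReCJ.
- under eq_fun do rewrite ImCJ; exact: measurable_funN.
Qed.

Lemma measurable_cfun_real (u : Cd -> R) : measurable_fun ball u -> measurable_cfun (fun z => (u z)%:C).
Proof. by move=> h; split => //=; exact: measurable_cst. Qed.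

Lemma measurable_normc F : measurable_cfun F -> measurable_fun ball (fun z => normc (F z)).
Proof.
move=> [h1 h2].
have -> : (fun z => normc (F z)) =
    (@Num.sqrt R) \o (fun z => complex.Re (F z) ^+ 2 + complex.Im (F z) ^+ 2).
  by apply/funext => z /=; case: (F z).
apply: measurableT_comp.
  by apply: continuous_measurable_fun; exact: sqrt_continuous.
by apply: measurable_funD; apply: measurable_funX.
Qed.

Lemma integrableC_ext F G : (forall z, ball z -> F z = G z) ->
  integrableC F -> integrableC G.
Proof.
move=> FG [h1 h2]; split; [apply: eq_integrable h1|apply: eq_integrable h2];
  by [exact: measurable_unit_ball|move=> z /[!inE] zb; rewrite FG].
Qed.

Lemma integralC_ext F G : (forall z, ball z -> F z = G z) -> integralC F = integralC G.
Proof.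
move=> FG; rewrite /integralC; congr (_ +i* _); apply: eq_Rintegral => z /[!inE] zb;
  by rewrite FG.
Qed.

Lemma integrableC_measurable F : integrableC F -> measurable_cfun F.
Proof.
by move=> [h1 h2]; split; apply/measurable_EFinP; [exact: measurable_int h1|exact: measurable_int h2].
Qed.

Lemma integrableC_le F (g : Cd -> R) : measurable_cfun F ->
  mu.-integrable ball (EFin \o g) ->
  (forall z, ball z -> normc (F z) <= g z) -> integrableC F.
Proof.
move=> [m1 m2] ig Fg; split; apply: le_integrable ig => //.
- exact: measurable_unit_ball.
- exact/measurable_EFinP.
- move=> z zb /=; rewrite lee_fin; apply: le_trans (Re_le_normc _) _.
  by apply: le_trans (Fg z zb) _; exact: ler_norm.
- exact: measurable_unit_ball.
- exact/measurable_EFinP.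
- move=> z zb /=; rewrite lee_fin; apply: le_trans (Im_le_normc _) _.
  by apply: le_trans (Fg z zb) _; exact: ler_norm.
Qed.

Lemma integrableC_normc F : integrableC F ->
  mu.-integrable ball (EFin \o (fun z => normc (F z))).
Proof.
move=> iF; have mF := integrableC_measurable iF; case: iF => h1 h2.
have h := integrableD measurable_unit_ball (integrable_abse h1) (integrable_abse h2).
apply: le_integrable h.
- exact: measurable_unit_ball.
- by apply/measurable_EFinP; exact: measurable_normc.
- move=> z zb /=; rewrite lee_fin; apply: le_trans (ler_norm _).
  by rewrite ger0_norm ?normc_ge0//; exact: normc_le_sum.
Qed.

Lemma integrableC_add F G : integrableC F -> integrableC G ->
  integrableC (fun z => F z + G z).
Proof.
move=> [h1 h2] [h3 h4]; split.
- under eq_fun do rewrite ReCD; exact: (integrableD measurable_unit_ball h1 h3).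
- under eq_fun do rewrite ImCD; exact: (integrableD measurable_unit_ball h2 h4).
Qed.

Lemma integralC_add F G : integrableC F -> integrableC G ->
  integralC (fun z => F z + G z) = integralC F + integralC G.
Proof.
move=> [h1 h2] [h3 h4]; have mb := @measurable_unit_ball R d.
apply: complexP; rewrite ?ReCD ?ImCD /integralC /=.
- by under eq_Rintegral do rewrite ReCD; rewrite (RintegralD mb h1 h3).
- by under eq_Rintegral do rewrite ImCD; rewrite (RintegralD mb h2 h4).
Qed.

Lemma integrableC_cmul c F : integrableC F -> integrableC (fun z => c * F z).
Proof.
move=> iF; have mF := integrableC_measurable iF.
apply: (@integrableC_le _ (fun z => normc c * normc (F z))).
- apply: measurable_cfun_mul => //; split; exact: measurable_cst.
- exact: (integrableZl measurable_unit_ball _ (integrableC_normc iF)).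
- by move=> z _; rewrite normcM.
Qed.

Lemma integralC_cmul c F : integrableC F -> integralC (fun z => c * F z) = c * integralC F.
Proof.
move=> [h1 h2]; have mb := @measurable_unit_ball R d.
have k1 r := integrableZl mb r h1; have k2 r := integrableZl mb r h2.
apply: complexP; rewrite ?ReCM ?ImCM /integralC /=.
- under eq_Rintegral do rewrite ReCM.
  by rewrite (RintegralB mb (k1 _) (k2 _)) (RintegralZl _ mb h1) (RintegralZl _ mb h2).
- under eq_Rintegral do rewrite ImCM.
  by rewrite (RintegralD mb (k2 _) (k1 _)) (RintegralZl _ mb h1) (RintegralZl _ mb h2).
Qed.

Lemma integralC_conj F : integrableC F -> integralC (fun z => conjc (F z)) = conjc (integralC F).
Proof.
move=> [h1 h2]; have mb := @measurable_unit_ball R d.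
apply: complexP; rewrite ?ReCJ ?ImCJ /integralC /=.
- by under eq_Rintegral do rewrite ReCJ.
- under eq_Rintegral do rewrite ImCJ -mulN1r.
  by rewrite (RintegralZl _ mb h2) mulN1r.
Qed.

Lemma integrableC_sum n (F : 'I_n -> Cd -> R[i]) : (forall i, integrableC (F i)) ->
  integrableC (fun z => \sum_(i < n) F i z).
Proof.
elim: n F => [|n IH] F h.
  under eq_fun do rewrite big_ord0.
  apply: (@integrableC_le _ (fun=> 0)) => [||z _]; last by rewrite normc0.
    by split; exact: measurable_cst.
  by apply: (@bounded_integrable_ball _ _ _ 0) => // z _; rewrite normr0.
by under eq_fun do rewrite big_ord_recl; apply: integrableC_add => //; exact: IH.
Qed.

Lemma integralC_sum n (F : 'I_n -> Cd -> R[i]) : (forall i, integrableC (F i)) ->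
  integralC (fun z => \sum_(i < n) F i z) = \sum_(i < n) integralC (F i).
Proof.
elim: n F => [|n IH] F h.
  under integralC_ext do rewrite big_ord0.
  rewrite big_ord0; apply: complexP => /=; rewrite Rintegral_cst ?mul0r//;
    exact: measurable_unit_ball.
under integralC_ext do rewrite big_ord_recl.
rewrite integralC_add//; last exact: integrableC_sum.
by rewrite big_ord_recl IH.
Qed.

Lemma integralC_cvg (F_ : nat -> Cd -> R[i]) F (g : Cd -> R) :
  (forall n, measurable_cfun (F_ n)) ->
  mu.-integrable ball (EFin \o g) ->
  (forall n z, ball z -> normc (F_ n z) <= g z) ->
  (forall z, ball z -> complex.Re (F_ n z) @[n --> \oo] --> complex.Re (F z)) ->
  (forall z, ball z -> complex.Im (F_ n z) @[n --> \oo] --> complex.Im (F z)) ->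
  [/\ integrableC F,
    complex.Re (integralC (F_ n)) @[n --> \oo] --> complex.Re (integralC F) &
    complex.Im (integralC (F_ n)) @[n --> \oo] --> complex.Im (integralC F)].
Proof.
move=> mF ig Fg cRe cIm.
have [i1 c1] := Rdominated_convergence measurable_unit_ball (fun n => (mF n).1) cRe ig
  (fun n z zb => le_trans (Re_le_normc _) (Fg n z zb)).
have [i2 c2] := Rdominated_convergence measurable_unit_ball (fun n => (mF n).2) cIm ig
  (fun n z zb => le_trans (Im_le_normc _) (Fg n z zb)).
by split.
Qed.

Lemma continuousC_bounded (b : R) F : b < 1 ->
  (forall z, ball z -> continuousC_at F z) ->
  exists2 M, 0 <= M & forall z, sqnorm z <= b -> normc (F z) <= M.
Proof.
move=> b1 cF.
have zb z : sqnorm z <= b -> ball z by move=> h; exact: le_lt_trans h b1.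
have [M1 [M10 h1]] := continuous_bounded_on (@compact_sqnorm_le R d b)
  (fun z hz => (cF z (zb z hz)).1).
have [M2 [M20 h2]] := continuous_bounded_on (@compact_sqnorm_le R d b)
  (fun z hz => (cF z (zb z hz)).2).
exists (M1 + M2); first exact: addr_ge0.
by move=> z hz; apply: le_trans (normc_le_sum _) _; apply: lerD; [exact: h1|exact: h2].
Qed.

Lemma integrableC_support (b : R) F : b < 1 ->
  (forall z, ball z -> continuousC_at F z) ->
  (forall z, b < sqnorm z -> F z = 0) -> integrableC F.
Proof.
move=> b1 cF F0; have [M M0 FM] := continuousC_bounded b1 cF.
apply: (@integrableC_le _ (fun=> M)); first exact: measurable_cfun_continuous.
- by apply: (@bounded_integrable_ball _ _ _ M) => // z _; rewrite ger0_norm.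
- move=> z zb; have [/FM//|/F0 ->] := leP (sqnorm z) b.
  by rewrite normc0.
Qed.

Definition dsq (b : bool) (j : 'I_d) z : R := 2 * (if b then z.2 ord0 j else z.1 ord0 j).

Lemma is_derive_sqnorm_dir b j z : is_derive z (real_dir b j) (@sqnorm R d) (dsq b j z).
Proof.
apply: is_derive_eq (is_derive_sqnorm _ _) _.
rewrite (bigD1 j)//= big1 ?addr0.
  by rewrite /dsq /real_dir; case: b; rewrite /= !mxE !eqxx /= ?mulr0 ?mulr1 ?add0r ?addr0.
move=> i ij; rewrite /real_dir.
by case: b => /=; rewrite !mxE (negbTE ij) /= ?andbF !mulr0 addr0 mulr0.
Qed.

Record cutoff (b : R) (k k' : R -> R) := Cutoff {
  cut_derive : forall t : R, 0 <= t -> is_derive t (1 : R) k (k' t);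
  cut_cont : forall t : R, 0 <= t -> {for t, continuous k'};
  cut_lt1 : b < 1;
  cut0 : forall t : R, b < t -> k t = 0;
  cut0' : forall t : R, b < t -> k' t = 0 }.

Lemma cut_continuous b k k' t : cutoff b k k' -> 0 <= t -> {for t, continuous k}.
Proof.
move=> ck t0; have [h _] := cut_derive ck t0.
by apply: differentiable_continuous; exact/derivable1_diffP.
Qed.

Lemma cut_sq_continuous b k k' z : cutoff b k k' ->
  {for z, continuous (fun w : Cd => k (sqnorm w))}.
Proof.
move=> ck; apply: (@continuous_comp _ _ _ (@sqnorm R d) k); first exact: sqnorm_continuous.
by apply: cut_continuous ck _; exact: sqnorm_ge0.
Qed.

Lemma cut_sq'_continuous b k k' z : cutoff b k k' ->
  {for z, continuous (fun w : Cd => k' (sqnorm w))}.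
Proof.
move=> ck; apply: (@continuous_comp _ _ _ (@sqnorm R d) k'); first exact: sqnorm_continuous.
by apply: cut_cont ck _ _; exact: sqnorm_ge0.
Qed.

Lemma dsq_continuous b j : continuous (@dsq b j).
Proof.
move=> z; apply: cvgM; first exact: cvg_cst.
by case: b; [exact: coord_im_continuous|exact: coord_re_continuous].
Qed.

Lemma nbhs_sqnorm_gt b z : b < sqnorm z -> \forall w \near z, b < sqnorm (w : Cd).
Proof.
move=> bz; apply: open_nbhs_nbhs; split => //.
by apply: (@open_comp _ _ (@sqnorm R d) [set x | b < x]) => [y _|];
  [exact: sqnorm_continuous|exact: open_gt].
Qed.

Lemma integralC_derive_cut F (b : bool) j (b0 : R) k k' : Ck 1 F -> cutoff b0 k k' ->
  integralC (fun z => deriveC (real_dir b j) F z * (k (sqnorm z))%:C +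
                      F z * (k' (sqnorm z) * dsq b j z)%:C) = 0.
Proof.
move=> hF ck; set u' := (fun z => _).
pose u z := F z * (k (sqnorm z))%:C.
have b1 := cut_lt1 ck.
have der z : is_deriveC z (real_dir b j) u (u' z).
  have [zb|zb] := ltP (sqnorm z) 1.
    apply: is_deriveC_mul; first exact: derivableCP (Ck_derivable _ _ hF zb).
    apply: is_deriveC_real; apply: is_derive_comp1; last exact: is_derive_sqnorm_dir.
    by apply: cut_derive ck _ _; exact: sqnorm_ge0.
  have bz := lt_le_trans b1 zb.
  rewrite /u' (cut0 ck bz) (cut0' ck bz) mul0r !mulr0 addr0.
  apply: is_deriveC_near (is_deriveC_cst _ _ _).
  by apply: filterS (nbhs_sqnorm_gt bz) => w bw; rewrite /u (cut0 ck bw) mulr0.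
have out G : (forall z, b0 < sqnorm z -> G z = 0) ->
    (forall z, ball z -> continuousC_at G z) -> forall z, continuousC_at G z.
  move=> G0 cG z; have [zb|zb] := ltP (sqnorm z) 1; first exact: cG.
  have bz := lt_le_trans b1 zb.
  apply: near_continuousC (continuousC_cst z 0).
  by apply: filterS (nbhs_sqnorm_gt bz) => w bw; rewrite G0.
have cu : forall z, continuousC_at u z.
  apply: out => z zb; first by rewrite /u (cut0 ck zb) mulr0.
  apply: continuousC_mul; first exact: Ck_cont hF _ zb.
  by apply: continuousC_real; exact: cut_sq_continuous ck.
have cu' : forall z, continuousC_at u' z.
  apply: out => z zb; first by rewrite /u' (cut0 ck zb) (cut0' ck zb) mul0r !mulr0 addr0.
  apply: continuousC_add; apply: continuousC_mul.
  - exact: Ck_cont (Ck_deriveC b j hF) _ zb.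
  - by apply: continuousC_real; exact: cut_sq_continuous ck.
  - exact: Ck_cont hF _ zb.
  - apply: continuousC_real; apply: cvgM; first exact: cut_sq'_continuous ck.
    exact: dsq_continuous.
have DRe : (fun z => complex.Re (u' z)) = 'D_(real_dir b j) (fun w => complex.Re (u w)).
  by apply/funext => z; have [[_ ->] _] := der z.
have DIm : (fun z => complex.Im (u' z)) = 'D_(real_dir b j) (fun w => complex.Im (u w)).
  by apply/funext => z; have [_ [_ ->]] := der z.
apply: complexP; rewrite /integralC /=.
- rewrite DRe; apply: (@Rintegral_derive0 _ _ _ _ b0) => //.
  + by move=> z; exact: (cu z).1.
  + by move=> z; exact: (@ex_derive _ _ _ _ _ _ _ (der z).1).
  + by rewrite -DRe => z; exact: (cu' z).1.
  + by move=> z bz; rewrite /u (cut0 ck bz) mulr0.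
- rewrite DIm; apply: (@Rintegral_derive0 _ _ _ _ b0) => //.
  + by move=> z; exact: (cu z).2.
  + by move=> z; exact: (@ex_derive _ _ _ _ _ _ _ (der z).2).
  + by rewrite -DIm => z; exact: (cu' z).2.
  + by move=> z bz; rewrite /u (cut0 ck bz) mulr0.
Qed.

Lemma integrableC_cut G (b0 : R) k k' : (forall z, ball z -> continuousC_at G z) ->
  cutoff b0 k k' -> integrableC (fun z => G z * (k (sqnorm z))%:C).
Proof.
move=> cG ck; apply: (integrableC_support (cut_lt1 ck)) => z zb.
  apply: continuousC_mul; first exact: cG.
  by apply: continuousC_real; exact: cut_sq_continuous ck.
by rewrite (cut0 ck zb) mulr0.
Qed.

Lemma integrableC_cut' G (b0 : R) k k' : (forall z, ball z -> continuousC_at G z) ->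
  cutoff b0 k k' -> integrableC (fun z => G z * (k' (sqnorm z))%:C).
Proof.
move=> cG ck; apply: (integrableC_support (cut_lt1 ck)) => z zb.
  apply: continuousC_mul; first exact: cG.
  by apply: continuousC_real; exact: cut_sq'_continuous ck.
by rewrite (cut0' ck zb) mulr0.
Qed.

Lemma integrableC_derive_cut F (b : bool) j (b0 : R) k k' : Ck 1 F -> cutoff b0 k k' ->
  integrableC (fun z => deriveC (real_dir b j) F z * (k (sqnorm z))%:C +
                      F z * (k' (sqnorm z) * dsq b j z)%:C).
Proof.
move=> hF ck; apply: integrableC_add.
  by apply: integrableC_cut ck => z zb; exact: Ck_cont (Ck_deriveC b j hF) _ zb.
have h : integrableC (fun z => (F z * (dsq b j z)%:C) * (k' (sqnorm z))%:C).
  apply: integrableC_cut' ck => z zb; apply: continuousC_mul; first exact: Ck_cont hF _ zb.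
  by apply: continuousC_real; exact: dsq_continuous.
by apply: integrableC_ext h => z _; rewrite realCM -[LHS]mulrA; congr (_ * _); exact: mulrC.
Qed.

Lemma dsq_coord j z : ((dsq false j z)%:C - 'i%C * (dsq true j z)%:C) / 2 = conjc (coordC z j).
Proof.
apply: (@mulIf _ 2); rewrite ?divfK ?pnatr_eq0//.
by apply: complexP; rewrite /dsq /coordC /=; ring.
Qed.

End integralC.

Section radial_ring.
Variable K : comPzRingType.
Lemma radial_dz (a b c e f k k' i h : K) :
  (a * k + f * (k' * c) + i * (b * k + f * (k' * e))) * h =
  (a + i * b) * h * k + f * (k' * ((c + i * e) * h)).
Proof. by ring. Qed.
Lemma radial_N1 (c a f z w k k' : K) :
  (c * f + z * a) * k + z * f * (k' * w) = f * c * k + z * a * k + f * k' * (z * w).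
Proof. by ring. Qed.
Lemma radial_N2 (n f k k' s t : K) :
  n * k + f * (s * k' + t * k) = f * 1 * k * t + n * k + f * k' * s.
Proof. by ring. Qed.
End radial_ring.

Section radial.
Context {R : realType} {d : nat}.
Local Notation Cd := (Cspace R d).
Local Notation ball := (@unit_ball R d).
Implicit Types (F G f g : Cd -> R[i]) (z v : Cd).

Lemma integralC_dz_cut F j (b0 : R) k k' : Ck 1 F -> cutoff b0 k k' ->
  integralC (fun z => dz j F z * (k (sqnorm z))%:C +
                      F z * ((k' (sqnorm z))%:C * conjc (coordC z j))) = 0.
Proof.
move=> hF ck.
have i1 := integrableC_derive_cut false j hF ck; have i2 := integrableC_derive_cut true j hF ck.
have e1 := integralC_derive_cut false j hF ck; have e2 := integralC_derive_cut true j hF ck.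
have h := integralC_cmul 2^-1 (integrableC_add i1 (integrableC_cmul (- 'i%C) i2)).
have h1 := etrans (integralC_add i1 (integrableC_cmul (- 'i%C) i2))
  (congr2 +%R e1 (etrans (integralC_cmul (- 'i%C) i2) (congr1 ( *%R (- 'i%C)) e2))).
move: h => /esym; rewrite h1 mulr0 addr0 mulr0 => ->; apply: integralC_ext => z _.
rewrite -dsq_coord /dz -!mulNr; rewrite [RHS]mulrC !rmorphM/=.
by rewrite radial_dz.
Qed.

Definition radN (k k' : R -> R) (t : R) : R := t * k' t + d%:R * k t.

Lemma integrableC_radN G (b0 : R) k k' : (forall z, ball z -> continuousC_at G z) ->
  cutoff b0 k k' -> integrableC (fun z => G z * (radN k k' (sqnorm z))%:C).
Proof.
move=> cG ck.
have h : integrableC (fun z => (G z * (sqnorm z)%:C) * (k' (sqnorm z))%:C +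
    d%:R%:C * (G z * (k (sqnorm z))%:C)).
  apply: integrableC_add.
    apply: integrableC_cut' ck => z zb; apply: continuousC_mul; first exact: cG.
    by apply: continuousC_real; exact: sqnorm_continuous.
  by apply: integrableC_cmul; exact: integrableC_cut ck.
apply: integrableC_ext h => z _; rewrite /radN rmorphD !rmorphM/= mulrDr !mulrA.
by rewrite [_%:C * G z]mulrC.
Qed.

Lemma integralC_opN_cut f (b0 : R) k k' : Ck 1 f -> cutoff b0 k k' ->
  integralC (fun z => opN f z * (k (sqnorm z))%:C) =
  - integralC (fun z => f z * (radN k k' (sqnorm z))%:C).
Proof.
move=> hf ck; apply/eqP; rewrite -addr_eq0 -integralC_add; last 2 first.
- by apply: integrableC_cut ck => z zb; exact: Ck_cont (Ck_opN hf) _ zb.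
- by apply: integrableC_radN ck => z zb; exact: Ck_cont hf _ zb.
pose F j z := coordC z j * f z.
have hF j : Ck 1 (F j) := Ck_mul (Ck_coord 1 j) hf.
rewrite (_ : integralC _ = integralC (fun z => \sum_(j < d) (dz j (F j) z * (k (sqnorm z))%:C +
   F j z * ((k' (sqnorm z))%:C * conjc (coordC z j))))).
  rewrite integralC_sum ?big1// => j; first by rewrite (integralC_dz_cut j (hF j) ck).
  apply: integrableC_add.
    by apply: integrableC_cut ck => z zb; exact: Ck_cont (Ck_dz j (hF j)) _ zb.
  have h : integrableC (fun z => (F j z * conjc (coordC z j)) * (k' (sqnorm z))%:C).
    apply: integrableC_cut' ck => z zb; apply: continuousC_mul; first exact: Ck_cont (hF j) _ zb.
    by apply: continuousC_conj; exact: continuousC_coord.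
  by apply: integrableC_ext h => z _; rewrite mulrAC -!mulrA.
apply: integralC_ext => z zb.
transitivity (\sum_(j < d) (f z * 1 * (k (sqnorm z))%:C +
    coordC z j * dz j f z * (k (sqnorm z))%:C +
    f z * (k' (sqnorm z))%:C * (coordC z j * conjc (coordC z j)))); last first.
  apply: eq_bigr => j _.
  rewrite dz_mul; [|exact: diff1_coord|exact: Ck_diff1 hf zb].
  by rewrite dz_coord eqxx radial_N1.
rewrite !big_split/= -[X in _ = _ + X]mulr_sumr -[X in _ = _ + X + _]mulr_suml -sqnorm_coordE.
rewrite sumr_const card_ord /radN realCD !realCM realC_nat -[X in _ = X + _ + _]mulr_natr.
exact: radial_N2.
Qed.

Lemma integralC_opNbar_cut f (b0 : R) k k' : Ck 1 f -> cutoff b0 k k' ->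
  integralC (fun z => opNbar f z * (k (sqnorm z))%:C) =
  - integralC (fun z => f z * (radN k k' (sqnorm z))%:C).
Proof.
move=> hf ck.
have iN : integrableC (fun z => opNbar f z * (k (sqnorm z))%:C).
  by apply: integrableC_cut ck => z zb; exact: Ck_cont (Ck_opNbar hf) _ zb.
have i0 : integrableC (fun z => f z * (radN k k' (sqnorm z))%:C).
  by apply: integrableC_radN ck => z zb; exact: Ck_cont hf _ zb.
apply: (can_inj (@conjcK R)); rewrite conjcN -!integralC_conj//.
rewrite (_ : integralC _ = integralC (fun z => opN (fun w => conjc (f w)) z * (k (sqnorm z))%:C)).
  rewrite (integralC_opN_cut (Ck_conj hf) ck); congr (- _); apply: integralC_ext => z _.
  by rewrite conjcM conjc_real.
apply: integralC_ext => z zb; rewrite opN_conj ?conjcM ?conjc_real//.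
exact: Ck_diff1 hf zb.
Qed.

End radial.

(** * The mean value property *)

Section truncated_powers.
Context {R : realType}.
Implicit Types (t x b : R) (g s : R -> R).

Definition tpow (m : nat) x : R := Num.max x 0 ^+ m.

Lemma tpow_ge0 m x : 0 <= tpow m x.
Proof. by apply: exprn_ge0; rewrite le_max lexx orbT. Qed.

Lemma tpow_pos m x : 0 <= x -> tpow m x = x ^+ m.
Proof. by move=> x0; rewrite /tpow max_l. Qed.

Lemma tpow_neg m x : x <= 0 -> tpow m.+1 x = 0.
Proof. by move=> x0; rewrite /tpow max_r// expr0n. Qed.

Lemma tpowS m x : tpow m.+2 x = x * tpow m.+1 x.
Proof.
have [x0|x0] := leP 0 x; first by rewrite !tpow_pos// -exprS.
by rewrite !tpow_neg ?ltW// mulr0.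
Qed.

Lemma is_derive_exprS n t : is_derive t 1 (fun x : R => x ^+ n.+1) (n.+1%:R * t ^+ n).
Proof.
elim: n => [|n IH].
  by under eq_fun do rewrite expr1; rewrite expr0 mulr1; exact: is_derive_id.
under eq_fun do rewrite exprS.
apply: is_derive_eq (is_derive_mulf (is_derive_id t (1 : R)) IH) _.
by rewrite -[in RHS]natr1 !exprS; ring.
Qed.

Lemma tpow_continuous m : continuous (tpow m : R -> R).
Proof.
move=> x; apply: (@continuous_comp _ _ _ (fun x : R => Num.max x 0) (fun x => x ^+ m)).
  by apply: (@continuous_max _ _ (fun x : R => x) (fun=> 0)); [exact: cvg_id|exact: cvg_cst].
exact: exprn_continuous.
Qed.

Lemma is_derive_tpow m x : is_derive x 1 (tpow m.+2 : R -> R) (m.+2%:R * tpow m.+1 x).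
Proof.
have [x0|x0|->] := ltgtP x 0.
- rewrite tpow_neg ?ltW// mulr0.
  apply: near_eq_is_derive (is_derive_cst (0 : R) x 1).
  near=> y; rewrite tpow_neg//; apply: ltW; near: y; exact: lt_nbhsl.
- rewrite tpow_pos ?ltW//.
  apply: (@near_eq_is_derive _ _ _ (fun y : R => y ^+ m.+2)).
    near=> y; rewrite tpow_pos//; apply: ltW; near: y; exact: lt_nbhsr.
  exact: is_derive_exprS.
- rewrite tpow_neg// mulr0.
  have c0 : h^-1 *: ((tpow m.+2 \o shift 0) (h *: 1) - tpow m.+2 0) @[h --> 0^'] --> (0 : R).
    have E : \forall h \near (0 : R)^', tpow m.+1 h =
        h^-1 *: ((tpow m.+2 \o shift 0) (h *: 1) - tpow m.+2 0).
      near=> h => /=; rewrite [tpow m.+2 0]tpow_neg// subr0 addr0 [h *: 1]mulr1.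
      rewrite tpowS [RHS]mulrA mulVf ?mul1r//.
      by near: h; exact: nbhs_dnbhs_neq.
    apply: cvg_trans (near_eq_cvg E) _.
    have : tpow m.+1 x @[x --> (0 : R)^'] --> tpow m.+1 (0 : R).
      by apply: cvg_within_filter; exact: tpow_continuous.
    by rewrite tpow_neg.
  split; first by apply/cvg_ex; exists 0.
  exact/cvg_lim.
Unshelve. all: by end_near. Qed.

Lemma cutoff_tpow m b (b0 : R) g g' s s' : b0 < 1 ->
  (forall t, 0 <= t -> is_derive t 1 s (s' t)) ->
  (forall t, 0 <= t -> {for t, continuous s'}) ->
  (forall t, b0 < t -> b < s t) ->
  (forall t, 0 <= t -> t < 1 -> is_derive t 1 g (g' t) /\ {for t, continuous g'}) ->
  cutoff b0 (fun t => g t * tpow m.+2 (b - s t))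
    (fun t => g' t * tpow m.+2 (b - s t) - g t * (m.+2%:R * tpow m.+1 (b - s t) * s' t)).
Proof.
move=> b01 ds cs bs dg.
have csc t : 0 <= t -> {for t, continuous s}.
  move=> /ds[h _]; apply: differentiable_continuous; exact/derivable1_diffP.
have z1 t n : b0 < t -> tpow n.+1 (b - s t) = 0.
  by move=> /bs bt; rewrite tpow_neg// subr_le0 ltW.
have near0 t n : 1 <= t -> \forall y \near t, tpow n.+1 (b - s y) = 0.
  move=> t1; near=> y; apply: z1; near: y; exact: lt_nbhsr (lt_le_trans b01 t1).
split => //.
- move=> t t0; have [t1|t1] := ltP t 1.
    have [dgt _] := dg t t0 t1.
    have d1 := is_derive_addf (is_derive_cst b t (1 : R)) (is_derive_oppf (ds t t0)).
    have d2 := is_derive_comp1 (is_derive_tpow m _) d1.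
    by apply: is_derive_eq (is_derive_mulf dgt d2) _; rewrite /=; ring.
  have tb := lt_le_trans b01 t1.
  rewrite !z1// !(mulr0, mul0r) subr0.
  apply: near_eq_is_derive (is_derive_cst (0 : R) t 1).
  by apply: filterS (near0 t m.+1 t1) => y ->; rewrite mulr0.
- move=> t t0; have [t1|t1] := ltP t 1.
    have [[dgt _] cg'] := dg t t0 t1.
    have cg : {for t, continuous g} by apply: differentiable_continuous; exact/derivable1_diffP.
    have cT n : {for t, continuous (fun t => tpow n (b - s t))}.
      apply: (@continuous_comp _ _ _ (fun t => b - s t) (tpow n)).
        by apply: cvgB; [exact: cvg_cst|exact: csc].
      exact: tpow_continuous.
    apply: cvgB; apply: cvgM => //; first exact: cT.
    apply: cvgM; last exact: cs.
    by apply: cvgM; [exact: cvg_cst|exact: cT].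
  have tb := lt_le_trans b01 t1.
  rewrite /prop_for /continuous_at !z1// !(mulr0, mul0r) subr0.
  apply: cvg_near_cst; near=> y.
  by rewrite (near (near0 t m.+1 t1) y)// (near (near0 t m t1) y)// !(mulr0, mul0r) subr0.
- by move=> t /z1 ->; rewrite mulr0.
- by move=> t tb; rewrite !z1// !(mulr0, mul0r) subr0.
Unshelve. all: by end_near. Qed.

End truncated_powers.

Section mean_value.
Context {R : realType} {d : nat}.
Local Notation Cd := (Cspace R d).
Local Notation mu := (@lebesgue_C R d).
Local Notation ball := (@unit_ball R d).
Implicit Types (F G f g : Cd -> R[i]) (z v w : Cd).

Definition mvb : R := 2^-1 ^+ d.+1.

(* As e -> 0, the kernel t poik' + d poik, whose integral against f vanishes
   when \bar N f = 0, is poiA - mvk + o(1), with poiA an approximate identity. *)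
Definition mvk (t : R) : R := (3 * d.+1%:R * t) * tpow 2 (mvb - t ^+ d.+1).

Definition mvk' (t : R) : R := (3 * d.+1%:R) * tpow 2 (mvb - t ^+ d.+1) -
  (3 * d.+1%:R * t) * (2%:R * tpow 1 (mvb - t ^+ d.+1) * (d.+1%:R * t ^+ d)).

Lemma mvb_lt (t : R) : 2^-1 < t -> mvb < t ^+ d.+1.
Proof.
move=> t0; have h0 : 0 <= 2^-1 :> R by rewrite invr_ge0.
by rewrite /mvb ltrXn2r// nnegrE ltW// (le_lt_trans h0).
Qed.

Lemma half_lt1 : 2^-1 < 1 :> R. Proof. by rewrite invf_lt1// ltr1n. Qed.

Lemma cutoff_exp m (g g' : R -> R) :
  (forall t : R, 0 <= t -> t < 1 -> is_derive t (1 : R) g (g' t) /\ {for t, continuous g'}) ->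
  cutoff 2^-1 (fun t => g t * tpow m.+2 (mvb - t ^+ d.+1))
    (fun t => g' t * tpow m.+2 (mvb - t ^+ d.+1) -
      g t * (m.+2%:R * tpow m.+1 (mvb - t ^+ d.+1) * (d.+1%:R * t ^+ d))).
Proof.
apply: (@cutoff_tpow R m mvb 2^-1 g g' (fun t => t ^+ d.+1) (fun t => d.+1%:R * t ^+ d)).
- exact: half_lt1.
- by move=> t _; exact: is_derive_exprS.
- by move=> t _; apply: cvgM; [exact: cvg_cst|exact: exprn_continuous].
- by move=> t; exact: mvb_lt.
Qed.

Lemma cutoff_mvk : cutoff 2^-1 mvk mvk'.
Proof.
apply: (@cutoff_exp 0 (fun t => 3 * d.+1%:R * t) (fun=> 3 * d.+1%:R)) => t t0 t1.
split; last exact: cvg_cst.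
have := is_derive_mulf (is_derive_cst (3 * d.+1%:R : R) t (1 : R)) (is_derive_id t (1 : R)).
by rewrite mul0r add0r mulr1.
Qed.

Definition poik (e t : R) : R := (e + t) ^- d * tpow 3 (mvb - t ^+ d.+1).

Definition poik' (e t : R) : R := (- (d%:R * (e + t) ^- d.+1)) * tpow 3 (mvb - t ^+ d.+1) -
  (e + t) ^- d * (3%:R * tpow 2 (mvb - t ^+ d.+1) * (d.+1%:R * t ^+ d)).

Lemma is_derive_invX (e t : R) n : 0 < e + t ->
  is_derive t 1 (fun t : R => (e + t) ^- n) (- (n%:R * (e + t) ^- n.+1)).
Proof.
move=> et.
have d1 : is_derive t 1 (fun t : R => e + t) 1.
  apply: is_derive_eq (is_derive_addf (is_derive_cst e t (1 : R)) (is_derive_id t (1 : R))) _.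
  by rewrite add0r.
elim: n => [|n IH].
  rewrite mul0r oppr0; under eq_fun do rewrite expr0 invr1; exact: is_derive_cst.
have d2 : is_derive t 1 (fun t : R => (e + t)^-1) (- ((e + t) ^- 2)).
  have et0 : e + t != 0 by rewrite gt_eqF.
  apply: is_derive_eq (is_deriveV et0 d1) _.
  by rewrite /GRing.scale/= mulr1.
under eq_fun do rewrite exprS invfM.
apply: is_derive_eq (is_derive_mulf d2 IH) _.
rewrite -natr1 !exprS; field.
by rewrite expf_neq0 ?gt_eqF.
Qed.

Lemma invX_continuous (e t : R) n : 0 < e + t -> {for t, continuous (fun t : R => (e + t) ^- n)}.
Proof.
move=> et; have [h _] := is_derive_invX n et.
by apply: differentiable_continuous; exact/derivable1_diffP.
Qed.

Lemma cutoff_poik (e : R) : 0 < e -> cutoff 2^-1 (poik e) (poik' e).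
Proof.
move=> e0; apply: (@cutoff_exp 1 (fun t => (e + t) ^- d) (fun t => - (d%:R * (e + t) ^- d.+1))) => t t0 t1.
have et : 0 < e + t by rewrite ltr_wpDr.
split; first exact: is_derive_invX.
apply: cvgN; apply: cvgM; first exact: cvg_cst.
exact: invX_continuous.
Qed.

Definition poiA (e t : R) : R := d%:R * e * (e + t) ^- d.+1 * tpow 3 (mvb - t ^+ d.+1).
Definition poiB (e t : R) : R := mvk t * (t / (e + t)) ^+ d.

Lemma radN_poik (e t : R) : 0 < e -> 0 <= t -> @radN R d (poik e) (poik' e) t = poiA e t - poiB e t.
Proof.
move=> e0 t0; have et : 0 < e + t by rewrite ltr_wpDr.
rewrite /radN /poik /poik' /poiA /poiB /mvk expr_div_n !exprS; field.
by rewrite expf_neq0 ?gt_eqF.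
Qed.

Lemma poiB_le (e t : R) : 0 < e -> 0 <= t -> 0 <= poiB e t <= mvk t.
Proof.
move=> e0 t0; have et : 0 < e + t by rewrite ltr_wpDr.
have m0 : 0 <= mvk t by rewrite /mvk mulr_ge0 ?tpow_ge0// !mulr_ge0.
have q0 : 0 <= t / (e + t) by rewrite divr_ge0// ltW.
rewrite /poiB mulr_ge0 ?exprn_ge0//= ler_piMr// exprn_ile1//.
by rewrite ler_pdivrMr// mul1r lerDr ltW.
Qed.

Lemma poiB_cvg (t : R) : 0 <= t -> poiB n.+1%:R^-1 t @[n --> \oo] --> mvk t.
Proof.
rewrite le_eqVlt => /orP[/eqP <-|t0].
  have -> : mvk 0 = 0 by rewrite /mvk mulr0 mul0r.
  by rewrite /poiB; under eq_fun do rewrite /mvk mulr0 !mul0r; exact: cvg_cst.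
have h1 : t / (n.+1%:R^-1 + t) @[n --> \oo] --> (1 : R).
  have h0 : n.+1%:R^-1 + t @[n --> \oo] --> (0 + t : R).
    by apply: cvgD; [exact: cvg_harmonic|exact: cvg_cst].
  have t0' : 0 + t != 0 by rewrite add0r gt_eqF.
  have := cvgM (cvg_cst t) (cvgV t0' h0); rewrite add0r mulfV ?gt_eqF//.
  exact.
have h2 := cvg_comp _ _ h1 (@exprn_continuous R d 1).
rewrite -[X in _ --> X]mulr1; apply: cvgM; first exact: cvg_cst.
by move: h2; rewrite expr1n.
Qed.

Definition mvI : R := Rintegral mu ball (fun z => mvk (sqnorm z)).

Lemma normc_integralC F (g : Cd -> R) : integrableC F ->
  mu.-integrable ball (EFin \o g) -> (forall z, ball z -> normc (F z) <= g z) ->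
  normc (integralC F) <= 2 * Rintegral mu ball g.
Proof.
move=> iF ig Fg; have [i1 i2] := iF; have mb := @measurable_unit_ball R d.
have h (u : Cd -> R) : mu.-integrable ball (EFin \o u) -> (forall z, ball z -> `|u z| <= g z) ->
    `|Rintegral mu ball u| <= Rintegral mu ball g.
  move=> iu ug; apply: le_trans (le_normr_Rintegral mb iu) _.
  by apply: le_Rintegral => //; exact: integrable_norm.
apply: le_trans (normc_le_sum _) _; rewrite mulr_natl mulr2n; apply: lerD; apply: h => // z zb.
- exact: le_trans (Re_le_normc _) (Fg z zb).
- exact: le_trans (Im_le_normc _) (Fg z zb).
Qed.

Lemma integrable_sq (k : R -> R) : (forall t, 0 <= t -> {for t, continuous k}) ->
  mu.-integrable ball (EFin \o (fun z : Cd => k (sqnorm z))).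
Proof.
move=> ck.
have [M' [M0 kM]] := continuous_bounded_on (A := [set z : Cd | sqnorm z <= 1])
   (@compact_sqnorm_le R d 1)
   (fun z _ => @continuous_comp _ _ _ (@sqnorm R d) k z (@sqnorm_continuous R d z)
     (ck _ (sqnorm_ge0 z))).
apply: (@bounded_integrable_ball _ _ _ M').
  apply: continuous_measurableC; first exact: open_unit_ball.
  move=> z _; apply: continuous_comp; first exact: sqnorm_continuous.
  exact: ck (sqnorm_ge0 z).
by move=> z zb; apply: kM; exact: ltW.
Qed.

Lemma mvk_ge0 (t : R) : 0 <= t -> 0 <= mvk t.
Proof. by move=> t0; rewrite /mvk mulr_ge0 ?tpow_ge0// !mulr_ge0. Qed.

Lemma integrable_mvk : mu.-integrable ball (EFin \o (fun z : Cd => mvk (sqnorm z))).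
Proof. by apply: integrable_sq => t t0; exact: cut_continuous cutoff_mvk t0. Qed.

Lemma mvI_ge0 : 0 <= mvI.
Proof. by apply: Rintegral_ge0 => z _; exact: mvk_ge0 (sqnorm_ge0 z). Qed.

Lemma lebesgue_C_cube_gt0 (a b : R) : a < b ->
  (0 < lebesgue_C (@cube R d a b `*` @cube R d a b))%E.
Proof. by move=> ab; rewrite lebesgue_C_cube ?ltW// lte_fin !exprn_gt0 ?subr_gt0. Qed.

Lemma mvI_gt0 : (0 < d)%N -> 0 < mvI.
Proof.
move=> d0; have d0' : 0 < d%:R :> R by rewrite ltr0n.
pose c : R := (4 * d%:R)^-1.
have c0 : 0 < c by rewrite invr_gt0 mulr_gt0.
have d1 : 1 <= d%:R :> R by rewrite ler1n.
have dc : d%:R * c = 4^-1 by rewrite /c invfM mulrCA mulfV ?mulr1// gt_eqF.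
have c4 : c <= 4^-1 by rewrite -dc ler_peMl// ltW.
pose K := @cube R d (c / 2) c `*` @cube R d (c / 2) c.
have mK : measurable K by apply: measurableX; exact: measurable_cube.
have Kt z : K z -> 2 * d%:R * (c / 2) ^+ 2 <= sqnorm z <= 2 * d%:R * c ^+ 2.
  have cE (x : R) : 2 * d%:R * x ^+ 2 = \sum_(j < d) (x ^+ 2 + x ^+ 2).
    by rewrite sumr_const card_ord -mulr_natr; ring.
  have c20 : 0 <= c / 2 by rewrite divr_ge0// ltW.
  move=> [h1 h2]; rewrite !cE; apply/andP; split; apply: ler_sum => j _.
  - have /andP[a1 _] := h1 j; have /andP[a2 _] := h2 j.
    by apply: lerD; rewrite lerXn2r ?nnegrE// (le_trans c20).
  - have /andP[b1 a1] := h1 j; have /andP[b2 a2] := h2 j.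
    by apply: lerD; rewrite lerXn2r ?nnegrE ?(ltW c0)// (le_trans c20).
have s1 : 2 * d%:R * c ^+ 2 <= 8^-1.
  rewrite expr2 (_ : 2 * d%:R * (c * c) = 2 * (d%:R * c) * c); last by ring.
  by rewrite dc; lra.
have s0 : 0 < 2 * d%:R * (c / 2) ^+ 2 by rewrite !mulr_gt0// exprn_gt0// divr_gt0.
pose m0 : R := (3 * d.+1%:R * (2 * d%:R * (c / 2) ^+ 2)) * (mvb - 8^-1 ^+ d.+1) ^+ 2.
have bp : 0 < mvb - 8^-1 ^+ d.+1.
  rewrite subr_gt0 /mvb ltrXn2r// ?nnegrE ?invr_ge0//.
  by rewrite ltf_pV2 ?posrE// ltr_nat.
have m00 : 0 < m0 by rewrite /m0 !mulr_gt0// exprn_gt0.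
have Km z : K z -> m0 <= mvk (sqnorm z).
  move=> /Kt /andP[t1 t2]; rewrite /mvk.
  have t3 := le_trans t2 s1.
  have b2 : mvb - 8^-1 ^+ d.+1 <= mvb - sqnorm z ^+ d.+1.
    by rewrite lerD2l lerN2 lerXn2r ?nnegrE ?sqnorm_ge0 ?invr_ge0.
  rewrite tpow_pos ?(le_trans (ltW bp))//; apply: ler_pM.
  - by rewrite !mulr_ge0// ltW.
  - exact: exprn_ge0 (ltW bp).
  - by rewrite ler_pM2l// mulr_gt0.
  - by rewrite lerXn2r// nnegrE ?(ltW bp)// (le_trans (ltW bp)).
have Kb : K `<=` ball.
  move=> z /Kt /andP[_ t2]; apply: le_lt_trans (le_trans t2 s1) _.
  by rewrite invf_lt1 ?ltr1n.
have := integrable_mvk.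
rewrite -lte_fin /mvI /Rintegral => im.
rewrite fineK; last exact: (integrable_fin_num measurable_unit_ball im).
apply: (@lt_le_trans _ _ (m0%:E * lebesgue_C K)%E).
  by rewrite mule_gt0// lebesgue_C_cube_gt0; [|rewrite ltr_pdivrMr// ltr_pMr// ltr1n].
rewrite -integral_cst//; apply: (@le_trans _ _ (\int[mu]_(x in K) (mvk (sqnorm x))%:E)%E).
  apply: ge0_le_integral => //.
  - by move=> x _; rewrite lee_fin ltW.
  - have := measurable_int _ im; apply: measurable_funS => //; exact: measurable_unit_ball.
apply: ge0_subset_integral => //.
- exact: measurable_unit_ball.
- exact: measurable_int im.
- by move=> x _; rewrite lee_fin; exact: mvk_ge0 (sqnorm_ge0 x).
Qed.

Lemma continuous_nbhs_sqnorm F (eta : R) : continuousC_at F 0 -> 0 < eta ->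
  exists2 del : R, 0 < del & forall w, sqnorm w < del -> normc (F w - F 0) <= eta.
Proof.
move=> [c1 c2] e0; have e2 : 0 < eta / 2 by rewrite divr_gt0.
have n1 : \forall w \near (0 : Cd), `|complex.Re (F 0) - complex.Re (F w)| < eta / 2.
  by move/cvgrPdist_lt : c1 => /(_ _ e2).
have n2 : \forall w \near (0 : Cd), `|complex.Im (F 0) - complex.Im (F w)| < eta / 2.
  by move/cvgrPdist_lt : c2 => /(_ _ e2).
have /nbhs_ballP[r /= r0 rb] : nbhs (0 : Cd) [set w |
    `|complex.Re (F 0) - complex.Re (F w)| < eta / 2 /\
    `|complex.Im (F 0) - complex.Im (F w)| < eta / 2].
  by apply: filterS2 n1 n2 => w.
exists (r ^+ 2); first exact: exprn_gt0.
move=> w wr.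
have cr (x : R) : x ^+ 2 <= sqnorm w -> `|x| < r.
  move=> xw; rewrite -ltr_sqr ?nnegrE ?(ltW r0)// real_normK ?num_real//.
  exact: le_lt_trans xw wr.
have [h1 h2] : `|complex.Re (F 0) - complex.Re (F w)| < eta / 2 /\
    `|complex.Im (F 0) - complex.Im (F w)| < eta / 2.
  have h0 (x : R) (y : R) : y = 0 -> x ^+ 2 <= sqnorm w -> pseudometric_structure.ball y r x.
    by move=> -> /cr xr; rewrite -ball_normE /= sub0r normrN.
  apply: rb; split; split => // i j; rewrite ord1; apply: h0; rewrite ?mxE//;
    apply: le_trans (sqr_coord_le w j); by rewrite ?lerDl ?lerDr sqr_ge0.
apply: le_trans (normc_le_sum _) _; rewrite ReCD ImCD ReCN ImCN.
by rewrite [X in X + _]distrC [X in _ + X]distrC; lra.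
Qed.

Lemma cvg_small (x_ : nat -> R) (L : R) : x_ n @[n --> \oo] --> L ->
  (forall eta, 0 < eta -> \forall n \near \oo, `|x_ n| <= eta) -> L = 0.
Proof.
move=> xL h; apply: (cvg_unique _ xL); first exact: norm_hausdorff.
by apply/cvgrPdist_le => eta e0; apply: filterS (h eta e0) => n; rewrite sub0r normrN.
Qed.

Lemma poi_out (e t : R) : 2^-1 < t -> poiA e t = 0 /\ poiB e t = 0.
Proof.
move=> /mvb_lt tb; have tb' : mvb - t ^+ d.+1 <= 0 by rewrite subr_le0 ltW.
by rewrite /poiA /poiB /mvk !tpow_neg// !(mulr0, mul0r).
Qed.

Lemma poiA_continuous (e t : R) : 0 < e -> 0 <= t -> {for t, continuous (poiA e)}.
Proof.
move=> e0 t0; have et : 0 < e + t by rewrite ltr_wpDr.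
have c1 : {for t, continuous (fun x : R => tpow 3 (mvb - x ^+ d.+1))}.
  apply: (@continuous_comp _ _ _ (fun t : R => mvb - t ^+ d.+1) (tpow 3)).
    by apply: cvgB; [exact: cvg_cst|exact: exprn_continuous].
  exact: tpow_continuous.
apply: cvgM c1; first by apply: cvgM; [exact: cvg_cst|exact: invX_continuous].
Qed.

Lemma poiB_continuous (e t : R) : 0 < e -> 0 <= t -> {for t, continuous (poiB e)}.
Proof.
move=> e0 t0; have et : 0 < e + t by rewrite ltr_wpDr.
have c1 : {for t, continuous (fun x : R => (x / (e + x)) ^+ d)}.
  apply: (@continuous_comp _ _ _ (fun t : R => t / (e + t)) (fun x : R => x ^+ d)).
    apply: cvgM; first exact: cvg_id.
    by apply: cvgV; [rewrite gt_eqF|apply: cvgD; [exact: cvg_cst|exact: cvg_id]].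
  exact: exprn_continuous.
by apply: cvgM c1; exact: cut_continuous cutoff_mvk t0.
Qed.

Lemma integrableC_radial G (k : R -> R) : (forall z, ball z -> continuousC_at G z) ->
  (forall t, 0 <= t -> {for t, continuous k}) -> (forall t, 2^-1 < t -> k t = 0) ->
  integrableC (fun z => G z * (k (sqnorm z))%:C).
Proof.
move=> cG ck k0; apply: (integrableC_support half_lt1) => z zb; last by rewrite k0// mulr0.
apply: continuousC_mul; first exact: cG.
apply: continuousC_real; apply: (@continuous_comp _ _ _ (@sqnorm R d) k).
  exact: sqnorm_continuous.
exact: ck (sqnorm_ge0 z).
Qed.

Lemma Re_integralC F :
  complex.Re (integralC F) = Rintegral mu ball (fun z => complex.Re (F z)).
Proof. by []. Qed.

Lemma Im_integralC F :
  complex.Im (integralC F) = Rintegral mu ball (fun z => complex.Im (F z)).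
Proof. by []. Qed.

Lemma integralC0 F : (forall z, ball z -> F z = 0) -> integralC F = 0.
Proof.
move=> F0; apply: complexP; rewrite /integralC/=;
  (under eq_Rintegral => z do [rewrite inE => zb; rewrite F0//=]);
  rewrite Rintegral_cst ?mul0r//; exact: measurable_unit_ball.
Qed.

Lemma integralC_poi G (e : R) : 0 < e -> Ck 1 G -> (forall z, ball z -> opNbar G z = 0) ->
  integralC (fun z => G z * (poiA e (sqnorm z))%:C) =
  integralC (fun z => G z * (poiB e (sqnorm z))%:C).
Proof.
move=> e0 hG G0; have cG := Ck_cont hG.
have iA := integrableC_radial cG (fun t => @poiA_continuous e t e0) (fun t h => (poi_out e h).1).
have iB := integrableC_radial cG (fun t => @poiB_continuous e t e0) (fun t h => (poi_out e h).2).
have h := integralC_opNbar_cut hG (cutoff_poik e0).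
rewrite integralC0 in h; last by move=> z zb; rewrite G0// mul0r.
apply/eqP; rewrite -subr_eq0 -mulN1r -(integralC_cmul (-1) iB).
rewrite -(integralC_add iA (integrableC_cmul (-1) iB)).
move/esym/eqP : h; rewrite oppr_eq0 => /eqP <-; apply/eqP; apply: integralC_ext => z _.
rewrite radN_poik ?sqnorm_ge0// realCD mulrDr mulN1r; congr (_ + _); rewrite -mulrN.
by congr (_ * _); apply: complexP; rewrite /= ?oppr0.
Qed.

Lemma Rintegral_poiA_le (e : R) : 0 < e -> Rintegral mu ball (fun z => poiA e (sqnorm z)) <= mvI.
Proof.
move=> e0.
have -> : Rintegral mu ball (fun z => poiA e (sqnorm z)) =
    Rintegral mu ball (fun z => poiB e (sqnorm z)).
  have := @integralC_poi (fun=> 1) e e0 (Ck_cst 1 1) (fun z _ => opNbar_cst 1 z).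
  move=> /(congr1 (@complex.Re R)); rewrite !Re_integralC.
  under eq_Rintegral do rewrite mul1r Re_real.
  by under [in RHS]eq_Rintegral do rewrite mul1r Re_real.
apply: le_Rintegral.
- exact: measurable_unit_ball.
- by apply: integrable_sq => t; exact: poiB_continuous.
- exact: integrable_mvk.
- by move=> z _; have /andP[] := poiB_le e0 (sqnorm_ge0 z).
Qed.

Lemma poiA_ge0 (e t : R) : 0 < e -> 0 <= t -> 0 <= poiA e t.
Proof.
move=> e0 t0; rewrite /poiA mulr_ge0 ?tpow_ge0// mulr_ge0 ?invr_ge0 ?exprn_ge0//.
- by rewrite mulr_ge0// ltW.
- by rewrite addr_ge0// ltW.
Qed.

Lemma poiA_le (e t del : R) : 0 < e -> 0 < del -> del <= t ->
  poiA e t <= d%:R * e * del ^- d.+1 * mvb ^+ 3.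
Proof.
move=> e0 d0 dt; have t0 : 0 <= t by rewrite (le_trans (ltW d0)).
have b0 : 0 <= mvb by rewrite exprn_ge0 ?invr_ge0.
rewrite /poiA; apply: ler_pM.
- by rewrite mulr_ge0 ?invr_ge0 ?exprn_ge0 ?addr_ge0 ?(ltW e0)// mulr_ge0// ltW.
- exact: tpow_ge0.
- rewrite ler_wpM2l// ?mulr_ge0// ?(ltW e0)//.
  rewrite lef_pV2 ?posrE ?exprn_gt0//; last by rewrite ltr_wpDr.
  by rewrite lerXn2r ?nnegrE ?addr_ge0 ?(ltW e0) ?(ltW d0)// (le_trans dt)// lerDr ltW.
- rewrite /tpow lerXn2r ?nnegrE//; first by rewrite le_max lexx orbT.
  by rewrite ge_max b0 andbT lerBlDr lerDl exprn_ge0.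
Qed.

Lemma mean_value_weak F : Ck 1 F -> (forall z, ball z -> opNbar F z = 0) -> F 0 = 0 ->
  integralC (fun z => F z * (mvk (sqnorm z))%:C) = 0.
Proof.
move=> hF F0bar F00.
have cF z : ball z -> continuousC_at F z by exact: (Ck_cont hF).
have b0 : ball 0.
  by rewrite /unit_ball /= /sqnorm big1 ?ltr01// => j _; rewrite !mxE expr0n addr0.
pose e n : R := n.+1%:R^-1.
have e0 n : 0 < e n by rewrite invr_gt0.
pose A n z := F z * (poiA (e n) (sqnorm z))%:C.
pose B n z := F z * (poiB (e n) (sqnorm z))%:C.
have [M M0 FM] := continuousC_bounded half_lt1 cF.
have iA n : integrableC (A n).
  exact: integrableC_radial cF (fun t => @poiA_continuous (e n) t (e0 n)) (fun t h => (poi_out (e n) h).1).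
have iB n : integrableC (B n).
  exact: integrableC_radial cF (fun t => @poiB_continuous (e n) t (e0 n)) (fun t h => (poi_out (e n) h).2).
have mvk0 : forall t, 2^-1 < t -> mvk t = 0 := cut0 cutoff_mvk.
have nB n z : normc (B n z) <= M * mvk (sqnorm z).
  rewrite /B normcM normc_real.
  have /andP[p1 p2] := poiB_le (e0 n) (sqnorm_ge0 z); rewrite ger0_norm//.
  have [zh|zh] := leP (sqnorm z) 2^-1; first by rewrite ler_pM ?normc_ge0// FM.
  by rewrite (poi_out (e n) zh).2 mulr0 mulr_ge0// mvk_ge0// sqnorm_ge0.
have cvB z : ball z -> poiB (e n) (sqnorm z) @[n --> \oo] --> mvk (sqnorm z).
  by move=> _; exact: poiB_cvg (sqnorm_ge0 z).
have [iF cRe cIm] : [/\ integrableC (fun z => F z * (mvk (sqnorm z))%:C),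
    complex.Re (integralC (B n)) @[n --> \oo] -->
      complex.Re (integralC (fun z => F z * (mvk (sqnorm z))%:C)) &
    complex.Im (integralC (B n)) @[n --> \oo] -->
      complex.Im (integralC (fun z => F z * (mvk (sqnorm z))%:C))].
  apply: (@integralC_cvg _ _ B _ (fun z => M * mvk (sqnorm z))).
  - by move=> n; exact: integrableC_measurable.
  - exact: (integrableZl measurable_unit_ball M integrable_mvk).
  - by move=> n z _; exact: nB.
  - move=> z zb; rewrite /B ReCM /= mulr0 subr0; under eq_fun do rewrite ReCM /= mulr0 subr0.
    by apply: cvgM; [exact: cvg_cst|exact: cvB].
  - move=> z zb; rewrite /B ImCM /= mulr0 add0r; under eq_fun do rewrite ImCM /= mulr0 add0r.
    by apply: cvgM; [exact: cvg_cst|exact: cvB].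
have small eta : 0 < eta -> \forall n \near \oo, normc (integralC (B n)) <= eta.
  move=> eta0.
  pose eta' := eta / (4 * (mvI + 1)).
  have I1 : 0 < mvI + 1 by rewrite ltr_wpDl ?mvI_ge0.
  have eta'0 : 0 < eta' by rewrite divr_gt0// mulr_gt0.
  have [del del0 hdel] := continuous_nbhs_sqnorm (cF 0 b0) eta'0.
  pose C := M * (d%:R * del ^- d.+1 * mvb ^+ 3).
  have C0 : 0 <= C.
    by rewrite !mulr_ge0// ?invr_ge0 ?exprn_ge0 ?invr_ge0 ?(ltW del0).
  pose vol := fine (mu ball).
  have bound n : normc (integralC (B n)) <= 2 * (eta' * mvI + C * vol * e n).
    rewrite /B -integralC_poi//.
    have mb := @measurable_unit_ball R d.
    have iPA : mu.-integrable ball (EFin \o (fun z : Cd => poiA (e n) (sqnorm z))).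
      by apply: integrable_sq => t; exact: poiA_continuous.
    have icst (c : R) : mu.-integrable ball (EFin \o (fun _ : Cd => c)).
      by apply: (@bounded_integrable_ball _ _ _ `|c|).
    have iePA : mu.-integrable ball (EFin \o (fun z : Cd => eta' * poiA (e n) (sqnorm z))).
      exact: (integrableZl mb eta' iPA).
    have ig : mu.-integrable ball
        (EFin \o (fun z : Cd => eta' * poiA (e n) (sqnorm z) + C * e n)).
      exact: (integrableD mb iePA (icst _)).
    apply: (@le_trans _ _ (2 * Rintegral mu ball (fun z : Cd => eta' * poiA (e n) (sqnorm z) + C * e n))).
      apply: (normc_integralC (iA n) ig) => z zb.
      rewrite /A normcM normc_real ger0_norm ?poiA_ge0 ?sqnorm_ge0//.
      have pa0 := poiA_ge0 (e0 n) (sqnorm_ge0 z).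
      have Ce0 : 0 <= C * e n by rewrite mulr_ge0// ltW.
      have [zh|zh] := leP (sqnorm z) 2^-1; last first.
        by rewrite (poi_out (e n) zh).1 !mulr0 add0r.
      have [zd|zd] := ltP (sqnorm z) del.
        have := hdel z zd; rewrite F00 subr0 => h.
        by apply: (@le_trans _ _ (eta' * poiA (e n) (sqnorm z))); [rewrite ler_wpM2r|rewrite lerDl].
      apply: (@le_trans _ _ (C * e n)); last by rewrite lerDr mulr_ge0// ltW.
      apply: (@le_trans _ _ (M * (d%:R * e n * del ^- d.+1 * mvb ^+ 3))).
        by apply: ler_pM; rewrite ?normc_ge0// ?FM// poiA_le.
      by rewrite /C le_eqVlt; apply/orP; left; apply/eqP; ring.
    rewrite ler_pM2l// (RintegralD mb iePA (icst _)) (RintegralZl _ mb iPA) Rintegral_cst//.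
    apply: lerD; last by rewrite -/vol le_eqVlt; apply/orP; left; apply/eqP; ring.
    by rewrite ler_pM2l// Rintegral_poiA_le.
  have vol0 : 0 <= vol by rewrite fine_ge0.
  have en0 : e n @[n --> \oo] --> (0 : R) by exact: cvg_harmonic.
  have eC0 : 0 < eta / (4 * (C * vol + 1)).
    by rewrite divr_gt0// mulr_gt0// ltr_wpDl// mulr_ge0.
  move/cvgrPdist_le : en0 => /(_ _ eC0); apply: filterS => n.
  rewrite sub0r normrN ger0_norm ?(ltW (e0 n))// => hn.
  apply: le_trans (bound n) _.
  have h1 : eta' * mvI <= eta / 4.
    rewrite /eta' invfM mulrA -mulrA ler_piMr ?divr_ge0 ?(ltW eta0)//.
    by rewrite mulrC ler_pdivrMr// mul1r lerDl.
  have h2 : C * vol * e n <= eta / 4.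
    apply: (@le_trans _ _ (C * vol * (eta / (4 * (C * vol + 1))))).
      by rewrite ler_wpM2l// mulr_ge0.
    have Cv0 : 0 <= C * vol by rewrite mulr_ge0.
    rewrite invfM [X in _ * X]mulrA mulrCA ler_piMr ?divr_ge0 ?(ltW eta0)//.
    by rewrite ler_pdivrMr ?mul1r ?lerDl// ltr_wpDl.
  lra.
apply: complexP.
- apply: (cvg_small cRe) => eta /small; apply: filterS => n.
  by apply: le_trans; exact: Re_le_normc.
- apply: (cvg_small cIm) => eta /small; apply: filterS => n.
  by apply: le_trans; exact: Im_le_normc.
Qed.

Lemma unit_ball0 : ball 0.
Proof. by rewrite /unit_ball /= /sqnorm big1 ?ltr01// => j _; rewrite !mxE expr0n addr0. Qed.

Lemma mean_value F : Ck 1 F -> (forall z, ball z -> opNbar F z = 0) ->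
  integralC (fun z => F z * (mvk (sqnorm z))%:C) = F 0 * mvI%:C.
Proof.
move=> hF F0bar.
pose G z := F z + (- F 0).
have hG : Ck 1 G := Ck_add hF (Ck_cst 1 _).
have G0bar z : ball z -> opNbar G z = 0.
  move=> zb; have h := opNbar_add (Ck_diff1 hF zb) (diff1_cst z (- F 0)).
  by rewrite [LHS]h F0bar// opNbar_cst addr0.
have ck t : 0 <= t -> {for t, continuous mvk} := cut_continuous cutoff_mvk.
have k0 : forall t, 2^-1 < t -> mvk t = 0 := cut0 cutoff_mvk.
have i1 := integrableC_radial (Ck_cont hF) ck k0.
have i2 := integrableC_radial (Ck_cont (Ck_cst 1 (1 : R[i]))) ck k0.
have := mean_value_weak hG G0bar (subrr _).
rewrite (_ : integralC _ = integralC (fun z => F z * (mvk (sqnorm z))%:C +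
    (- F 0) * (1 * (mvk (sqnorm z))%:C))); last first.
  by apply: integralC_ext => z _; rewrite /G mulrDl mul1r.
rewrite (integralC_add i1 (integrableC_cmul _ i2)) (integralC_cmul _ i2) => /eqP.
rewrite mulNr subr_eq0 => /eqP ->; congr (_ * _).
apply: complexP; rewrite ?Re_integralC ?Im_integralC.
- by rewrite /mvI; apply: eq_Rintegral => z _; rewrite mul1r.
- under eq_Rintegral do rewrite mul1r Im_real.
  by rewrite Rintegral_cst ?mul0r//; exact: measurable_unit_ball.
Qed.

End mean_value.

(** * Regularity of holomorphic functions *)

Section scaling.
Context {R : realType} {d : nat}.
Local Notation Cd := (Cspace R d).
Local Notation mu := (@lebesgue_C R d).
Local Notation ball := (@unit_ball R d).
Implicit Types (F G f g : Cd -> R[i]) (z v w : Cd).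

Lemma ball_norm_le1 w : ball w -> `|w| <= 1.
Proof.
move=> wb.
have h (x : R) : x ^+ 2 <= sqnorm w -> `|x| <= 1.
  move=> xw; rewrite -(@expr_le1 _ 2)// real_normK ?num_real//.
  exact: le_trans xw (ltW wb).
rewrite prod_normE ge_max; apply/andP; split; rewrite [leLHS]mx_normrE;
  apply: bigmax_le => // -[i j] _ /=; rewrite ord1; apply: h;
  apply: le_trans (sqr_coord_le w j); by rewrite ?lerDl ?lerDr sqr_ge0.
Qed.

Lemma admissible z0 : ball z0 -> exists r rho q : R,
  [/\ 0 < r, 0 < rho, q < 1 &
   forall z w, `|z - z0| < rho -> ball w -> sqnorm (z + r *: w) <= q].
Proof.
move=> z0b; pose q := (1 + sqnorm z0) / 2.
have z01 : sqnorm z0 < 1 by [].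
have q1 : q < 1 by rewrite /q; lra.
have zq : sqnorm z0 < q by rewrite /q; lra.
have /nbhs_ballP[e /= e0 eb] : nbhs z0 [set z | sqnorm z < q].
  apply: open_nbhs_nbhs; split => //.
  by apply: (@open_comp _ _ (@sqnorm R d) [set x | x < q]) => [y _|];
    [exact: sqnorm_continuous|exact: open_lt].
have e2 : 0 < e / 2 by rewrite divr_gt0.
exists (e / 2), (e / 2), q; split => // z w zz wb.
apply/ltW/eb; rewrite -ball_normE /= distrC addrAC.
apply: le_lt_trans (ler_normD _ _) _.
have : `|(e / 2) *: w| <= e / 2.
  by rewrite normrZ gtr0_norm// ler_piMr ?(ltW e2)// ball_norm_le1.
lra.
Qed.

Lemma is_derive_scale (u : Cd -> R) z (r : R) w v l : is_derive (z + r *: w) v u l ->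
  is_derive w v (fun y => u (z + r *: y)) (r * l).
Proof.
move=> /is_derive_dirP h; apply/is_derive_dirP.
have dr : is_derive (0 : R) (1 : R) (fun x : R => r * x) r.
  have := is_derive_mulf (is_derive_cst r (0 : R) (1 : R)) (is_derive_id (0 : R) (1 : R)).
  by rewrite mul0r add0r mulr1.
have h' : is_derive (r * 0) (1 : R) (fun x : R => u (x *: v + (z + r *: w))) l by rewrite mulr0.
have := is_derive1_comp h' dr; rewrite mulrC.
congr (is_derive _ _ _ _); apply/funext => x /=; congr u.
by rewrite scalerDr scalerA addrCA.
Qed.

Lemma is_deriveC_scale f z (r : R) w v l : is_deriveC (z + r *: w) v f l ->
  is_deriveC w v (fun y => f (z + r *: y)) (r%:C * l).
Proof.
move=> [h1 h2]; split; rewrite ?ReCM ?ImCM /= !mul0r ?subr0 ?addr0.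
- exact: is_derive_scale h1.
- exact: is_derive_scale h2.
Qed.

Lemma affine_continuous z (r : R) : continuous (fun w : Cd => z + r *: w).
Proof. by move=> w; apply: cvgD; [exact: cvg_cst|apply: cvgZr; exact: cvg_id]. Qed.

Lemma continuousC_scale f z (r : R) w : continuousC_at f (z + r *: w) ->
  continuousC_at (fun y => f (z + r *: y)) w.
Proof.
move=> [h1 h2]; split.
- apply: (@continuous_comp _ _ _ (fun y : Cd => z + r *: y) (fun y => complex.Re (f y))) => //.
  exact: affine_continuous.
- apply: (@continuous_comp _ _ _ (fun y : Cd => z + r *: y) (fun y => complex.Im (f y))) => //.
  exact: affine_continuous.
Qed.

Lemma deriveC_scale f z (r : R) w b j : Ck 1 f -> ball (z + r *: w) ->
  deriveC (real_dir b j) (fun y => f (z + r *: y)) w =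
  r%:C * deriveC (real_dir b j) f (z + r *: w).
Proof.
by move=> hf zb; apply/is_deriveC_val/is_deriveC_scale/derivableCP; exact: Ck_derivable hf zb.
Qed.

Lemma Ck1_scale f z (r : R) : Ck 1 f -> (forall w, ball w -> ball (z + r *: w)) ->
  Ck 1 (fun y => f (z + r *: y)).
Proof.
move=> hf zb.
apply: (@Ck_build _ _ 0 _ (fun b j w => r%:C * deriveC (real_dir b j) f (z + r *: w))).
- move=> w wb; apply: continuousC_scale; exact: Ck_cont hf _ (zb w wb).
- move=> b j w wb; apply: is_deriveC_scale; apply: derivableCP; exact: Ck_derivable hf (zb w wb).
- move=> b j; split => // w wb; apply: continuousC_mul; first exact: continuousC_cst.
  apply: continuousC_scale; exact: Ck_cont (Ck_deriveC b j hf) _ (zb w wb).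
Qed.

Lemma opNbar_scale0 f z (r : R) w : Ck 1 f -> ball (z + r *: w) ->
  (forall j, dzbar j f (z + r *: w) = 0) -> opNbar (fun y => f (z + r *: y)) w = 0.
Proof.
move=> hf zb f0; rewrite /opNbar big1// => j _.
rewrite /dzbar !deriveC_scale// [X in _ + X]mulrCA -mulrDr -mulrA.
by rewrite -/(dzbar j f (z + r *: w)) f0 !mulr0.
Qed.

Lemma mean_value_scale f z (r : R) : holomorphic f -> (forall w, ball w -> ball (z + r *: w)) ->
  integralC (fun w => f (z + r *: w) * (@mvk R d (sqnorm w))%:C) = f z * (@mvI R d)%:C.
Proof.
move=> [hf f0] zb; rewrite (mean_value (Ck1_scale hf zb)).
  by rewrite scaler0 addr0.
by move=> w wb; apply: opNbar_scale0 => //; [exact: zb|move=> j; exact: f0 (zb w wb)].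
Qed.

Lemma continuous_seq (g : Cd -> R) z0 (P : set Cd) : nbhs z0 P ->
  (forall u : nat -> Cd, (forall n, P (u n)) -> u n @[n --> \oo] --> z0 ->
    g (u n) @[n --> \oo] --> g z0) -> {for z0, continuous g}.
Proof.
move=> nP h; apply/cvgrPdist_lt => e e0; apply: contrapT => nA.
have ex n : exists z, [/\ pseudometric_structure.ball z0 (n.+1%:R^-1) z, P z &
    ~ `|g z0 - g z| < e].
  apply: contrapT => /forallNP hn; apply: nA.
  have nb : nbhs z0 (pseudometric_structure.ball z0 (n.+1%:R^-1)).
    by apply: nbhsx_ballx; rewrite invr_gt0.
  apply: filterS2 nb nP => z zb Pz; apply: contrapT => zA; exact: (hn z).
have [u hu] := choice ex.
have uz : u n @[n --> \oo] --> z0.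
  apply/cvg_ballP => eps eps0.
  have /cvgrPdist_lt/(_ _ eps0) : n.+1%:R^-1 @[n --> \oo] --> (0 : R) by exact: cvg_harmonic.
  apply: filterS => n; rewrite sub0r normrN ger0_norm// => hn.
  by apply: le_ball (ltW hn) _ _; have [] := hu n.
have := h u (fun n => (let: And3 _ Pu _ := hu n in Pu)) uz.
move=> /cvgrPdist_lt/(_ _ e0)[N _ hN].
by have [_ _] := hu N; apply; apply: hN => /=.
Qed.

End scaling.

Section under_integral.
Context {R : realType} {d : nat}.
Local Notation Cd := (Cspace R d).
Local Notation mu := (@lebesgue_C R d).
Local Notation ball := (@unit_ball R d).
Implicit Types (F G f g : Cd -> R[i]) (z v w : Cd).
Variables (z0 : Cd) (r rho q : R) (K : Cd -> R) (MK : R).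
Hypothesis q1 : q < 1.
Hypothesis adm : forall z w, `|z - z0| < rho -> ball w -> sqnorm (z + r *: w) <= q.
Hypothesis mK : measurable_fun ball K.
Hypothesis KM : forall w, ball w -> `|K w| <= MK.

Let inb z w : `|z - z0| < rho -> ball w -> ball (z + r *: w).
Proof. by move=> zz wb; apply: le_lt_trans q1; exact: adm. Qed.

Section real.
Variable u : Cd -> R.
Hypothesis cu : forall z, ball z -> {for z, continuous u}.

Lemma measurable_scale z : `|z - z0| < rho ->
  measurable_fun ball (fun w => u (z + r *: w) * K w).
Proof.
move=> zz; apply: measurable_funM => //; apply: continuous_measurableC; first exact: open_unit_ball.
move=> w wb; apply: (@continuous_comp _ _ _ (fun y : Cd => z + r *: y) u).
  exact: affine_continuous.
by apply: cu; exact: inb.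
Qed.

Lemma scale_bound : exists2 M, 0 <= M &
  forall z w, `|z - z0| < rho -> ball w -> `|u (z + r *: w) * K w| <= M.
Proof.
have [M [M0 uM]] := continuous_bounded_on (@compact_sqnorm_le R d q)
  (fun z (hz : sqnorm z <= q) => cu (le_lt_trans hz q1)).
exists (M * `|MK|); first by rewrite mulr_ge0.
move=> z w zz wb; rewrite normrM; apply: ler_pM => //; first exact/uM/adm.
exact: le_trans (KM wb) (ler_norm _).
Qed.

Lemma integrable_scale z : `|z - z0| < rho ->
  mu.-integrable ball (EFin \o (fun w => u (z + r *: w) * K w)).
Proof.
move=> zz; have [M M0 h] := scale_bound.
by apply: (@bounded_integrable_ball _ _ _ M); [exact: measurable_scale|move=> w wb; exact: h].
Qed.

Lemma near_rho z : `|z - z0| < rho -> \forall y \near z, `|y - z0| < rho.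
Proof.
move=> zz; have e0 : 0 < rho - `|z - z0| by rewrite subr_gt0.
apply/nbhs_ballP; exists (rho - `|z - z0|) => // y; rewrite -ball_normE /= distrC => yz.
rewrite -(subrK z y) -addrA; apply: le_lt_trans (ler_normD _ _) _; lra.
Qed.

Lemma continuous_under z : `|z - z0| < rho ->
  {for z, continuous (fun z => Rintegral mu ball (fun w => u (z + r *: w) * K w))}.
Proof.
move=> zz; apply: (continuous_seq (near_rho zz)) => s hs sz.
have [M M0 h] := scale_bound.
have [] := @Rdominated_convergence R _ _ mu ball (fun n w => u (s n + r *: w) * K w)
  (fun w => u (z + r *: w) * K w) (fun=> M) measurable_unit_ball.
- by move=> n; exact: measurable_scale.
- move=> w wb; apply: cvgM; last exact: cvg_cst.
  have h1 : s n + r *: w @[n --> \oo] --> z + r *: w.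
    by apply: cvgD; [exact: sz|exact: cvg_cst].
  exact: (cvg_comp _ _ h1 (cu (inb zz wb))).
- by apply: (@bounded_integrable_ball _ _ _ M) => // w _; rewrite ger0_norm.
- by move=> n w wb; exact: h.
- by move=> _.
Qed.

End real.

Lemma derive_under (u : Cd -> R) v z :
  (forall y, ball y -> {for y, continuous u}) ->
  (forall y, ball y -> derivable u y v) ->
  (forall y, ball y -> {for y, continuous ('D_v u)}) ->
  `|z - z0| < rho ->
  is_derive z v (fun z => Rintegral mu ball (fun w => u (z + r *: w) * K w))
    (Rintegral mu ball (fun w => 'D_v u (z + r *: w) * K w)).
Proof.
move=> cu du cdu zz.
pose eta := (rho - `|z - z0|) / (1 + `|v|).
have v1 : 0 < 1 + `|v| by rewrite ltr_wpDr.
have eta0 : 0 < eta by rewrite divr_gt0// subr_gt0.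
have near_line (x : R) : x \in `]- eta, eta[ -> `|z + x *: v - z0| < rho.
  rewrite in_itv/= -ltr_norml => xe; rewrite addrAC; apply: le_lt_trans (ler_normD _ _) _.
  rewrite normrZ -ltrBrDl; apply: (@le_lt_trans _ _ (`|x| * (1 + `|v|))).
    by rewrite ler_wpM2l// lerDr.
  by rewrite -ltr_pdivlMr.
pose f (x : R) (w : Cd) : R := u (z + x *: v + r *: w) * K w.
have fE (x : R) w : x \in `]- eta, eta[ -> ball w ->
    is_derive x (1 : R) (f ^~ w) ('D_v u (z + x *: v + r *: w) * K w).
  move=> xe wb; have dl := @is_derive_line R d u (z + r *: w) v x.
  have E y : z + r *: w + y *: v = z + y *: v + r *: w by rewrite addrAC.
  have {}dl : is_derive x (1 : R) (fun s : R => u (z + s *: v + r *: w))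
      ('D_v u (z + x *: v + r *: w)).
    move: dl; rewrite E; under eq_fun do rewrite E; apply.
    by apply: du; apply: inb => //; exact: near_line.
  apply: is_derive_eq (is_derive_mulf dl (is_derive_cst (K w) x (1 : R))) _.
  by rewrite mulr0 addr0.
have [M M0 hM] := scale_bound cdu.
have e00 : (0 : R) \in `]- eta, eta[ by rewrite in_itv/= oppr_lt0 eta0.
have d1 (x : R) w : x \in `]- eta, eta[ -> ball w ->
    partial1of2 f x w = 'D_v u (z + x *: v + r *: w) * K w.
  by move=> xe wb; rewrite partial1of2E; have [_ ->] := fE x w xe wb.
have intf (x : R) : (`]- eta, eta[%classic : set R) x -> mu.-integrable ball (EFin \o f x).
  by move=> /= xe; apply: integrable_scale => //; exact: near_line.
have derf (x : R) w : (`]- eta, eta[%classic : set R) x -> ball w -> derivable (f ^~ w) x 1.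
  by move=> /= xe wb; have [] := fE x w xe wb.
have intG : mu.-integrable ball (EFin \o (fun _ : Cd => M)).
  by apply: (@bounded_integrable_ball _ _ _ M) => // w _; rewrite ger0_norm.
have Gub (x : R) w : (`]- eta, eta[%classic : set R) x -> ball w ->
    `|partial1of2 f x w| <= M.
  by move=> /= xe wb; rewrite d1//; apply: hM => //; exact: near_line.
have H := @cvg_differentiation_under_integral R _ _ mu f ball measurable_unit_ball 0 (- eta) eta
  e00 intf derf (fun=> M) (fun=> M0) intG Gub.
have E0 : Rintegral mu ball (fun y => partial1of2 f 0 y) =
    Rintegral mu ball (fun w => 'D_v u (z + r *: w) * K w).
  by apply: eq_Rintegral => w /[!inE] wb; rewrite d1// scale0r addr0.
have cv : h^-1 *: (((fun z => Rintegral mu ball (fun w => u (z + r *: w) * K w)) \o shift z) (h *: v) -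
    Rintegral mu ball (fun w => u (z + r *: w) * K w)) @[h --> (0 : R)^'] -->
    Rintegral mu ball (fun w => 'D_v u (z + r *: w) * K w).
  rewrite -E0; apply: cvg_trans H; apply: near_eq_cvg; apply: nearW => h /=.
  rewrite addr0 /f; congr (_ *: (_ - _)).
    by apply: eq_Rintegral => w _; rewrite [z + _]addrC.
  by apply: eq_Rintegral => w _; rewrite scale0r addr0.
split; first by apply/cvg_ex; eexists; exact: cv.
exact/cvg_lim.
Qed.

Let Re_mul_real (x : R[i]) (y : R) : complex.Re (x * y%:C) = complex.Re x * y.
Proof. by rewrite ReCM /= mulr0 subr0. Qed.
Let Im_mul_real (x : R[i]) (y : R) : complex.Im (x * y%:C) = complex.Im x * y.
Proof. by rewrite ImCM /= mulr0 add0r. Qed.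

Lemma integrableC_scale f z : (forall y, ball y -> continuousC_at f y) -> `|z - z0| < rho ->
  integrableC (fun w => f (z + r *: w) * (K w)%:C).
Proof.
move=> cf zz; split.
- under eq_fun do rewrite Re_mul_real.
  by apply: (@integrable_scale (fun z => complex.Re (f z))) => // y yb; exact: (cf y yb).1.
- under eq_fun do rewrite Im_mul_real.
  by apply: (@integrable_scale (fun z => complex.Im (f z))) => // y yb; exact: (cf y yb).2.
Qed.

Lemma continuousC_under f z : (forall y, ball y -> continuousC_at f y) -> `|z - z0| < rho ->
  continuousC_at (fun z => integralC (fun w => f (z + r *: w) * (K w)%:C)) z.
Proof.
move=> cf zz; split.
- have h := @continuous_under (fun z => complex.Re (f z)) (fun y yb => (cf y yb).1) z zz.
  rewrite /prop_for (_ : (fun y => _) =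
    (fun z => Rintegral mu ball (fun w => complex.Re (f (z + r *: w)) * K w)))//.
  by apply/funext => y; rewrite Re_integralC; apply: eq_Rintegral => w _; rewrite Re_mul_real.
- have h := @continuous_under (fun z => complex.Im (f z)) (fun y yb => (cf y yb).2) z zz.
  rewrite /prop_for (_ : (fun y => _) =
    (fun z => Rintegral mu ball (fun w => complex.Im (f (z + r *: w)) * K w)))//.
  by apply/funext => y; rewrite Im_integralC; apply: eq_Rintegral => w _; rewrite Im_mul_real.
Qed.

Lemma deriveC_under f b j z : Ck 1 f -> `|z - z0| < rho ->
  is_deriveC z (real_dir b j) (fun z => integralC (fun w => f (z + r *: w) * (K w)%:C))
    (integralC (fun w => deriveC (real_dir b j) f (z + r *: w) * (K w)%:C)).
Proof.
move=> hf zz.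
have cf := Ck_cont hf; have cd := Ck_cont (Ck_deriveC b j hf).
have df y (yb : ball y) := Ck_derivable b j hf yb.
split.
- have := @derive_under (fun z => complex.Re (f z)) _ z (fun y yb => (cf y yb).1)
    (fun y yb => (df y yb).1) (fun y yb => (cd y yb).1) zz.
  congr (is_derive _ _ _ _).
    by apply/funext => y; rewrite Re_integralC; apply: eq_Rintegral => w _; rewrite Re_mul_real.
  by rewrite Re_integralC; apply: eq_Rintegral => w _; rewrite Re_mul_real.
- have := @derive_under (fun z => complex.Im (f z)) _ z (fun y yb => (cf y yb).2)
    (fun y yb => (df y yb).2) (fun y yb => (cd y yb).2) zz.
  congr (is_derive _ _ _ _).
    by apply/funext => y; rewrite Im_integralC; apply: eq_Rintegral => w _; rewrite Im_mul_real.
  by rewrite Im_integralC; apply: eq_Rintegral => w _; rewrite Im_mul_real.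
Qed.

End under_integral.

Section regularity.
Context {R : realType} {d : nat}.
Local Notation Cd := (Cspace R d).
Local Notation mu := (@lebesgue_C R d).
Local Notation ball := (@unit_ball R d).
Hypothesis d_gt0 : (0 < d)%N.
Implicit Types (F G f g : Cd -> R[i]) (z v w : Cd).

Lemma bounded_radial (k : R -> R) : (forall t, 0 <= t -> {for t, continuous k}) ->
  measurable_fun ball (fun w : Cd => k (sqnorm w)) /\
  exists M : R, forall w : Cd, ball w -> `|k (sqnorm w)| <= M.
Proof.
move=> ck.
have c z : {for z, continuous (fun w : Cd => k (sqnorm w))}.
  by apply: (@continuous_comp _ _ _ (@sqnorm R d) k);
    [exact: sqnorm_continuous|exact: ck (sqnorm_ge0 z)].
split; first by apply: continuous_measurableC; [exact: open_unit_ball|move=> z _; exact: c].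
have [M [_ h]] := continuous_bounded_on (@compact_sqnorm_le R d 1) (fun z _ => c z).
by exists M => w wb; apply: h; exact: ltW.
Qed.

Lemma bounded_kernel b j :
  measurable_fun ball (fun w : Cd => @mvk' R d (sqnorm w) * dsq b j w) /\
  exists M : R, forall w : Cd, ball w -> `|@mvk' R d (sqnorm w) * dsq b j w| <= M.
Proof.
have c z : {for z, continuous (fun w : Cd => @mvk' R d (sqnorm w) * dsq b j w)}.
  by apply: cvgM; [exact: cut_sq'_continuous (@cutoff_mvk R d)|exact: dsq_continuous].
split; first by apply: continuous_measurableC; [exact: open_unit_ball|move=> z _; exact: c].
have [M [_ h]] := continuous_bounded_on (@compact_sqnorm_le R d 1) (fun z _ => c z).
by exists M => w wb; apply: h; exact: ltW.
Qed.

Lemma second_derivative f z0 : holomorphic f -> ball z0 ->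
  exists H : bool -> 'I_d -> bool -> 'I_d -> Cd -> R[i],
  [/\ \forall z \near z0, forall b j b' i,
       is_deriveC z (real_dir b' i) (deriveC (real_dir b j) f) (H b j b' i z),
     forall b j b' i, continuousC_at (H b j b' i) z0 &
     forall b j i, H b j false i z0 + 'i%C * H b j true i z0 = 0].
Proof.
move=> holf z0b; have [hf f0] := holf.
have [r [rho [q [r0 rho0 q1 adm]]]] := admissible z0b.
have inb z w : `|z - z0| < rho -> ball w -> ball (z + r *: w).
  by move=> zz wb; apply: le_lt_trans q1; exact: adm.
have I0 : @mvI R d != 0 by rewrite gt_eqF// mvI_gt0.
have cf := Ck_cont hf.
have [mM [MM hMM]] := bounded_radial (fun t => @cut_continuous R 2^-1 _ _ t (@cutoff_mvk R d)).
pose K b j (w : Cd) := @mvk' R d (sqnorm w) * dsq b j w.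
have [mK MK] : (forall b j, measurable_fun ball (K b j)) /\
    forall b j, exists M : R, forall w, ball w -> `|K b j w| <= M.
  by split => b j; have [] := bounded_kernel b j.
pose c : R[i] := - (r * @mvI R d)^-1%:C.
have first z b j : `|z - z0| < rho -> deriveC (real_dir b j) f z =
    c * integralC (fun w => f (z + r *: w) * (K b j w)%:C).
  move=> zz.
  have zb : ball z by have := inb z _ zz (@unit_ball0 R d); rewrite scaler0 addr0.
  have e1 : deriveC (real_dir b j) f z * (@mvI R d)%:C =
      integralC (fun w => deriveC (real_dir b j) f (z + r *: w) * (@mvk R d (sqnorm w))%:C).
    have d1 := deriveC_under q1 adm mM hMM b j hf zz.
    have d2 := is_deriveC_mul (derivableCP (Ck_derivable b j hf zb))
      (is_deriveC_cst z (real_dir b j) (@mvI R d)%:C).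
    rewrite mulr0 addr0 in d2; rewrite -(is_deriveC_val d2).
    apply: is_deriveC_val; apply: is_deriveC_near d1.
    apply: filterS (near_rho zz) => y yz.
    by apply: mean_value_scale => // w wb; exact: inb.
  have hF : Ck 1 (fun w => f (z + r *: w)) by apply: Ck1_scale => // w wb; exact: inb.
  have e2 := integralC_derive_cut b j hF (@cutoff_mvk R d).
  have i1 : integrableC (fun w => deriveC (real_dir b j) f (z + r *: w) * (@mvk R d (sqnorm w))%:C).
    by apply: (integrableC_scale q1 adm mM hMM) => // y yb; exact: Ck_cont (Ck_deriveC b j hf) _ yb.
  have i2 : integrableC (fun w => f (z + r *: w) * (K b j w)%:C).
    by have [M hM] := MK b j; exact: (integrableC_scale q1 adm (mK b j) hM).
  rewrite (_ : integralC _ = integralC (fun w =>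
     r%:C * (deriveC (real_dir b j) f (z + r *: w) * (@mvk R d (sqnorm w))%:C) +
     f (z + r *: w) * (K b j w)%:C)) in e2; last first.
    apply: integralC_ext => w wb; rewrite deriveC_scale//; last exact: inb.
    by rewrite mulrA.
  rewrite (integralC_add (integrableC_cmul _ i1) i2) (integralC_cmul _ i1) -e1 in e2.
  move/eqP : e2; rewrite addrC addr_eq0 => /eqP ->.
  rewrite /c mulrNN realC_inv realCM.
  rewrite [deriveC _ _ _ * _]mulrC [r%:C * (_ * _)]mulrA mulKf//.
  by rewrite mulf_neq0// realC_neq0// gt_eqF.
exists (fun b j b' i z => c * integralC (fun w => deriveC (real_dir b' i) f (z + r *: w) * (K b j w)%:C)).
have zz0 : `|z0 - z0| < rho by rewrite subrr normr0.
split.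
- apply: filterS (near_rho zz0) => z zz b j b' i.
  have [M hM] := MK b j.
  have d1 := deriveC_under q1 adm (mK b j) hM b' i hf zz.
  have d2 := is_deriveC_mul (is_deriveC_cst z (real_dir b' i) c) d1.
  rewrite mul0r add0r in d2; apply: is_deriveC_near d2.
  by apply: filterS (near_rho zz) => y yz; rewrite first.
- move=> b j b' i; have [M hM] := MK b j.
  apply: continuousC_mul; first exact: continuousC_cst.
  apply: (continuousC_under q1 adm (mK b j) hM) => // y yb.
  exact: Ck_cont (Ck_deriveC b' i hf) _ yb.
- move=> b j i; have [M hM] := MK b j.
  have it b' : integrableC (fun w => deriveC (real_dir b' i) f (z0 + r *: w) * (K b j w)%:C).
    by apply: (integrableC_scale q1 adm (mK b j) hM) => // y yb; exact: Ck_cont (Ck_deriveC b' i hf) _ yb.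
  rewrite mulrCA -mulrDr -(integralC_cmul 'i%C (it true)).
  rewrite -(integralC_add (it false) (integrableC_cmul 'i%C (it true))).
  rewrite integralC0 ?mulr0// => w wb; rewrite mulrA -mulrDl.
  have := f0 (z0 + r *: w) i (inb _ _ zz0 wb); rewrite /dzbar => /eqP.
  by rewrite mulf_eq0 invr_eq0 pnatr_eq0 orbF => /eqP ->; rewrite mul0r.
Qed.

Lemma holomorphic_Ck2 f : holomorphic f -> Ck 2 f.
Proof.
move=> holf; have [hf f0] := holf.
apply: (@Ck_build _ _ 1 _ (fun b j => deriveC (real_dir b j) f)).
- exact: Ck_cont hf.
- by move=> b j z zb; apply: derivableCP; exact: Ck_derivable hf zb.
move=> b j; apply: (@Ck_build _ _ 0 _ (fun b' i => deriveC (real_dir b' i) (deriveC (real_dir b j) f))).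
- exact: Ck_cont (Ck_deriveC b j hf).
- move=> b' i z zb; have [H [h _ _]] := second_derivative holf zb.
  by apply/derivableCP/is_deriveC_ex; exact: (nbhs_singleton h).
- move=> b' i; split => // z zb; have [H [h1 h2 _]] := second_derivative holf zb.
  apply: near_continuousC (h2 b j b' i).
  by apply: filterS h1 => y hy; rewrite (is_deriveC_val (hy b j b' i)).
Qed.

Lemma holomorphic_dz f j : holomorphic f -> holomorphic (dz j f).
Proof.
move=> holf; have h2 := holomorphic_Ck2 holf.
split; first exact: Ck_dz.
move=> z i zb; have [H [h1 _ h3]] := second_derivative holf zb.
have {}h1 := nbhs_singleton h1.
have D b : dzbar i (deriveC (real_dir b j) f) z = 0.
  by rewrite /dzbar !(is_deriveC_val (h1 _ _ _ _)) h3 mul0r.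
have hD b : diff1 z (deriveC (real_dir b j) f) := Ck_diff1 (Ck_deriveC b j h2) zb.
rewrite /dz dzbar_mul; last 2 first.
- move=> b k; have e := is_deriveC_add (derivableCP (hD false b k))
    (is_deriveC_mul (is_deriveC_cst z (real_dir b k) (- (0 +i* 1))) (derivableCP (hD true b k))).
  by apply: is_deriveC_ex; apply: is_deriveC_near e; near=> y; rewrite mulNr.
- exact: diff1_cst.
rewrite dzbar_cst mulr0 addr0.
have -> : (fun w => deriveC (real_dir false j) f w - (0 +i* 1) * deriveC (real_dir true j) f w) =
   (fun w => deriveC (real_dir false j) f w + (- (0 +i* 1)) * deriveC (real_dir true j) f w).
  by apply/funext => w; rewrite mulNr.
have hm : diff1 z (fun w => - (0 +i* 1) * deriveC (real_dir true j) f w).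
  move=> b k; exact: is_deriveC_ex (is_deriveC_mul (is_deriveC_cst z (real_dir b k) _) (derivableCP (hD true b k))).
rewrite (dzbar_add _ (hD false) hm) (dzbar_mul _ (diff1_cst z _) (hD true)) !D dzbar_cst.
by rewrite mul0r mulr0 !addr0 mul0r.
Unshelve. all: by end_near. Qed.

Lemma holomorphic_opN f : holomorphic f -> holomorphic (opN f).
Proof.
move=> holf; split; first exact/Ck_opN/holomorphic_Ck2.
move=> z i zb.
suff : forall n (g : 'I_n -> Cd -> R[i]), (forall k, diff1 z (g k)) ->
    (forall k, dzbar i (g k) z = 0) -> dzbar i (fun w => \sum_(k < n) g k w) z = 0.
  apply => j.
    exact: Ck_diff1 (Ck_mul (Ck_coord 1 j) (holomorphic_dz j holf).1) zb.
  rewrite dzbar_mul ?dzbar_coord ?mul0r ?add0r ?(holomorphic_dz j holf).2 ?mulr0//.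
    exact: diff1_coord.
  exact: Ck_diff1 (holomorphic_dz j holf).1 zb.
move=> n g dg g0.
have hs : forall b k, is_deriveC z (real_dir b k) (fun w => \sum_(l < n) g l w)
    (\sum_(l < n) deriveC (real_dir b k) (g l) z).
  by move=> b k; apply: is_deriveC_sum => l; apply: derivableCP; exact: dg.
rewrite /dzbar !(is_deriveC_val (hs _ _)) mulr_sumr -big_split/= big_distrl/=.
by rewrite big1// => l _; exact: g0.
Qed.

End regularity.

(** * Weighted integration by parts *)

Section ecut.
Context {R : realType}.
Implicit Types (a e t : R).

Lemma is_derive_onem_powR a t : t < 1 ->
  is_derive t (1 : R) (fun x : R => (1 - x) `^ a) (- (a * (1 - t) `^ (a - 1))).
Proof.
move=> t1; have t0 : 0 < 1 - t by rewrite subr_gt0.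
have d1 := is_derive_addf (is_derive_cst (1 : R) t (1 : R)) (is_derive_oppf (is_derive_id t (1 : R))).
have d2 : is_derive (1 - t) (1 : R) (fun x : R => x `^ a) (a * (1 - t) `^ (a - 1)).
  exact: is_derive1_powR.
have := @is_derive_comp1 R R (fun x : R => x `^ a) (fun x : R => 1 - x) t 1 _ _ d2 d1.
by rewrite sub0r mulrN1.
Qed.

Lemma onem_powR_continuous a t : t < 1 -> {for t, continuous (fun x : R => (1 - x) `^ a)}.
Proof.
move=> /(is_derive_onem_powR a)[h _].
by apply: differentiable_continuous; exact/derivable1_diffP.
Qed.

(* (1 - t)^a ((1 - e - t)_+)^m increases to (1 - t)^(a + m) as e decreases to 0. *)
Definition ecut e a m t : R := (1 - t) `^ a * tpow m (1 - e - t).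

Definition ecut' e a m t : R := - (a * (1 - t) `^ (a - 1)) * tpow m.+2 (1 - e - t) -
  (1 - t) `^ a * (m.+2%:R * tpow m.+1 (1 - e - t) * 1).

Lemma cutoff_ecut e a m : 0 < e -> cutoff (1 - e) (ecut e a m.+2) (ecut' e a m).
Proof.
move=> e0; apply: (@cutoff_tpow R m (1 - e) (1 - e) (fun t => (1 - t) `^ a)
  (fun t => - (a * (1 - t) `^ (a - 1))) (fun t => t) (fun=> 1)) => //.
- by rewrite ltrBlDr ltrDl.
- by move=> t _; exact: cvg_cst.
- move=> t _ t1; split; first exact: is_derive_onem_powR.
  apply: cvgN; apply: cvgM; first exact: cvg_cst.
  exact: onem_powR_continuous.
Qed.

Lemma ecut_ge0 e a m t : 0 <= ecut e a m t.
Proof. by rewrite mulr_ge0 ?powR_ge0 ?tpow_ge0. Qed.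

Lemma powR_addn (x a : R) m : 0 < x -> x `^ (a + m%:R) = x `^ a * x ^+ m.
Proof.
move=> x0; rewrite powRD; last by rewrite (gt_eqF x0) implybT.
by rewrite powR_mulrn// ltW.
Qed.

Lemma ecut_le e a m t : 0 < e -> t < 1 -> ecut e a m t <= (1 - t) `^ (a + m%:R).
Proof.
move=> e0 t1; have t0 : 0 < 1 - t by rewrite subr_gt0.
rewrite powR_addn// /ecut ler_wpM2l ?powR_ge0// lerXn2r ?nnegrE//.
- by rewrite le_max lexx orbT.
- exact: ltW.
- by rewrite ge_max (ltW t0) andbT; lra.
Qed.

Lemma ecut_cvg a m t : t < 1 -> ecut n.+2%:R^-1 a m t @[n --> \oo] --> (1 - t) `^ (a + m%:R).
Proof.
move=> t1; have t0 : 0 < 1 - t by rewrite subr_gt0.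
rewrite powR_addn//; apply: cvgM; first exact: cvg_cst.
have h : (n.+2%:R^-1 : R) @[n --> \oo] --> 0.
  have := @cvg_harmonic R; rewrite -(cvg_shiftS (@harmonic R)); exact.
have h1 : 1 - n.+2%:R^-1 - t @[n --> \oo] --> 1 - 0 - t.
  by apply: cvgB; [apply: cvgB => //; exact: cvg_cst|exact: cvg_cst].
have := cvg_comp _ _ h1 (@tpow_continuous R m (1 - 0 - t)).
by rewrite subr0 tpow_pos ?(ltW t0).
Qed.

Lemma max0_le (x y : R) : x <= y -> Num.max x 0 <= Num.max y 0.
Proof. by move=> xy; rewrite ge_max; apply/andP; split; rewrite le_max ?xy// lexx orbT. Qed.

Lemma ecut_nd a m t n k : (n <= k)%N -> ecut n.+2%:R^-1 a m t <= ecut k.+2%:R^-1 a m t.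
Proof.
move=> nk; rewrite /ecut ler_wpM2l ?powR_ge0//.
have m0 (x : R) : Num.max x 0 \in Num.nneg by rewrite nnegrE le_max lexx orbT.
apply: lerXn2r => //; apply: max0_le; rewrite lerB// lerB// lef_pV2 ?posrE// ler_nat; exact: nk.
Qed.

Lemma powR_succ (x a : R) : 0 < x -> x `^ (a + 1) = x * x `^ a.
Proof. by move=> x0; rewrite (powR_addn a 1 x0) expr1 mulrC. Qed.

Lemma ecut_rad (dd e a : R) m t : t < 1 ->
  t * ecut' e a m t + dd * ecut e a m.+2 t =
  - a * ecut e (a - 1) m.+2 t + (a + dd) * ecut e a m.+2 t -
  m.+2%:R * ecut e a m.+1 t + m.+2%:R * ecut e (a + 1) m.+1 t.
Proof.
move=> t1; have t0 : 0 < 1 - t by rewrite subr_gt0.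
have e1 : (1 - t) `^ a = (1 - t) * (1 - t) `^ (a - 1) by rewrite -powR_succ// subrK.
rewrite /ecut' /ecut (powR_succ _ t0) e1; ring.
Qed.

End ecut.

Section weighted.
Context {R : realType} {d : nat}.
Local Notation Cd := (Cspace R d).
Local Notation mu := (@lebesgue_C R d).
Local Notation ball := (@unit_ball R d).
Implicit Types (F G f g psi : Cd -> R[i]) (z v w : Cd).

Definition wt (q : R) z : R := (1 - sqnorm z) `^ q.

Lemma wt_ge0 q z : 0 <= wt q z.
Proof. exact: powR_ge0. Qed.

Lemma wt_continuous q z : ball z -> {for z, continuous (wt q)}.
Proof.
move=> zb; apply: (@continuous_comp _ _ _ (@sqnorm R d) (fun t : R => (1 - t) `^ q)).
  exact: sqnorm_continuous.
exact: onem_powR_continuous.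
Qed.

Lemma measurable_wt q : measurable_fun ball (wt q).
Proof. by apply: continuous_measurableC; [exact: open_unit_ball|move=> z; exact: wt_continuous]. Qed.

Lemma wt_le p q z : ball z -> q <= p -> wt p z <= wt q z.
Proof.
move=> zb qp; rewrite /wt; apply: ger_powR => //.
by rewrite subr_gt0 zb/= lerBlDr lerDl sqnorm_ge0.
Qed.

Definition eN n : R := n.+2%:R^-1.

Lemma eN_gt0 n : 0 < eN n. Proof. by rewrite invr_gt0. Qed.

Definition ebr psi n a m : R[i] := integralC (fun z => psi z * (ecut (eN n) a m (sqnorm z))%:C).

Lemma continuous_ecut n a m z : ball z -> {for z, continuous (fun w : Cd => ecut (eN n) a m (sqnorm w))}.
Proof.
move=> zb; have c1 : {for z, continuous (wt a)} := @wt_continuous a z zb.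
have c2 : {for z, continuous (tpow m \o (fun w : Cd => 1 - eN n - sqnorm w))}.
  apply: continuous_comp; last exact: tpow_continuous.
  by apply: cvgB; [exact: cvg_cst|exact: sqnorm_continuous].
exact: cvgM c1 c2.
Qed.

Lemma integrable_ebr psi n a m : (forall z, ball z -> continuousC_at psi z) ->
  integrableC (fun z => psi z * (ecut (eN n) a m.+1 (sqnorm z))%:C).
Proof.
move=> cp; apply: (@integrableC_support R d (1 - eN n)).
- by rewrite ltrBlDr ltrDl eN_gt0.
- move=> z zb; apply: continuousC_mul; first exact: cp.
  by apply: continuousC_real; exact: continuous_ecut.
- by move=> z zb; rewrite /ecut tpow_neg ?mulr0 ?mulr0// subr_le0 ltW.
Qed.

Lemma ebr_lin psi n (c1 c2 c3 c4 a1 a2 a3 a4 : R) m1 m2 m3 m4 :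
  (forall z, ball z -> continuousC_at psi z) ->
  integralC (fun z => psi z * (c1 * ecut (eN n) a1 m1.+1 (sqnorm z) +
    c2 * ecut (eN n) a2 m2.+1 (sqnorm z) + c3 * ecut (eN n) a3 m3.+1 (sqnorm z) +
    c4 * ecut (eN n) a4 m4.+1 (sqnorm z))%:C) =
  c1%:C * ebr psi n a1 m1.+1 + c2%:C * ebr psi n a2 m2.+1 +
  c3%:C * ebr psi n a3 m3.+1 + c4%:C * ebr psi n a4 m4.+1.
Proof.
move=> cp.
have i c a m := integrableC_cmul c%:C (@integrable_ebr psi n a m cp).
rewrite /ebr -!(integralC_cmul _ (integrable_ebr _ _ _ cp)).
rewrite -(integralC_add (i _ _ _) (i _ _ _)).
rewrite -(integralC_add (integrableC_add (i _ _ _) (i _ _ _)) (i _ _ _)).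
rewrite -(integralC_add (integrableC_add (integrableC_add (i _ _ _) (i _ _ _)) (i _ _ _)) (i _ _ _)).
apply: integralC_ext => z _; rewrite !realCD !realCM !mulrDr.
by congr (_ + _ + _ + _); rewrite mulrCA.
Qed.

Lemma ebr_opN psi n a m : Ck 1 psi ->
  ebr (opN psi) n a m.+2 = a%:C * ebr psi n (a - 1) m.+2 + (- (a + d%:R))%:C * ebr psi n a m.+2 +
   (m.+2%:R)%:C * ebr psi n a m.+1 + (- m.+2%:R)%:C * ebr psi n (a + 1) m.+1.
Proof.
move=> hp; rewrite /ebr (integralC_opN_cut hp (cutoff_ecut a m (eN_gt0 n))).
rewrite -(ebr_lin n _ _ _ _ _ _ _ _ _ _ _ _ (Ck_cont hp)).
have i := integrableC_radN (Ck_cont hp) (cutoff_ecut a m (eN_gt0 n)).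
have := integralC_cmul (-1) i; rewrite mulN1r => <-.
apply: integralC_ext => z zb; rewrite mulN1r -mulrN; congr (_ * _).
rewrite /radN ecut_rad//; apply: complexP; rewrite /= ?oppr0//; ring.
Qed.

Lemma ebr_opNbar psi n a m : Ck 1 psi ->
  ebr (opNbar psi) n a m.+2 = a%:C * ebr psi n (a - 1) m.+2 + (- (a + d%:R))%:C * ebr psi n a m.+2 +
   (m.+2%:R)%:C * ebr psi n a m.+1 + (- m.+2%:R)%:C * ebr psi n (a + 1) m.+1.
Proof.
move=> hp; rewrite /ebr (integralC_opNbar_cut hp (cutoff_ecut a m (eN_gt0 n))).
rewrite -(ebr_lin n _ _ _ _ _ _ _ _ _ _ _ _ (Ck_cont hp)).
have i := integrableC_radN (Ck_cont hp) (cutoff_ecut a m (eN_gt0 n)).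
have := integralC_cmul (-1) i; rewrite mulN1r => <-.
apply: integralC_ext => z zb; rewrite mulN1r -mulrN; congr (_ * _).
rewrite /radN ecut_rad//; apply: complexP; rewrite /= ?oppr0//; ring.
Qed.

Definition cvgC (x_ : nat -> R[i]) (x : R[i]) :=
  (complex.Re (x_ n) @[n --> \oo] --> complex.Re x) /\
  (complex.Im (x_ n) @[n --> \oo] --> complex.Im x).

Lemma cvgC_unique x_ x y : cvgC x_ x -> cvgC x_ y -> x = y.
Proof.
by move=> [h1 h2] [h3 h4]; apply: complexP;
  [apply: (cvg_unique _ h1 h3)|apply: (cvg_unique _ h2 h4)]; exact: norm_hausdorff.
Qed.

Lemma cvgC_add x_ x y_ y : cvgC x_ x -> cvgC y_ y -> cvgC (fun n => x_ n + y_ n) (x + y).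
Proof.
move=> [h1 h2] [h3 h4]; split.
- by rewrite ReCD; under eq_fun do rewrite ReCD; exact: cvgD.
- by rewrite ImCD; under eq_fun do rewrite ImCD; exact: cvgD.
Qed.

Lemma cvgC_cmul (c : R) x_ x : cvgC x_ x -> cvgC (fun n => c%:C * x_ n) (c%:C * x).
Proof.
move=> [h1 h2]; split.
- rewrite ReCM /= mul0r subr0; under eq_fun do rewrite ReCM /= mul0r subr0.
  by apply: cvgM => //; exact: cvg_cst.
- rewrite ImCM /= mul0r addr0; under eq_fun do rewrite ImCM /= mul0r addr0.
  by apply: cvgM => //; exact: cvg_cst.
Qed.

Lemma ebr_cvg psi a m : (forall z, ball z -> continuousC_at psi z) ->
  integrableC (fun z => psi z * (wt (a + m.+1%:R) z)%:C) ->
  cvgC (fun n => ebr psi n a m.+1) (integralC (fun z => psi z * (wt (a + m.+1%:R) z)%:C)).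
Proof.
move=> cp ip; have ig := integrableC_normc ip.
have [] := @integralC_cvg R d (fun n z => psi z * (ecut (eN n) a m.+1 (sqnorm z))%:C)
  (fun z => psi z * (wt (a + m.+1%:R) z)%:C) _ _ ig.
- by move=> n; exact: integrableC_measurable (integrable_ebr _ _ _ cp).
- move=> n z zb; rewrite !normcM !normc_real ler_wpM2l ?normc_ge0//.
  rewrite !ger0_norm ?wt_ge0 ?ecut_ge0//; exact: ecut_le (eN_gt0 n) zb.
- move=> z zb; rewrite ReCM /= mulr0 subr0; under eq_fun do rewrite ReCM /= mulr0 subr0.
  by apply: cvgM; [exact: cvg_cst|exact: ecut_cvg].
- move=> z zb; rewrite ImCM /= mulr0 add0r; under eq_fun do rewrite ImCM /= mulr0 add0r.
  by apply: cvgM; [exact: cvg_cst|exact: ecut_cvg].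
- by move=> _ h1 h2; split.
Qed.

Lemma integrableC_wt_le psi p q : (forall z, ball z -> continuousC_at psi z) -> q <= p ->
  integrableC (fun z => psi z * (wt q z)%:C) -> integrableC (fun z => psi z * (wt p z)%:C).
Proof.
move=> cp qp iq; apply: integrableC_le (integrableC_normc iq) _.
  apply: measurable_cfun_mul; first exact: measurable_cfun_continuous.
  by apply: measurable_cfun_real; exact: measurable_wt.
move=> z zb; rewrite !normcM !normc_real !ger0_norm ?wt_ge0// ler_wpM2l ?normc_ge0//.
exact: wt_le.
Qed.

Lemma ibp_limit psi phi s : (forall n a m, ebr phi n a m.+2 =
   a%:C * ebr psi n (a - 1) m.+2 + (- (a + d%:R))%:C * ebr psi n a m.+2 +
   (m.+2%:R)%:C * ebr psi n a m.+1 + (- m.+2%:R)%:C * ebr psi n (a + 1) m.+1) ->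
  (forall z, ball z -> continuousC_at psi z) -> (forall z, ball z -> continuousC_at phi z) ->
  integrableC (fun z => psi z * (wt (s - 1) z)%:C) ->
  integrableC (fun z => phi z * (wt s z)%:C) ->
  integralC (fun z => phi z * (wt s z)%:C) =
  s%:C * integralC (fun z => psi z * (wt (s - 1) z)%:C) -
  (s + d%:R)%:C * integralC (fun z => psi z * (wt s z)%:C).
Proof.
move=> E cpsi cphi ipsi iphi.
have ipsis : integrableC (fun z => psi z * (wt s z)%:C).
  by apply: integrableC_wt_le ipsi => //; rewrite lerBlDr lerDl.
have e1 : s - 2 + 2%:R = s by rewrite subrK.
have e2 : s - 2 - 1 + 2%:R = s - 1 by ring.
have e3 : s - 2 + 1%:R = s - 1 by ring.
have e4 : s - 2 + 1 + 1%:R = s by ring.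
have c0 := @ebr_cvg phi (s - 2) 1 cphi.
have c1 := @ebr_cvg psi (s - 2 - 1) 1 cpsi.
have c2 := @ebr_cvg psi (s - 2) 1 cpsi.
have c3 := @ebr_cvg psi (s - 2) 0 cpsi.
have c4 := @ebr_cvg psi (s - 2 + 1) 0 cpsi.
rewrite e1 in c0 c2; rewrite e2 in c1; rewrite e3 in c3; rewrite e4 in c4.
have {}c0 := c0 iphi; have {}c1 := c1 ipsi; have {}c2 := c2 ipsis.
have {}c3 := c3 ipsi; have {}c4 := c4 ipsis.
have rhs := cvgC_add (cvgC_add (cvgC_add (cvgC_cmul (s - 2) c1) (cvgC_cmul (- (s - 2 + d%:R)) c2))
  (cvgC_cmul 2%:R c3)) (cvgC_cmul (- 2%:R) c4).
rewrite (_ : (fun n => _) = (fun n => ebr phi n (s - 2) 2)) in rhs; last first.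
  by apply/funext => n; rewrite E.
rewrite (cvgC_unique c0 rhs).
move: (integralC _) (integralC _) => x y; apply: complexP;
  rewrite ?(ReCD, ImCD, ReCM, ImCM, ReCN, ImCN) /=; ring.
Qed.

Lemma ibp_opN psi s : Ck 1 psi ->
  integrableC (fun z => psi z * (wt (s - 1) z)%:C) ->
  integrableC (fun z => opN psi z * (wt s z)%:C) ->
  integralC (fun z => opN psi z * (wt s z)%:C) =
  s%:C * integralC (fun z => psi z * (wt (s - 1) z)%:C) -
  (s + d%:R)%:C * integralC (fun z => psi z * (wt s z)%:C).
Proof.
move=> hp; apply: ibp_limit => //.
- by move=> n a m; exact: ebr_opN.
- exact: Ck_cont hp.
- exact: Ck_cont (Ck_opN hp).
Qed.

Lemma ibp_opNbar psi s : Ck 1 psi ->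
  integrableC (fun z => psi z * (wt (s - 1) z)%:C) ->
  integrableC (fun z => opNbar psi z * (wt s z)%:C) ->
  integralC (fun z => opNbar psi z * (wt s z)%:C) =
  s%:C * integralC (fun z => psi z * (wt (s - 1) z)%:C) -
  (s + d%:R)%:C * integralC (fun z => psi z * (wt s z)%:C).
Proof.
move=> hp; apply: ibp_limit => //.
- by move=> n a m; exact: ebr_opNbar.
- exact: Ck_cont hp.
- exact: Ck_cont (Ck_opNbar hp).
Qed.

End weighted.

Section sqrt_estimate.
Context {R : realType} {d : nat}.
Local Notation Cd := (Cspace R d).
Local Notation mu := (@lebesgue_C R d).
Local Notation ball := (@unit_ball R d).
Hypothesis d_gt0 : (0 < d)%N.
Implicit Types (F G f g psi : Cd -> R[i]) (z v w : Cd).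

Lemma normc_add (x y : R[i]) : normc (x + y) <= normc x + normc y.
Proof. by rewrite -lecR realCD; have := ler_normD x y; rewrite !normc_def; case: x; case: y. Qed.

Lemma normc_comb (c1 c2 c3 c4 : R) (x1 x2 x3 x4 : R[i]) (J : R) :
  normc x1 <= J -> normc x2 <= J -> normc x3 <= J -> normc x4 <= J ->
  normc (c1%:C * x1 + c2%:C * x2 + c3%:C * x3 + c4%:C * x4) <=
  (`|c1| + `|c2| + `|c3| + `|c4|) * J.
Proof.
move=> h1 h2 h3 h4; rewrite !mulrDl.
have h (c : R) (x : R[i]) : normc x <= J -> normc (c%:C * x) <= `|c| * J.
  by move=> xJ; rewrite normcM normc_real ler_wpM2l.
apply: le_trans (normc_add _ _) (lerD _ (h _ _ h4)).
apply: le_trans (normc_add _ _) (lerD _ (h _ _ h3)).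
exact: le_trans (normc_add _ _) (lerD (h _ _ h1) (h _ _ h2)).
Qed.

Lemma ebr_sq_bound f q n a m : (forall z, ball z -> continuousC_at f z) ->
  mu.-integrable ball (EFin \o (fun z => normc (f z) ^+ 2 * wt q z)) ->
  q <= a + m.+1%:R ->
  normc (ebr (fun z => conjc (f z) * f z) n a m.+1) <=
   2 * Rintegral mu ball (fun z => normc (f z) ^+ 2 * wt q z).
Proof.
move=> cf iq qa; apply: normc_integralC => //.
  apply: integrable_ebr => z zb; apply: continuousC_mul; last exact: cf.
  by apply: continuousC_conj; exact: cf.
move=> z zb; rewrite conjc_mul_self normcM !normc_real !ger0_norm ?ecut_ge0 ?sqr_ge0//.
rewrite ler_wpM2l ?sqr_ge0//; apply: le_trans (wt_le zb qa).
exact: ecut_le (eN_gt0 n) zb.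
Qed.

Lemma opN_square_integrable f q : holomorphic f ->
  mu.-integrable ball (EFin \o (fun z => normc (f z) ^+ 2 * wt q z)) ->
  mu.-integrable ball (EFin \o (fun z => normc (opN f z) ^+ 2 * wt (q + 2) z)).
Proof.
move=> holf iq; have [hf f0] := holf; have [hN N0] := holomorphic_opN d_gt0 holf.
have cf := Ck_cont hf; have cN := Ck_cont hN.
pose J := 2 * Rintegral mu ball (fun z => normc (f z) ^+ 2 * wt q z).
pose a := q - 1.
have b1 n a' m : q <= a' + m.+1%:R -> normc (ebr (fun z => conjc (f z) * f z) n a' m.+1) <= J.
  by move=> qa; exact: ebr_sq_bound.
have hff : Ck 1 (fun z => conjc (f z) * f z) := Ck_mul (Ck_conj hf) hf.
have hfN : Ck 1 (fun z => conjc (f z) * opN f z) := Ck_mul (Ck_conj hf) hN.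
have e1 n a' m : ebr (fun z => conjc (f z) * opN f z) n a' m = ebr (opN (fun z => conjc (f z) * f z)) n a' m.
  apply: integralC_ext => z zb; congr (_ * _).
  have h := opN_mul (Ck_diff1 (Ck_conj hf) zb) (Ck_diff1 hf zb).
  have fb : opNbar f z = 0 by rewrite /opNbar big1// => j _; rewrite f0// mulr0.
  have hc := opN_conj (Ck_diff1 hf zb).
  by rewrite [RHS]h [in RHS]hc fb conjc0 mul0r add0r.
pose K (a : R) (m : nat) : R := `|a| + `|- (a + d%:R)| + `|m.+2%:R : R| + `|- m.+2%:R : R|.
have K0 a' m : 0 <= K a' m by rewrite !addr_ge0.
have b3 n a' m : q <= a' + m.+1%:R ->
    normc (ebr (fun z => conjc (f z) * opN f z) n a' m.+2) <= K a' m * J.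
  move=> qa; rewrite e1 (ebr_opN _ _ _ hff); apply: normc_comb; apply: b1; apply: le_trans qa _;
    rewrite -?natr1; lra.
have e2 n a' m : ebr (fun z => conjc (opN f z) * opN f z) n a' m =
    ebr (opNbar (fun z => conjc (f z) * opN f z)) n a' m.
  apply: integralC_ext => z zb; congr (_ * _).
  have h := opNbar_mul (Ck_diff1 (Ck_conj hf) zb) (Ck_diff1 hN zb).
  have fb : opNbar (opN f) z = 0 by rewrite /opNbar big1// => j _; rewrite N0// mulr0.
  have hc := opNbar_conj (Ck_diff1 hf zb).
  by rewrite [RHS]h [in RHS]hc fb mulr0 addr0.
have J0 : 0 <= J.
  by rewrite mulr_ge0// Rintegral_ge0// => z _; rewrite mulr_ge0 ?sqr_ge0 ?wt_ge0.
pose KK := K (a - 1) 1%N + K a 1%N + K a 0%N + K (a + 1) 0%N.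
have b4 n : normc (ebr (fun z => conjc (opN f z) * opN f z) n a 3) <= K a 1%N * (KK * J).
  have s4 (x y z t : R) : 0 <= x -> 0 <= y -> 0 <= z -> 0 <= t ->
      [/\ x <= x + y + z + t, y <= x + y + z + t, z <= x + y + z + t & t <= x + y + z + t].
    by move=> *; split; lra.
  have [k1 k2 k3 k4] := s4 _ _ _ _ (K0 (a - 1) 1%N) (K0 a 1%N) (K0 a 0%N) (K0 (a + 1) 0%N).
  rewrite e2 (ebr_opNbar _ _ _ hfN); apply: normc_comb.
  - by apply: le_trans (b3 _ _ _ _) (ler_wpM2r J0 k1); rewrite /a; lra.
  - by apply: le_trans (b3 _ _ _ _) (ler_wpM2r J0 k2); rewrite /a; lra.
  - by apply: le_trans (b3 _ _ _ _) (ler_wpM2r J0 k3); rewrite /a; lra.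
  - by apply: le_trans (b3 _ _ _ _) (ler_wpM2r J0 k4); rewrite /a; lra.
pose g n z := normc (opN f z) ^+ 2 * ecut (eN n) a 3 (sqnorm z).
have mN := measurable_normc (measurable_cfun_continuous cN).
have mg n : measurable_fun ball (g n).
  apply: measurable_funM; first exact: measurable_funX.
  by apply: continuous_measurableC; [exact: open_unit_ball|move=> z; exact: continuous_ecut].
have g0 n z : 0 <= g n z by rewrite mulr_ge0 ?sqr_ge0 ?ecut_ge0.
have gE n : (\int[mu]_(z in ball) (g n z)%:E <= (K a 1%N * (KK * J))%:E)%E.
  have ic : integrableC (fun z => (conjc (opN f z) * opN f z) * (ecut (eN n) a 3 (sqnorm z))%:C).
    apply: integrable_ebr => z zb; apply: continuousC_mul; last exact: cN.
    by apply: continuousC_conj; exact: cN.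
  have E z : complex.Re ((conjc (opN f z) * opN f z) * (ecut (eN n) a 3 (sqnorm z))%:C) = g n z.
    by rewrite conjc_mul_self -realCM Re_real.
  have ig : mu.-integrable ball (EFin \o g n).
    by have [h _] := ic; move: h; under eq_fun do rewrite E.
  rewrite -(fineK (integrable_fin_num measurable_unit_ball ig)) lee_fin.
  apply: le_trans (b4 n); apply: le_trans (Re_le_normc _); apply: le_trans (ler_norm _).
  rewrite /ebr Re_integralC /Rintegral.
  by under [X in _ <= fine X]eq_integral do rewrite E.
have m2 : measurable_fun ball (fun z => normc (opN f z) ^+ 2 * wt (q + 2) z).
  by apply: measurable_funM; [exact: measurable_funX|exact: measurable_wt].
apply/integrableP; split; first exact/measurable_EFinP.
apply: (@le_lt_trans _ _ (K a 1%N * (KK * J))%:E); last exact: ltry.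
have cv : (\int[mu]_(z in ball) (g n z)%:E)%E @[n --> \oo] -->
    (\int[mu]_(z in ball) `|(normc (opN f z) ^+ 2 * wt (q + 2) z)%:E|)%E.
  rewrite (eq_integral (fun z => limn (fun n => (g n z)%:E))).
    apply: cvg_monotone_convergence.
    - exact: measurable_unit_ball.
    - by move=> n; exact/measurable_EFinP.
    - by move=> n z _; rewrite lee_fin.
    - by move=> z _ n k nk; rewrite lee_fin /g ler_wpM2l ?sqr_ge0// ecut_nd.
  move=> z /[!inE] zb; apply/esym/cvg_lim => //.
  rewrite gee0_abs ?lee_fin ?mulr_ge0 ?normc_ge0 ?wt_ge0//.
  apply: cvg_EFin; first exact: nearW.
  apply: cvgM; first exact: cvg_cst.
  rewrite (_ : q + 2 = a + 3%:R); last by rewrite /a; ring.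
  exact: ecut_cvg.
have := cvg_lim (@ereal_hausdorff R) cv => <-.
apply: lime_le; first by apply/cvg_ex; eexists; exact: cv.
by apply: nearW => n; exact: gE.
Qed.

End sqrt_estimate.

(** * The Gamma function *)

Section ray.
Context {R : realType}.
Local Notation leb := (@lebesgue_measure R).
Local Notation ray := (`]0, +oo[%classic : set R).
Implicit Types (f F : R -> R) (s t : R).

Definition seg n : set R := `[n.+2%:R^-1, n.+2%:R]%classic.

Lemma seg_bounds n : 0 < (n.+2%:R^-1 : R) /\ (n.+2%:R^-1 : R) < n.+2%:R.
Proof.
have h : (0 : R) < n.+2%:R^-1 by rewrite invr_gt0.
split => //; apply: (@lt_trans _ _ 1); last by rewrite ltr1n.
by rewrite invf_lt1// ltr1n.
Qed.

Lemma seg_ray n : seg n `<=` ray.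
Proof.
move=> t; rewrite /seg /= !in_itv/= andbT => /andP[h _].
exact: lt_le_trans (seg_bounds n).1 h.
Qed.

Lemma seg_nd n k : (n <= k)%N -> seg n `<=` seg k.
Proof.
move=> nk t; rewrite /seg /= !in_itv/= => /andP[h1 h2]; apply/andP; split.
  by apply: le_trans h1; rewrite lef_pV2 ?posrE// ler_nat.
by apply: le_trans h2 _; rewrite ler_nat.
Qed.

Lemma measurable_seg n : measurable (seg n).
Proof. exact: measurable_itv. Qed.

Lemma near_seg t : 0 < t -> \forall n \near \oo, seg n t.
Proof.
move=> t0; have t'0 : 0 < t^-1 by rewrite invr_gt0.
have h (x : R) : 0 < x -> \forall n \near \oo, x <= n.+2%:R.
  move=> x0; near=> n; apply: (@le_trans _ _ n%:R); last by rewrite ler_nat leqW// leqW.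
  by near: n; exact: nbhs_infty_ger.
near=> n; rewrite /seg /= in_itv/=; apply/andP; split.
  by rewrite -[t]invrK lef_pV2 ?posrE//; near: n; exact: h.
by near: n; exact: h.
Unshelve. all: by end_near. Qed.

Lemma patch_seg_cvg f t : 0 < t -> (f \_ (seg n)) t @[n --> \oo] --> f t.
Proof.
move=> t0; apply: cvg_near_cst; apply: filterS (near_seg t0) => n tn.
by rewrite patchE mem_set.
Qed.

Lemma integral_seg_patch f n :
  (\int[leb]_(t in ray) ((f \_ (seg n)) t)%:E = \int[leb]_(t in seg n) (f t)%:E)%E.
Proof.
rewrite -{2}(setIidr (@seg_ray n)) integral_mkcondr; apply: eq_integral => t _.
by rewrite !patchE; case: ifP.
Qed.

Lemma measurable_patch_seg f n : measurable_fun setT f -> measurable_fun ray (f \_ (seg n)).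
Proof.
move=> mf; apply: (@measurable_funS _ _ _ _ setT) => //.
apply/(measurable_restrictT _ (measurable_seg n)); exact: measurable_funTS.
Qed.

Lemma Rintegral_seg_cvg f : measurable_fun setT f -> leb.-integrable ray (EFin \o f) ->
  Rintegral leb (seg n) f @[n --> \oo] --> Rintegral leb ray f.
Proof.
move=> mf fi.
have [] := @Rdominated_convergence R _ _ leb ray (fun n => f \_ (seg n)) f (fun t => `|f t|).
- exact: measurable_itv.
- by move=> n; exact: measurable_patch_seg.
- by move=> t /=; rewrite in_itv/= andbT; exact: patch_seg_cvg.
- exact: integrable_norm.
- by move=> n t _; rewrite patchE; case: ifP => // _; rewrite normr0.
move=> _; under eq_fun do rewrite /Rintegral integral_seg_patch; exact.
Qed.

Lemma integral_seg f F n : (forall t, 0 < t -> {for t, continuous f}) ->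
  (forall t, 0 < t -> is_derive t (1 : R) F (f t)) ->
  (\int[leb]_(t in seg n) (f t)%:E = (F n.+2%:R - F n.+2%:R^-1)%:E)%E.
Proof.
move=> cf dF; have [a0 ab] := seg_bounds n.
have cF t : 0 < t -> {for t, continuous F}.
  by move=> /dF[h _]; apply: differentiable_continuous; exact/derivable1_diffP.
rewrite (@continuous_FTC2 _ f F)//.
- apply: continuous_in_subspaceT => t; rewrite inE => /seg_ray/=.
  by rewrite in_itv/= andbT; exact: cf.
- split.
  + move=> t; rewrite in_itv/= => /andP[h _]; have [] := dF t (lt_trans a0 h); by [].
  + by apply: cvg_at_right_filter; exact: cF.
  + by apply: cvg_at_left_filter; apply: cF; exact: lt_trans ab.
- move=> t; rewrite in_itv/= => /andP[h _]; have [_ <-] := dF t (lt_trans a0 h).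
  by rewrite derive1E.
Qed.

Lemma ray_integrable f F (M : R) : measurable_fun setT f ->
  (forall t, 0 < t -> 0 <= f t) -> (forall t, 0 < t -> {for t, continuous f}) ->
  (forall t, 0 < t -> is_derive t (1 : R) F (f t)) ->
  (forall t, 0 < t -> `|F t| <= M) -> leb.-integrable ray (EFin \o f).
Proof.
move=> mf f0 cf dF FM.
have mray : measurable (ray : set (measurableTypeR R)) by exact: measurable_itv.
apply/integrableP; split; first by apply/measurable_EFinP; exact: measurable_funTS.
apply: (@le_lt_trans _ _ (M + M)%:E); last exact: ltry.
have cv : (\int[leb]_(t in ray) ((f \_ (seg n)) t)%:E)%E @[n --> \oo] -->
    (\int[leb]_(t in ray) `|(EFin \o f) t|)%E.
  have -> : (\int[leb]_(t in ray) `|(EFin \o f) t| =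
      \int[leb]_(t in ray) limn (fun n => ((f \_ (seg n)) t)%:E))%E; last first.
    apply: cvg_monotone_convergence => //.
    - by move=> n; apply/measurable_EFinP; exact: measurable_patch_seg.
    - move=> n t /=; rewrite in_itv/= andbT lee_fin patchE => t0.
      by case: ifP => // _; exact: f0.
    - move=> t /=; rewrite in_itv/= andbT => t0 n k nk; rewrite lee_fin !patchE.
      case: ifPn => [|_]; last by case: ifP => // _; exact: f0.
      by rewrite !inE => tn; rewrite mem_set//; exact: seg_nd nk _ tn.
  apply: eq_integral => t; rewrite inE /= in_itv/= andbT => t0; apply/esym/cvg_lim => //.
  rewrite ger0_norm ?f0//; apply: cvg_EFin; first exact: nearW.
  exact: patch_seg_cvg.
have := cvg_lim (@ereal_hausdorff R) cv => <-.
apply: lime_le; first by apply/cvg_ex; eexists; exact: cv.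
apply: nearW => n; rewrite integral_seg_patch (integral_seg n cf dF) lee_fin.
apply: le_trans (ler_norm _) _; apply: le_trans (ler_normB _ _) _.
by apply: lerD; apply: FM => //; rewrite invr_gt0.
Qed.

End ray.

Section Gamma.
Context {R : realType}.
Local Notation leb := (@lebesgue_measure R).
Local Notation ray := (`]0, +oo[%classic : set R).
Implicit Types (s t : R).

Definition gden s t : R := t `^ (s - 1) * expR (- t).

Lemma gden_ge0 s t : 0 <= gden s t.
Proof. by rewrite mulr_ge0 ?powR_ge0 ?expR_ge0. Qed.

Lemma measurable_gden s : measurable_fun setT (gden s).
Proof.
apply: measurable_funM; first exact: measurable_powR.
by apply: measurableT_comp => //; exact: measurable_oppr.
Qed.

Lemma is_derive_powR_shift (c a t : R) : 0 < c + t ->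
  is_derive t (1 : R) (fun x : R => (c + x) `^ a) (a * (c + t) `^ (a - 1)).
Proof.
move=> t0.
have d1 := is_derive_addf (is_derive_cst c t (1 : R)) (is_derive_id t (1 : R)).
have d2 : is_derive (c + t) (1 : R) (fun x : R => x `^ a) (a * (c + t) `^ (a - 1)).
  exact: is_derive1_powR.
have := @is_derive_comp1 R R (fun x : R => x `^ a) (fun x : R => c + x) t 1 _ _ d2 d1.
by rewrite add0r mulr1.
Qed.

Lemma powR_shift_continuous (c a t : R) : 0 < c + t -> {for t, continuous (fun x : R => (c + x) `^ a)}.
Proof.
move=> /(is_derive_powR_shift a)[h _].
by apply: differentiable_continuous; exact/derivable1_diffP.
Qed.

Lemma powR_pred (x a : R) : 0 < x -> x `^ a = x * x `^ (a - 1).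
Proof. by move=> x0; rewrite powRB ?(gt_eqF x0) ?implybT// powRr1 ?ltW// mulrC divfK// gt_eqF. Qed.

Lemma is_derive_powR_expN s t : 0 < t ->
  is_derive t (1 : R) (fun x : R => x `^ s * expR (- x)) (s * gden s t - gden (s + 1) t).
Proof.
move=> t0; have d1 : is_derive t (1 : R) (fun x : R => x `^ s) (s * t `^ (s - 1)).
  exact: is_derive1_powR.
have d2 : is_derive t (1 : R) (fun x : R => expR (- x)) (expR (- t) * - 1).
  exact: (@is_derive_comp1 R R (@expR R) (fun x : R => - x) t 1 _ _ (is_derive_expR _)
    (is_derive_oppf (is_derive_id t (1 : R)))).
apply: is_derive_eq (is_derive_mulf d1 d2) _.
by rewrite /gden addrK mulrN1 mulrN mulrA.
Qed.

Lemma gden_continuous s t : 0 < t -> {for t, continuous (gden s)}.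
Proof.
move=> t0; have [h _] := is_derive_powR_expN (s - 1) t0.
by apply: differentiable_continuous; exact/derivable1_diffP.
Qed.

Lemma powR_le_expR s : exists2 C : R, 0 < C & forall t, 0 < t -> (1 + t) `^ s <= C * expR t.
Proof.
have [m /andP[m0 sm]] : exists m : nat, (0 < m)%N && (s <= m%:R).
  exists (Num.truncn `|s|).+1; rewrite ltn0Sn/=.
  by apply: le_trans (ler_norm _) _; apply: ltW; exact: truncnS_gt.
have m1 : 0 < m%:R :> R by rewrite ltr0n.
exists (m%:R ^+ m); first by rewrite exprn_gt0.
move=> t t0; apply: (@le_trans _ _ ((1 + t) `^ m%:R)).
  by apply: ler_powR => //; rewrite lerDl ltW.
rewrite powR_mulrn; last by rewrite addr_ge0// ltW.
rewrite -{2}[t](mulfVK (lt0r_neq0 m1)) expRM_natr -exprMn.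
apply: lerXn2r; rewrite ?nnegrE ?addr_ge0 ?(ltW t0)//.
apply: (@le_trans _ _ (m%:R * (1 + t / m%:R))); last first.
  by rewrite ler_pM2l//; exact: expR_ge1Dx.
rewrite mulrDr mulr1 mulrCA mulfV ?mulr1 ?lerD2r ?ler1n//.
exact: lt0r_neq0.
Qed.

(* The derivative of gmaj dominates the integrand of Gamma s up to a constant,
   and gmaj is bounded: this gives the integrability at both ends at once. *)
Definition gmaj s t : R := t `^ s * (1 + t) `^ (- s).

Lemma is_derive_gmaj s t : 0 < t ->
  is_derive t (1 : R) (gmaj s) (s * (t `^ (s - 1) * (1 + t) `^ (- s - 1))).
Proof.
move=> t0; have t1 : 0 < 1 + t by rewrite addr_gt0.
have d1 : is_derive t (1 : R) (fun x : R => x `^ s) (s * t `^ (s - 1)).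
  exact: is_derive1_powR.
apply: is_derive_eq (is_derive_mulf d1 (is_derive_powR_shift (- s) t1)) _.
rewrite (powR_pred (- s) t1) (powR_pred s t0); ring.
Qed.

Lemma gmaj_le1 s t : 0 < s -> 0 < t -> `|gmaj s t| <= 1.
Proof.
move=> s0 t0; have t1 : 0 < 1 + t by rewrite addr_gt0.
rewrite ger0_norm ?mulr_ge0 ?powR_ge0// /gmaj powRN ler_pdivrMr ?powR_gt0// mul1r.
by apply: ge0_ler_powR; rewrite ?nnegrE ?(ltW s0) ?(ltW t0) ?(ltW t1) ?lerDr.
Qed.

Lemma gden_le s : 0 < s -> exists2 C : R, 0 < C &
  forall t, 0 < t -> gden s t <= C * (s * (t `^ (s - 1) * (1 + t) `^ (- s - 1))).
Proof.
move=> s0; have [C C0 hC] := powR_le_expR (s + 1).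
exists (C / s); first by rewrite divr_gt0.
move=> t t0; have t1 : 0 < 1 + t by rewrite addr_gt0.
rewrite [C / s * _]mulrA divfK ?gt_eqF// mulrCA /gden ler_wpM2l ?powR_ge0//.
by rewrite -opprD powRN expRN ler_pdivlMr ?powR_gt0// mulrC ler_pdivrMr ?expR_gt0// hC.
Qed.

Lemma integrable_gden s : 0 < s -> leb.-integrable ray (EFin \o gden s).
Proof.
move=> s0; have [C C0 hC] := gden_le s0.
have mray : measurable (ray : set (measurableTypeR R)) by exact: measurable_itv.
pose f t := s * (t `^ (s - 1) * (1 + t) `^ (- s - 1)).
have mf : measurable_fun setT f.
  apply: measurable_funM; first exact: measurable_cst.
  apply: measurable_funM; first exact: measurable_powR.
  have m1 : measurable_fun setT (fun t : R => 1 + t) by exact: measurable_funD.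
  exact: (measurableT_comp (@measurable_powR R (- s - 1)) m1).
have f0 t : 0 <= f t by rewrite !mulr_ge0 ?powR_ge0 ?ltW.
have fi : leb.-integrable ray (EFin \o f).
  apply: (@ray_integrable R f (gmaj s) 1) => //.
  - move=> t t0; have t1 : 0 < 1 + t by rewrite addr_gt0.
    have c0 : {for t, continuous (fun x : R => x `^ (s - 1))}.
      have : is_derive t (1 : R) (fun x : R => x `^ (s - 1)) _ := is_derive1_powR _ t0.
      by move=> [h _]; apply: differentiable_continuous; exact/derivable1_diffP.
    have c1 := @powR_shift_continuous 1 (- s - 1) t t1.
    have c2 : {for t, continuous (fun x : R => x `^ (s - 1) * (1 + x) `^ (- s - 1))} by exact: cvgM c0 c1.
    by apply: cvgM; [exact: cvg_cst|exact: c2].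
  - by move=> t; exact: is_derive_gmaj.
  - by move=> t; exact: gmaj_le1.
apply: (@le_integrable _ _ _ leb ray mray _ (EFin \o (fun t => C * f t))).
- by apply/measurable_EFinP; apply: measurable_funTS; exact: measurable_gden.
- move=> t /=; rewrite in_itv/= andbT => t0; rewrite lee_fin !ger0_norm ?gden_ge0 ?mulr_ge0 ?powR_ge0 ?(ltW C0) ?(ltW s0)//.
  exact: hC.
- by have := integrableZl mray C fi.
Qed.

Lemma GammaE s : Gamma s = Rintegral leb ray (gden s).
Proof. by []. Qed.

Lemma Gamma_succ s : 0 < s -> Gamma (s + 1) = s * Gamma s.
Proof.
move=> s0; have s10 : 0 < s + 1 by rewrite addr_gt0.
have mray : measurable (ray : set (measurableTypeR R)) by exact: measurable_itv.
have i1 := integrable_gden s0; have i2 := integrable_gden s10.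
have i1' : leb.-integrable ray (EFin \o (fun t => s * gden s t)) by have := integrableZl mray s i1.
pose f t := s * gden s t - gden (s + 1) t.
have mf : measurable_fun setT f.
  apply: measurable_funB; last exact: measurable_gden.
  by apply: measurable_funM; [exact: measurable_cst|exact: measurable_gden].
have fi : leb.-integrable ray (EFin \o f).
  by have := integrableB mray i1' i2.
have e1 : Rintegral leb ray f = s * Gamma s - Gamma (s + 1).
  by rewrite !GammaE (RintegralB mray i1' i2) (RintegralZl _ mray i1).
suff : Rintegral leb ray f = 0 by rewrite e1 => /eqP; rewrite subr_eq0 => /eqP.
pose F (t : R) := t `^ s * expR (- t).
have cf t : 0 < t -> {for t, continuous f}.
  move=> t0; have c2 := @gden_continuous (s + 1) t t0.
  have c1 : {for t, continuous (fun t => s * gden s t)}.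
    by apply: cvgM; [exact: cvg_cst|exact: gden_continuous].
  exact: cvgB c1 c2.
have segE n : Rintegral leb (seg n) f = F n.+2%:R - F n.+2%:R^-1.
  have dF : forall t, 0 < t -> is_derive t (1 : R) F (f t) by move=> t; exact: is_derive_powR_expN.
  by rewrite /Rintegral (integral_seg n cf dF).
have cv := Rintegral_seg_cvg mf fi.
have h0 : (n.+2%:R^-1 : R) @[n --> \oo] --> 0.
  have := @cvg_harmonic R; rewrite -(cvg_shiftS (@harmonic R)); exact.
have cF0 : F n.+2%:R^-1 @[n --> \oo] --> 0.
  have p0 : (n.+2%:R^-1 : R) `^ s @[n --> \oo] --> 0.
    have /cvg_at_rightP := powR_cvg0 s0; by apply; split => // n; rewrite invr_gt0.
  apply: (@squeeze_cvgr _ _ _ _ (fun=> 0) (fun n => (n.+2%:R^-1 : R) `^ s)) => //; last exact: cvg_cst.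
  apply: nearW => n; rewrite /F mulr_ge0 ?powR_ge0 ?expR_ge0//= ler_piMr ?powR_ge0//.
have cFoo : F n.+2%:R @[n --> \oo] --> 0.
  have [C C0 hC] := powR_le_expR (s + 1).
  apply: (@squeeze_cvgr _ _ _ _ (fun=> 0) (fun n => C * n.+2%:R^-1)).
  - apply: nearW => n; rewrite /F mulr_ge0 ?powR_ge0 ?expR_ge0//=.
    have n0 : 0 < (n.+2%:R : R) by rewrite ltr0n.
    rewrite expRN ler_pdivrMr ?expR_gt0// mulrAC ler_pdivlMr// mulrC.
    rewrite (_ : n.+2%:R * n.+2%:R `^ s = n.+2%:R `^ (s + 1)); last first.
      by rewrite (powR_pred (s + 1) n0) addrK.
    apply: le_trans (hC _ n0); have n1 : (n.+2%:R : R) <= 1 + n.+2%:R by rewrite lerDr.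
    by apply: (ge0_ler_powR (ltW s10) _ _ n1); rewrite nnegrE ltW// (lt_le_trans n0).
  - exact: cvg_cst.
  - by rewrite -[X in _ --> X](mulr0 C); apply: cvgM => //; exact: cvg_cst.
have c0 : Rintegral leb (seg n) f @[n --> \oo] --> (0 : R).
  rewrite (_ : (fun n => _) = (fun n => F n.+2%:R - F n.+2%:R^-1)); last exact/funext.
  by rewrite -[X in _ --> X](subr0 0); exact: cvgB.
exact: (cvg_unique (@norm_hausdorff _ R) cv c0).
Qed.

Lemma Gamma_gt0 s : 0 < s -> 0 < Gamma s.
Proof.
move=> s0; have i1 := integrable_gden s0.
have mray : measurable (ray : set (measurableTypeR R)) by exact: measurable_itv.
pose c : R := 2 `^ (- `|s - 1|) * expR (- 2).
have c0 : 0 < c by rewrite mulr_gt0 ?powR_gt0 ?expR_gt0.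
have m12 : measurable (`[1, 2]%classic : set (measurableTypeR R)) by exact: measurable_itv.
have s12 : (`[1, 2]%classic : set R) `<=` ray.
  by move=> t /=; rewrite !in_itv/= andbT => /andP[h _]; exact: lt_le_trans h.
have hc t : (`[1, 2]%classic : set R) t -> c <= gden s t.
  rewrite /= in_itv/= => /andP[t1 t2]; rewrite /c /gden; apply: ler_pM; rewrite ?powR_ge0 ?expR_ge0//.
    have t0 : 0 < t by exact: lt_le_trans t1.
    rewrite powRN; apply: (@le_trans _ _ (t `^ `|s - 1|)^-1).
      rewrite lef_pV2 ?posrE ?powR_gt0//; apply: ge0_ler_powR; rewrite ?nnegrE// ltW//.
    rewrite -powRN; apply: ler_powR => //.
    by rewrite lerNl; have := ler_norm (- (s - 1)); rewrite normrN.
  by rewrite ler_expR lerN2.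
have e : (\int[leb]_(t in `[1%R, 2%R]) (cst c%:E t) = c%:E)%E.
  have l1 : leb `[1%R, 2%R]%classic = 1%E.
    apply: etrans (lebesgue_measure_itv `[1, 2]) _.
    by rewrite /= lte_fin ltr1n -EFinB; congr EFin; ring.
  apply: etrans (integral_cst leb m12 c%:E) _.
  apply: etrans (mule1 c%:E); congr mule; exact: l1.
rewrite GammaE /Rintegral -lte_fin fineK; last exact: integrable_fin_num i1.
apply: (@lt_le_trans _ _ c%:E); first by rewrite lte_fin.
rewrite -e; apply: (@le_trans _ _ (\int[leb]_(t in `[1%R, 2%R]) (gden s t)%:E)%E).
  apply: ge0_le_integral => //.
  - by move=> t _; rewrite lee_fin ltW.
  - by apply/measurable_EFinP; apply: measurable_funTS; exact: measurable_gden.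
apply: ge0_subset_integral => //.
- by apply/measurable_EFinP; apply: measurable_funTS; exact: measurable_gden.
- by move=> t _; rewrite lee_fin gden_ge0.
Qed.

Lemma cst_c_gt0 d s : d%:R < s -> 0 < cst_c d s.
Proof.
move=> ds; have s0 : 0 < s by exact: le_lt_trans ds.
by rewrite /cst_c divr_gt0 ?mulr_gt0 ?exprn_gt0 ?pi_gt0 ?Gamma_gt0// subr_gt0.
Qed.

Lemma cst_c_succ d s : d%:R < s -> cst_c d (s + 1) * (s - d%:R) = s * cst_c d s.
Proof.
move=> ds; have s0 : 0 < s by exact: le_lt_trans ds.
have sd : 0 < s - d%:R by rewrite subr_gt0.
have g1 := Gamma_gt0 s0; have g2 := Gamma_gt0 sd.
have p0 : 0 < pi ^+ d :> R by rewrite exprn_gt0// pi_gt0.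
rewrite /cst_c addrAC !Gamma_succ//; field.
by rewrite !gt_eqF.
Qed.

End Gamma.

(** * Raising the weight *)

Section square_integrable.
Context {R : realType} {d : nat}.
Local Notation Cd := (Cspace R d).
Local Notation mu := (@lebesgue_C R d).
Local Notation ball := (@unit_ball R d).
Implicit Types (F G f g u v psi : Cd -> R[i]) (z w : Cd) (p q r s : R).

Lemma onem_sqnorm_gt0 z : ball z -> 0 < 1 - sqnorm z.
Proof. by rewrite subr_gt0. Qed.

Lemma wtD p q z : ball z -> wt (p + q) z = wt p z * wt q z.
Proof. by move=> /onem_sqnorm_gt0 z0; rewrite /wt powRD// (gt_eqF z0) implybT. Qed.

Lemma weight_tau s z : ball z -> weight s z * tau_density z = wt (s - d.+1%:R) z.
Proof.
move=> /onem_sqnorm_gt0 z0.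
by rewrite /weight /tau_density /wt powRB ?(gt_eqF z0) ?implybT// powR_mulrn// ltW.
Qed.

Definition sqint q u := measurable_cfun u /\
  mu.-integrable ball (EFin \o (fun z => normc (u z) ^+ 2 * wt q z)).

Lemma measurable_sq q u : measurable_cfun u -> measurable_fun ball (fun z => normc (u z) ^+ 2 * wt q z).
Proof.
move=> mu_; apply: measurable_funM; last exact: measurable_wt.
by apply: measurable_funX; exact: measurable_normc.
Qed.

Lemma sqint_bdd q u v (M : R) : measurable_cfun u -> (forall z, ball z -> normc (u z) <= M) ->
  sqint q v -> sqint q (fun z => u z * v z).
Proof.
move=> mu_ uM [mv iv]; have m := measurable_cfun_mul mu_ mv; split => //.
have iM := integrableZl (@measurable_unit_ball R d) (M ^+ 2) iv.
apply: le_integrable iM; first exact: measurable_unit_ball.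
- by apply/measurable_EFinP; exact: measurable_sq.
- move=> z zb /=; have M0 : 0 <= M := le_trans (normc_ge0 _) (uM z zb).
  rewrite lee_fin !ger0_norm ?mulr_ge0 ?normc_ge0 ?wt_ge0 ?sqr_ge0//.
  rewrite normcM exprMn -mulrA ler_wpM2r ?mulr_ge0 ?normc_ge0 ?wt_ge0//.
  by rewrite lerXn2r ?nnegrE ?normc_ge0// uM.
Qed.

Lemma sqint_le p q u : q <= p -> sqint q u -> sqint p u.
Proof.
move=> qp [mu_ iu]; split => //.
apply: le_integrable iu; first exact: measurable_unit_ball.
- by apply/measurable_EFinP; exact: measurable_sq.
- move=> z zb /=; rewrite lee_fin !ger0_norm ?mulr_ge0 ?normc_ge0 ?wt_ge0//.
  by rewrite ler_wpM2l ?sqr_ge0// wt_le.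
Qed.

Lemma sqint_mul p q r u v : p + q <= r + r -> sqint p u -> sqint q v ->
  integrableC (fun z => conjc (u z) * v z * (wt r z)%:C).
Proof.
move=> pq [m1 i1] [m2 i2]; have mb := @measurable_unit_ball R d.
have i3 := integrableD mb i1 i2.
apply: (@integrableC_le R d _ (fun z => normc (u z) ^+ 2 * wt p z + normc (v z) ^+ 2 * wt q z)).
- apply: measurable_cfun_mul; last by apply: measurable_cfun_real; exact: measurable_wt.
  by apply: measurable_cfun_mul => //; exact: measurable_cfun_conj.
- exact: i3.
- move=> z zb; rewrite !normcM normc_real normc_conj ger0_norm ?wt_ge0//.
  have e x : wt x z = wt (x / 2) z ^+ 2 by rewrite expr2 -wtD// -splitr.
  have h : wt r z <= wt (p / 2) z * wt (q / 2) z by rewrite -wtD// wt_le//; lra.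
  apply: (@le_trans _ _ ((normc (u z) * wt (p / 2) z) * (normc (v z) * wt (q / 2) z))).
    by rewrite mulrACA ler_wpM2l// mulr_ge0 ?normc_ge0.
  rewrite (e p) (e q) -!exprMn.
  move: (normc (u z) * _) (normc (v z) * _) => x y.
  have := sqr_ge0 (x - y); have := sqr_ge0 x; have := sqr_ge0 y; nra.
Qed.

Lemma L2_sqint s u : d%:R < s -> L2 s u <-> sqint (s - d.+1%:R) u.
Proof.
move=> /cst_c_gt0 c0; have mb := @measurable_unit_ball R d.
have E z : ball z -> cst_c d s * (normc (u z) ^+ 2 * weight s z * tau_density z) =
    cst_c d s * (normc (u z) ^+ 2 * wt (s - d.+1%:R) z).
  by move=> zb; rewrite -[_ * weight _ _ * _]mulrA weight_tau.
have E1 : (\int[mu]_(z in ball) (cst_c d s * (normc (u z) ^+ 2 * weight s z * tau_density z))%:E =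
   \int[mu]_(z in ball) (cst_c d s * (normc (u z) ^+ 2 * wt (s - d.+1%:R) z))%:E)%E.
  by apply: eq_integral => z /[!inE] zb; rewrite E.
have p0 z : 0 <= normc (u z) ^+ 2 * wt (s - d.+1%:R) z by rewrite mulr_ge0 ?sqr_ge0 ?wt_ge0.
have E2 : measurable_cfun u -> (\int[mu]_(z in ball) (cst_c d s * (normc (u z) ^+ 2 * wt (s - d.+1%:R) z))%:E =
    (cst_c d s)%:E * \int[mu]_(z in ball) (normc (u z) ^+ 2 * wt (s - d.+1%:R) z)%:E)%E.
  move=> m; under eq_integral do rewrite EFinM.
  rewrite ge0_integralZl//; last exact: ltW.
  - by apply/measurable_EFinP; exact: measurable_sq.
  - by move=> z _; rewrite lee_fin.
have E3 : (\int[mu]_(z in ball) `|(normc (u z) ^+ 2 * wt (s - d.+1%:R) z)%:E| =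
    \int[mu]_(z in ball) (normc (u z) ^+ 2 * wt (s - d.+1%:R) z)%:E)%E.
  by apply: eq_integral => z _ /=; rewrite ger0_norm.
split => [[m1 m2]|[m /integrableP[_] /=]].
- have m : measurable_cfun u by split.
  rewrite E1 E2// => h; split => //; apply/integrableP; split.
    by apply/measurable_EFinP; exact: measurable_sq.
  rewrite E3; move: h; rewrite -lte_pdivlMl// mulry gtr0_sg ?mul1e//.
  by rewrite invr_gt0.
- rewrite E3 => h; have [m1 m2] := m; split => //; rewrite E1 E2//.
  by rewrite lte_mul_pinfty// lee_fin ltW.
Qed.

Definition wint s F : R[i] := (cst_c d s)%:C * integralC (fun z => F z * (wt (s - d.+1%:R) z)%:C).

Lemma integral_tau_weight s F :
  integral_tau (fun z => F z * (weight s z)%:C) = integralC (fun z => F z * (wt (s - d.+1%:R) z)%:C).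
Proof.
by apply: integralC_ext => z zb; rewrite -mulrA -realCM weight_tau.
Qed.

Lemma integrable_tau_weight s F : integrableC (fun z => F z * (wt (s - d.+1%:R) z)%:C) ->
  integrable_tau (fun z => F z * (weight s z)%:C).
Proof.
by apply: integrableC_ext => z zb; rewrite -mulrA -realCM weight_tau.
Qed.

Lemma inner_wint s f g : inner s f g = wint s (fun z => conjc (f z) * g z).
Proof. by rewrite /inner /integral_mu integral_tau_weight. Qed.

Lemma wint_ext s F G : (forall z, ball z -> F z = G z) -> wint s F = wint s G.
Proof. by move=> FG; congr (_ * _); apply: integralC_ext => z zb; rewrite FG. Qed.

End square_integrable.

Section raising.
Context {R : realType} {d : nat}.
Local Notation Cd := (Cspace R d).
Local Notation ball := (@unit_ball R d).
Implicit Types (F G f g u v psi h : Cd -> R[i]) (z w : Cd) (a p q r s : R).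

Variable D : (Cd -> R[i]) -> Cd -> R[i].
Hypothesis ibp_D : forall psi s, Ck 1 psi ->
  integrableC (fun z => psi z * (wt (s - 1) z)%:C) ->
  integrableC (fun z => D psi z * (wt s z)%:C) ->
  integralC (fun z => D psi z * (wt s z)%:C) =
  s%:C * integralC (fun z => psi z * (wt (s - 1) z)%:C) -
  (s + d%:R)%:C * integralC (fun z => psi z * (wt s z)%:C).

Let raise_identity (C : comPzRingType) (c' c x y s si sd : C) : s * si = 1 -> c' * sd = s * c ->
  c' * (y + si * (sd * x - s * y)) = c * x.
Proof.
move=> h1 h2; have -> : si * (sd * x - s * y) = sd * si * x - y.
  by rewrite mulrBr !mulrA [si * s]mulrC h1 mul1r [si * sd]mulrC.
by rewrite addrC subrK !mulrA h2 [s * c]mulrC -[c * s * si]mulrA h1 mulr1.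
Qed.

Let step_identity (C : comPzRingType) (x xi u v w : C) : x * xi = 1 ->
  x * ((u + v * xi) * w + -1 * (u * w)) = v * w.
Proof.
move=> h1; transitivity (x * xi * (v * w)); first by ring.
by rewrite h1 mul1r.
Qed.

Lemma wint_raise psi s : d%:R < s -> Ck 1 psi ->
  integrableC (fun z => psi z * (wt (s - d.+1%:R) z)%:C) ->
  integrableC (fun z => D psi z * (wt (s + 1 - d.+1%:R) z)%:C) ->
  wint (s + 1) (fun z => psi z + D psi z / s%:C) = wint s psi.
Proof.
move=> ds hp i1 i2; have s0 : 0 < s by exact: le_lt_trans ds.
have e1 : s + 1 - d.+1%:R = s - d%:R by rewrite -natr1; ring.
have e2 : s - d.+1%:R = s - d%:R - 1 by rewrite -natr1; ring.
have i3 : integrableC (fun z => psi z * (wt (s + 1 - d.+1%:R) z)%:C).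
  by apply: integrableC_wt_le i1; [exact: Ck_cont hp|rewrite lerD2r lerDl].
rewrite /wint; have -> : integralC (fun z => (psi z + D psi z / s%:C) * (wt (s + 1 - d.+1%:R) z)%:C) =
   integralC (fun z => psi z * (wt (s + 1 - d.+1%:R) z)%:C) +
   (s%:C)^-1 * integralC (fun z => D psi z * (wt (s + 1 - d.+1%:R) z)%:C).
  rewrite -(integralC_cmul _ i2) -(integralC_add i3 (integrableC_cmul _ i2)).
  by apply: integralC_ext => z _; rewrite mulrDl; congr (_ + _); rewrite mulrAC mulrC.
rewrite e1 in i2 i3 *; rewrite e2 in i1 *.
rewrite (ibp_D hp i1 i2) subrK; apply: raise_identity.
- by rewrite mulfV// realC_neq0// gt_eqF.
- by rewrite -!realCM cst_c_succ.
Qed.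

Lemma wint_raise_step psi s : d%:R < s -> Ck 1 psi ->
  integrableC (fun z => psi z * (wt (s - d.+1%:R) z)%:C) ->
  integrableC (fun z => (psi z + D psi z / s%:C) * (wt (s + 1 - d.+1%:R) z)%:C) ->
  wint (s + 1) (fun z => psi z + D psi z / s%:C) = wint s psi.
Proof.
move=> ds hp i1 i2; have s0 : 0 < s by exact: le_lt_trans ds.
apply: (wint_raise ds hp i1).
have i3 : integrableC (fun z => psi z * (wt (s + 1 - d.+1%:R) z)%:C).
  by apply: integrableC_wt_le i1; [exact: Ck_cont hp|rewrite lerD2r lerDl].
have sK : s%:C * (s%:C)^-1 = 1 by rewrite mulfV// realC_neq0// gt_eqF.
have i4 := integrableC_cmul s%:C (integrableC_add i2 (integrableC_cmul (-1) i3)).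
apply: integrableC_ext i4 => z zb.
exact: (step_identity (psi z) (D psi z) (wt (s + 1 - d.+1%:R) z)%:C sK).
Qed.

Lemma wint_prodI a k h : d%:R < a ->
  (forall i, (i < k)%N -> Ck 1 (prodI D a i h)) ->
  (forall i, (i <= k)%N -> integrableC (fun z => prodI D a i h z * (wt (a + i%:R - d.+1%:R) z)%:C)) ->
  wint (a + k%:R) (prodI D a k h) = wint a h.
Proof.
move=> da; elim: k => [|k IH] hC hi; first by rewrite addr0.
rewrite -IH; last 2 first.
- by move=> i ik; apply: hC; exact: ltnW.
- by move=> i ik; apply: hi; exact: leqW.
have ik := hi k (leqnSn k); have hk := hC k (ltnSn k).
have ikS := hi k.+1 (leqnn _).
have e : a + k.+1%:R = a + k%:R + 1 by rewrite -natr1 addrA.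
rewrite e in ikS *.
have dak : d%:R < a + k%:R by apply: lt_le_trans da _; rewrite lerDl.
exact: (wint_raise_step dak hk ik ikS).
Qed.

End raising.

Section expansion.
Context {R : realType} {d : nat}.
Local Notation Cd := (Cspace R d).
Local Notation ball := (@unit_ball R d).
Implicit Types (F G f g u v psi h : Cd -> R[i]) (z w : Cd) (a p q r s : R).

Section lists.
Variable I : Type.
Implicit Types (L : seq (R[i] * I)) (t : I -> I).

(* A formal linear combination is a list of coefficients and indices, which
   makes the coefficients independent of the functions they are applied to. *)
Definition shiftL t (c : R[i]) L := [seq (c * x.1, t x.2) | x <- L].

Definition raiseL t1 t2 (a : R) L := L ++ shiftL t1 (a%:C)^-1 L ++ shiftL t2 (a%:C)^-1 L.

Fixpoint prodL t1 t2 (a : R) (k : nat) L :=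
  if k is k'.+1 then raiseL t1 t2 (a + k'%:R) (prodL t1 t2 a k' L) else L.

Variable T : I -> Cd -> R[i].

Definition sumL L z : R[i] := \sum_(x <- L) x.1 * T x.2 z.

Variable D : (Cd -> R[i]) -> Cd -> R[i].
Hypothesis D_cst : forall c z, D (fun=> c) z = 0.
Hypothesis D_add : forall f g z, diff1 z f -> diff1 z g ->
  D (fun w => f w + g w) z = D f z + D g z.
Hypothesis D_mul : forall f g z, diff1 z f -> diff1 z g ->
  D (fun w => f w * g w) z = D f z * g z + f z * D g z.
Hypothesis D_ext : forall f g z, ball z -> (forall w, ball w -> f w = g w) -> D f z = D g z.

Definition all_ix (P : I -> Prop) L := forall x, List.In x L -> P x.2.

Lemma sumL_nil z : sumL [::] z = 0. Proof. exact: big_nil. Qed.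

Lemma sumL_cons x L z : sumL (x :: L) z = x.1 * T x.2 z + sumL L z.
Proof. exact: big_cons. Qed.

Lemma sumL_Ck k L : all_ix (fun e => Ck k (T e)) L -> Ck k (sumL L).
Proof.
elim: L => [|x L IH] h.
  by apply: Ck_ext (Ck_cst k 0) => z _; rewrite sumL_nil.
apply: (@Ck_ext _ _ _ (fun z => x.1 * T x.2 z + sumL L z)).
  by move=> z _; rewrite sumL_cons.
apply: Ck_add; last by apply: IH => y yL; apply: h; right.
by apply: Ck_mul; [exact: Ck_cst|apply: h; left].
Qed.

Lemma sumL_D t1 t2 c L z : ball z -> all_ix (fun e => Ck 1 (T e)) L ->
  all_ix (fun e => D (T e) z = T (t1 e) z + T (t2 e) z) L ->
  c * D (sumL L) z = sumL (shiftL t1 c L) z + sumL (shiftL t2 c L) z.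
Proof.
move=> zb; elim: L => [|x L IH] h1 h2.
  have e0 : D (sumL [::]) z = D (fun=> 0) z by apply: D_ext => // w _; rewrite sumL_nil.
  by rewrite !sumL_nil addr0 e0 D_cst mulr0.
have hL : Ck 1 (sumL L) by apply: sumL_Ck => y yL; apply: h1; right.
have hx : Ck 1 (T x.2) by apply: h1; left.
have hxx : Ck 1 (fun z => x.1 * T x.2 z) := Ck_mul (Ck_cst 1 x.1) hx.
rewrite (_ : D _ z = D (fun w => x.1 * T x.2 w + sumL L w) z); last first.
  by apply: D_ext => // w _; rewrite sumL_cons.
have e1 := D_add (Ck_diff1 hxx zb) (Ck_diff1 hL zb).
have e2 := D_mul (diff1_cst z x.1) (Ck_diff1 hx zb).
rewrite [X in c * X]e1 [X in c * (X + _)]e2 D_cst mul0r add0r mulrDr IH; last 2 first.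
- by move=> y yL; apply: h1; right.
- by move=> y yL; apply: h2; right.
rewrite /= !sumL_cons /= (h2 x); last by left.
by rewrite !mulrDr !mulrA addrACA.
Qed.

Lemma sumL_cat L1 L2 z : sumL (L1 ++ L2) z = sumL L1 z + sumL L2 z.
Proof. exact: big_cat. Qed.

Lemma sumL_raise t1 t2 a L z : ball z -> all_ix (fun e => Ck 1 (T e)) L ->
  all_ix (fun e => D (T e) z = T (t1 e) z + T (t2 e) z) L ->
  sumL (raiseL t1 t2 a L) z = sumL L z + D (sumL L) z / a%:C.
Proof. by move=> zb h1 h2; rewrite /raiseL !sumL_cat -(sumL_D _ zb h1 h2) mulrC. Qed.

Lemma all_ix_cat P L1 L2 : all_ix P L1 -> all_ix P L2 -> all_ix P (L1 ++ L2).
Proof. by move=> h1 h2 x xL; have [] := List.in_app_or _ _ _ xL; [exact: h1|exact: h2]. Qed.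

Lemma all_ix_shift (P Q : I -> Prop) t c L : (forall e, P e -> Q (t e)) -> all_ix P L -> all_ix Q (shiftL t c L).
Proof.
move=> PQ h x; elim: L h => // y L IH h /= [<-|]; first by apply/PQ/h; left.
by apply: IH => w wL; apply: h; right.
Qed.

Variables (t1 t2 : I -> I) (P : nat -> I -> Prop).
Hypothesis P_le : forall i e, P i e -> P i.+1 e.
Hypothesis P_t1 : forall i e, P i e -> P i.+1 (t1 e).
Hypothesis P_t2 : forall i e, P i e -> P i.+1 (t2 e).

Lemma all_ix_prod a k L : all_ix (P 0) L -> all_ix (P k) (prodL t1 t2 a k L).
Proof.
move=> h; elim: k => // k IH; apply: all_ix_cat; last apply: all_ix_cat.
- by move=> x xL; apply: P_le; exact: IH.
- exact: all_ix_shift (P_t1 (i := k)) IH.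
- exact: all_ix_shift (P_t2 (i := k)) IH.
Qed.

Lemma prodI_sumL a k L h : all_ix (P 0) L -> (forall z, ball z -> h z = sumL L z) ->
  (forall i e, (i < k)%N -> P i e -> Ck 1 (T e)) ->
  (forall i e z, (i < k)%N -> P i e -> ball z -> D (T e) z = T (t1 e) z + T (t2 e) z) ->
  forall z, ball z -> prodI D a k h z = sumL (prodL t1 t2 a k L) z.
Proof.
move=> h0 hL; elim: k => // k IH hC hD z zb.
have {}IH := IH (fun i e ik => hC i e (leqW ik)) (fun i e z ik => hD i e z (leqW ik)).
have hk := @all_ix_prod a k _ h0.
rewrite [RHS]sumL_raise//; last 2 first.
- by move=> x xL; apply: (hC k) => //; exact: hk.
- by move=> x xL; apply: (hD k) => //; exact: hk.
by rewrite /= IH// (D_ext zb IH).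
Qed.

End lists.
End expansion.

(** * Expansion of the operator C *)

Notation ix := (nat * nat * nat * nat)%type.

Definition up_j (e : ix) : ix := let: (j, k, l, m) := e in (j.+1, k, l, m).
Definition up_k (e : ix) : ix := let: (j, k, l, m) := e in (j, k.+1, l, m).
Definition up_l (e : ix) : ix := let: (j, k, l, m) := e in (j, k, l.+1, m).
Definition up_m (e : ix) : ix := let: (j, k, l, m) := e in (j, k, l, m.+1).

Definition coefL {R : realType} (lambda : R) (n : nat) : seq (R[i] * ix) :=
  prodL up_j up_k (lambda + n%:R) n (prodL up_l up_m lambda n [:: (1, (0, 0, 0, 0)%N)]).

Definition coefA {R : realType} (lambda : R) (n : nat) (j k l m : nat) : R[i] :=
  \sum_(x <- coefL lambda n)
    let: (j', k', l', m') := x.2 in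
    x.1 * ((j' == j)%:R * (k' == k)%:R * (l' == l)%:R * (m' == m)%:R).

Section pick_terms.
Variable C : comPzRingType.

Lemma sum_pick n c (F : nat -> C) : (c <= n)%N -> \sum_(j < n.+1) (c == j)%:R * F j = F c.
Proof.
move=> cn; rewrite (bigD1 (inord c)) //= inordK// eqxx mul1r big1 ?addr0// => j.
move=> jc; case: eqP => [cj|]; last by rewrite mul0r.
by move/eqP : jc => []; apply: val_inj; rewrite /= inordK.
Qed.

Lemma sum_pick4 n j0 k0 l0 m0 (F : nat -> nat -> nat -> nat -> C) :
  (j0 <= n)%N -> (k0 <= n)%N -> (l0 <= n)%N -> (m0 <= n)%N ->
  \sum_(j < n.+1) \sum_(k < n.+1) \sum_(l < n.+1) \sum_(m < n.+1)
    (j0 == j)%:R * (k0 == k)%:R * (l0 == l)%:R * (m0 == m)%:R * F j k l m = F j0 k0 l0 m0.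
Proof.
move=> hj hk hl hm.
rewrite -(sum_pick (fun j => F j k0 l0 m0) hj); apply: eq_bigr => j _.
rewrite -(sum_pick (fun k => F j k l0 m0) hk) mulr_sumr; apply: eq_bigr => k _.
rewrite -(sum_pick (fun l => F j k l m0) hl) !mulr_sumr; apply: eq_bigr => l _.
rewrite -(sum_pick (fun m => F j k l m) hm) !mulr_sumr; apply: eq_bigr => m _.
by rewrite !mulrA.
Qed.

End pick_terms.

Section terms.
Context {R : realType} {d : nat}.
Local Notation Cd := (Cspace R d).
Local Notation ball := (@unit_ball R d).
Hypothesis d_gt0 : (0 < d)%N.
Variables (lambda : R) (n : nat) (phi f g : Cd -> R[i]).
Hypothesis dl : d%:R < lambda.
Hypothesis hphi : symbol_class n phi.
Hypotheses (hf : HL2 lambda f) (hg : HL2 lambda g).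

Lemma holomorphic_iter (u : Cd -> R[i]) j : holomorphic u -> holomorphic (iter j opN u).
Proof. by move=> hu; elim: j => //= j; exact: holomorphic_opN. Qed.

Lemma sqint_iter (u : Cd -> R[i]) j : HL2 lambda u -> sqint (lambda - d.+1%:R + j.*2%:R) (iter j opN u).
Proof.
move=> [hu /(L2_sqint u dl) su]; elim: j => [|j [mj ij]]; first by rewrite addr0.
have hj := holomorphic_iter j hu; have hj1 := holomorphic_iter j.+1 hu.
split; first exact: measurable_cfun_continuous (Ck_cont hj1.1).
have -> : lambda - d.+1%:R + j.+1.*2%:R = lambda - d.+1%:R + j.*2%:R + 2.
  by rewrite doubleS -[j.*2.+2]addn2 natrD addrA.
exact: opN_square_integrable.
Qed.

Definition symb k l := iter k opNbar (iter l opN phi).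

Lemma Ck_symb k l r : (k + l + r <= 2 * n)%N -> Ck r (symb k l).
Proof.
move=> h; have {}h := Ck_le h hphi.1.
have step D u i q : (forall r u, Ck r.+1 u -> Ck r (D u)) ->
    Ck (i + q) u -> Ck q (iter i D u : Cd -> R[i]).
  move=> hD; elim: i q => //= i IH q hu; apply: hD; apply: IH.
  by rewrite addnS -addSn.
apply: (step opNbar); first by move=> *; exact: Ck_opNbar.
apply: (step opN); first by move=> *; exact: Ck_opN.
by rewrite addnA [(l + k)%N]addnC.
Qed.

Definition pair_term k l m z := symb k l z * iter m opN g z.

Lemma sqint_pair_term k l m : (k <= n)%N -> (l <= n)%N ->
  sqint (lambda - d.+1%:R + m.*2%:R) (pair_term k l m).
Proof.
move=> kn ln; have [M hM] := hphi.2 k l kn ln.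
apply: sqint_bdd hM _; last exact: sqint_iter.
apply/measurable_cfun_continuous/Ck_cont; apply: (@Ck_symb k l 0); lia.
Qed.

Definition term (e : ix) z : R[i] :=
  let: (j, k, l, m) := e in conjc (iter j opN f z) * pair_term k l m z.

Lemma Ck_term j k l m : (k + l + 1 <= 2 * n)%N -> Ck 1 (term (j, k, l, m)).
Proof.
move=> h; apply: Ck_mul; first by apply/Ck_conj; exact: (holomorphic_iter j hf.1).1.
by apply: Ck_mul; [exact: Ck_symb|exact: (holomorphic_iter m hg.1).1].
Qed.

Lemma term_integrable j k l m r : (k <= n)%N -> (l <= n)%N ->
  lambda - d.+1%:R + (j + m)%:R <= r ->
  integrableC (fun z => term (j, k, l, m) z * (wt r z)%:C).
Proof.
move=> kn ln jmr; apply: sqint_mul (sqint_iter j hf) (sqint_pair_term m kn ln).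
by move: jmr; rewrite natrD -!addnn !natrD; lra.
Qed.

Lemma holomorphic_opNbar u z : holomorphic u -> ball z -> opNbar u z = 0.
Proof. by move=> [_ h] zb; rewrite /opNbar big1// => j _; rewrite h// mulr0. Qed.

Lemma opN_term l m z : (l + 1 <= 2 * n)%N -> ball z ->
  opN (term (0, 0, l, m)%N) z = term (0, 0, l.+1, m)%N z + term (0, 0, l, m.+1)%N z.
Proof.
move=> ln zb; have cf := Ck_diff1 hf.1.1 zb.
have cs : diff1 z (symb 0 l) by apply: (@Ck_diff1 _ _ 0) => //; apply: Ck_symb; lia.
have cg := Ck_diff1 (holomorphic_iter m hg.1).1 zb.
have csg : diff1 z (pair_term 0 l m).
  apply: (@Ck_diff1 _ _ 0) => //; apply: Ck_mul; last exact: (holomorphic_iter m hg.1).1.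
  by apply: Ck_symb; lia.
have ccf : diff1 z (fun w => conjc (f w)) := Ck_diff1 (Ck_conj hf.1.1) zb.
have e1 := opN_mul ccf csg; have e2 := opN_mul cs cg; have e3 := opN_conj cf.
rewrite (holomorphic_opNbar hf.1 zb) conjc0 in e3.
rewrite [LHS]e1 e3 mul0r add0r [X in _ * X]e2 mulrDr; congr (_ + _).
Qed.

Lemma opNbar_term j k l m z : (k + l + 1 <= 2 * n)%N -> ball z ->
  opNbar (term (j, k, l, m)) z = term (j.+1, k, l, m) z + term (j, k.+1, l, m) z.
Proof.
move=> ln zb; have hj := holomorphic_iter j hf.1; have hm := holomorphic_iter m hg.1.
have cf := Ck_diff1 hj.1 zb.
have cs : diff1 z (symb k l) by apply: (@Ck_diff1 _ _ 0) => //; exact: Ck_symb.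
have cg := Ck_diff1 hm.1 zb.
have csg : diff1 z (pair_term k l m).
  apply: (@Ck_diff1 _ _ 0) => //; apply: Ck_mul; last exact: hm.1.
  exact: Ck_symb.
have ccf : diff1 z (fun w => conjc (iter j opN f w)) := Ck_diff1 (Ck_conj hj.1) zb.
have e1 := opNbar_mul ccf csg; have e2 := opNbar_mul cs cg; have e3 := opNbar_conj cf.
rewrite (holomorphic_opNbar hm zb) mulr0 addr0 in e2.
by rewrite [LHS]e1 e3 [X in _ + _ * X]e2.
Qed.

Definition ixN (i : nat) (e : ix) : Prop := let: (j, k, l, m) := e in
  [/\ j = 0%N, k = 0%N & (l + m <= i)%N].

Definition ixNbar (i : nat) (e : ix) : Prop := let: (j, k, l, m) := e in
  (j + k <= i)%N /\ (l + m <= n)%N.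

Lemma ixN_step i e : ixN i e -> [/\ ixN i.+1 e, ixN i.+1 (up_l e) & ixN i.+1 (up_m e)].
Proof. by case: e => [[[j k] l] m] [-> -> h]; split; split; rewrite ?addSn ?addnS// leqW. Qed.

Lemma ixNbar_step i e :
  ixNbar i e -> [/\ ixNbar i.+1 e, ixNbar i.+1 (up_j e) & ixNbar i.+1 (up_k e)].
Proof. by case: e => [[[j k] l] m] [h h']; split; split; rewrite ?addSn ?addnS// leqW. Qed.

Definition psi0 z := conjc (f z) * phi z * g z.

Lemma prodI_N k : (k <= n)%N -> forall z, ball z ->
  prodI opN lambda k psi0 z = sumL term (prodL up_l up_m lambda k [:: (1, (0, 0, 0, 0)%N)]) z.
Proof.
move=> kn.
apply: (@prodI_sumL R d ix term opN (@opN_cst R d) (@opN_add R d) (@opN_mul R d) (@opN_ext R d)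
  up_l up_m ixN).
1-3: by move=> i e /ixN_step[].
- by move=> x [<-|[]].
- by move=> z zb; rewrite sumL_cons sumL_nil addr0 mul1r /psi0 -mulrA.
- by move=> i [[[j' k'] l] m] ik [-> -> h]; apply: Ck_term; lia.
- by move=> i [[[j' k'] l] m] z ik [-> -> h] zb; apply: opN_term => //; lia.
Qed.

Lemma all_ixN k : all_ix (ixN k) (prodL up_l up_m lambda k [:: (1, (0, 0, 0, 0)%N)]).
Proof.
apply: all_ix_prod.
1-3: by move=> i e /ixN_step[].
- by move=> x [<-|[]].
Qed.

Lemma all_ixNbar k : all_ix (ixNbar k) (prodL up_j up_k (lambda + n%:R) k
  (prodL up_l up_m lambda n [:: (1, (0, 0, 0, 0)%N)])).
Proof.
apply: all_ix_prod.
1-3: by move=> i e /ixNbar_step[].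
- by move=> x /all_ixN; case: x => c [[[j' k'] l] m] [/= -> -> h].
Qed.

Lemma prodI_Nbar k : (k <= n)%N -> forall z, ball z ->
  prodI opNbar (lambda + n%:R) k (prodI opN lambda n psi0) z =
  sumL term (prodL up_j up_k (lambda + n%:R) k
    (prodL up_l up_m lambda n [:: (1, (0, 0, 0, 0)%N)])) z.
Proof.
move=> kn.
apply: (@prodI_sumL R d ix term opNbar (@opNbar_cst R d) (@opNbar_add R d) (@opNbar_mul R d)
  (@opNbar_ext R d) up_j up_k ixNbar).
1-3: by move=> i e /ixNbar_step[].
- by move=> x /all_ixN; case: x => c [[[j' k'] l] m] [/= -> -> h].
- exact: prodI_N.
- by move=> i [[[j' k'] l] m] ik [h1 h2]; apply: Ck_term; lia.
- by move=> i [[[j' k'] l] m] z ik [h1 h2] zb; apply: opNbar_term => //; lia.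
Qed.

Lemma integrable_sumL L r :
  all_ix (fun e : ix => let: (j, k, l, m) := e in
    [/\ (k <= n)%N, (l <= n)%N & lambda - d.+1%:R + (j + m)%:R <= r]) L ->
  integrableC (fun z => sumL term L z * (wt r z)%:C) /\
  integralC (fun z => sumL term L z * (wt r z)%:C) =
  \sum_(x <- L) x.1 * integralC (fun z => term x.2 z * (wt r z)%:C).
Proof.
elim: L => [|x L IH] h.
  rewrite big_nil; have e z : ball z -> 0 = sumL term [::] z * (wt r z)%:C.
    by rewrite sumL_nil mul0r.
  split; last by apply: integralC0 => z /e.
  apply: integrableC_ext e _; apply: (integrableC_le (g := fun=> 0)).
  - by apply: measurable_cfun_continuous => z _; exact: continuousC_cst.
  - exact: integrable0.
  - by move=> z _; rewrite normc0.
have [iL eL] := IH (fun y yL => h y (or_intror yL)).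
have ix : integrableC (fun z => term x.2 z * (wt r z)%:C).
  have := h x (or_introl erefl); case: x.2 => [[[j k] l] m] [h1 h2 h3].
  exact: term_integrable.
have e z : ball z -> x.1 * (term x.2 z * (wt r z)%:C) + sumL term L z * (wt r z)%:C =
    sumL term (x :: L) z * (wt r z)%:C.
  by rewrite sumL_cons mulrDl mulrA.
have ixL := integrableC_add (integrableC_cmul x.1 ix) iL.
split; first exact: integrableC_ext e ixL.
rewrite big_cons -eL -(integralC_cmul _ ix) -(integralC_add (integrableC_cmul x.1 ix) iL).
by apply: integralC_ext => z zb; rewrite -e.
Qed.

Lemma integrable_prodI_N k : (k <= n)%N ->
  integrableC (fun z => prodI opN lambda k psi0 z * (wt (lambda + k%:R - d.+1%:R) z)%:C).
Proof.
move=> kn; have [] := @integrable_sumL (prodL up_l up_m lambda k [:: (1, (0, 0, 0, 0)%N)])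
    (lambda + k%:R - d.+1%:R).
  move=> x /all_ixN; case: x => c [[[j' k'] l] m] [/= -> -> h]; split => //; first lia.
  have : (0 + m)%:R <= k%:R :> R by rewrite ler_nat; lia.
  lra.
by move=> h _; apply: integrableC_ext h => z zb; rewrite prodI_N.
Qed.

Lemma integrable_prodI_Nbar k : (k <= n)%N ->
  integrableC (fun z => prodI opNbar (lambda + n%:R) k (prodI opN lambda n psi0) z *
    (wt (lambda + n%:R + k%:R - d.+1%:R) z)%:C).
Proof.
move=> kn; have [] := @integrable_sumL (prodL up_j up_k (lambda + n%:R) k
    (prodL up_l up_m lambda n [:: (1, (0, 0, 0, 0)%N)])) (lambda + n%:R + k%:R - d.+1%:R).
  move=> x /all_ixNbar; case: x => c [[[j' k'] l] m] [/= h1 h2]; split; [lia|lia|].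
  have : (j' + m)%:R <= n%:R + k%:R :> R by rewrite -natrD ler_nat; lia.
  lra.
by move=> h _; apply: integrableC_ext h => z zb; rewrite prodI_Nbar.
Qed.

Lemma Ck_prodI_N k : (k < n)%N -> Ck 1 (prodI opN lambda k psi0).
Proof.
move=> kn; apply: (@Ck_ext _ _ _ (sumL term (prodL up_l up_m lambda k [:: (1, (0, 0, 0, 0)%N)]))).
  by move=> z zb; rewrite prodI_N// ltnW.
apply: sumL_Ck => x /all_ixN; case: x => c [[[j' k'] l] m] [/= -> -> h].
by apply: Ck_term; lia.
Qed.

Lemma Ck_prodI_Nbar k : (k < n)%N ->
  Ck 1 (prodI opNbar (lambda + n%:R) k (prodI opN lambda n psi0)).
Proof.
move=> kn; apply: (@Ck_ext _ _ _ (sumL term (prodL up_j up_k (lambda + n%:R) k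
    (prodL up_l up_m lambda n [:: (1, (0, 0, 0, 0)%N)])))).
  by move=> z zb; rewrite prodI_Nbar// ltnW.
apply: sumL_Ck => x /all_ixNbar; case: x => c [[[j' k'] l] m] [/= h1 h2].
by apply: Ck_term; lia.
Qed.

Lemma wint_opC : wint lambda psi0 = wint (lambda + (2 * n)%:R) (opC n lambda psi0).
Proof.
have dln : d%:R < lambda + n%:R by apply: lt_le_trans dl _; rewrite lerDl.
rewrite mul2n -addnn natrD addrA /opC.
rewrite (wint_prodI (@ibp_opNbar R d) dln); last 2 first.
- exact: Ck_prodI_Nbar.
- exact: integrable_prodI_Nbar.
rewrite (wint_prodI (@ibp_opN R d) dl)//.
- exact: Ck_prodI_N.
- exact: integrable_prodI_N.
Qed.

Lemma exponent_2n : lambda + (2 * n)%:R - d.+1%:R = lambda + n%:R + n%:R - d.+1%:R.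
Proof. by rewrite mul2n -addnn natrD addrA. Qed.

Lemma integrable_opC :
  integrableC (fun z => opC n lambda psi0 z * (wt (lambda + (2 * n)%:R - d.+1%:R) z)%:C).
Proof. by rewrite exponent_2n; exact: integrable_prodI_Nbar. Qed.

Lemma wint_opC_sum : wint (lambda + (2 * n)%:R) (opC n lambda psi0) =
  \sum_(j < n.+1) \sum_(k < n.+1) \sum_(l < n.+1) \sum_(m < n.+1)
    coefA lambda n j k l m * wint (lambda + (2 * n)%:R) (term (j : nat, k : nat, l : nat, m : nat)).
Proof.
have [_ e] : integrableC (fun z => sumL term (coefL lambda n) z * (wt (lambda + (2 * n)%:R - d.+1%:R) z)%:C) /\
    integralC (fun z => sumL term (coefL lambda n) z * (wt (lambda + (2 * n)%:R - d.+1%:R) z)%:C) =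
    \sum_(x <- coefL lambda n) x.1 * integralC (fun z => term x.2 z * (wt (lambda + (2 * n)%:R - d.+1%:R) z)%:C).
  apply: integrable_sumL => x /all_ixNbar; case: x => c [[[j' k'] l] m] [/= h1 h2]; split; [lia|lia|].
  rewrite addrAC lerD2r lerD2l ler_nat; lia.
rewrite (@wint_ext _ _ _ _ (sumL term (coefL lambda n))); last exact: prodI_Nbar.
rewrite {1}/wint e mulr_sumr.
pose W (j k l m : nat) := wint (lambda + (2 * n)%:R) (term (j, k, l, m)).
transitivity (\sum_(x <- coefL lambda n) \sum_(j < n.+1) \sum_(k < n.+1) \sum_(l < n.+1) \sum_(m < n.+1)
    (let: (j', k', l', m') := x.2 in
    x.1 * ((j' == j)%:R * (k' == k)%:R * (l' == l)%:R * (m' == m)%:R)) * W j k l m).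
  rewrite !big_seq; apply: eq_bigr => x xL.
  have : List.In x (coefL lambda n).
    by elim: (coefL lambda n) xL => // y L IH /=; rewrite inE => /orP[/eqP ->|/IH]; [left|right].
  move=> /all_ixNbar; case: x {xL} => c [[[j' k'] l'] m'] [/= h1 h2].
  rewrite mulrCA -/(wint _ _) -/(W j' k' l' m').
  rewrite -(@sum_pick4 _ n j' k' l' m' W); [|lia|lia|lia|lia].
  do 4 (rewrite mulr_sumr; apply: eq_bigr => ? _).
  exact: mulrA.
rewrite exchange_big; apply: eq_bigr => j _.
rewrite exchange_big; apply: eq_bigr => k _.
rewrite exchange_big; apply: eq_bigr => l _.
rewrite exchange_big; apply: eq_bigr => m _.
by rewrite /coefA mulr_suml.
Qed.

Lemma inner_toeplitz P : is_orthogonal_projection lambda P ->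
  inner lambda f (toeplitz P phi g) = wint lambda psi0.
Proof.
move=> hP.
have sphg : sqint (lambda - d.+1%:R) (pair_term 0 0 0).
  by have := @sqint_pair_term 0 0 0; rewrite addr0; exact.
have sf : sqint (lambda - d.+1%:R) f by apply/(L2_sqint f dl); exact: hf.2.
have [hPg /(_ f hf)] := hP _ ((L2_sqint _ dl).2 sphg).
have sP := (L2_sqint _ dl).1 hPg.2.
have i1 := sqint_mul (lexx _) sf sphg.
have i2 := sqint_mul (lexx _) sf sP.
rewrite !inner_wint {1}/wint.
rewrite (_ : integralC _ = integralC (fun z => conjc (f z) * pair_term 0 0 0 z * (wt (lambda - d.+1%:R) z)%:C
   + (-1) * (conjc (f z) * P (pair_term 0 0 0) z * (wt (lambda - d.+1%:R) z)%:C))); last first.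
  by apply: integralC_ext => z _; rewrite mulrBr mulrBl mulN1r.
rewrite (integralC_add i1 (integrableC_cmul _ i2)) (integralC_cmul _ i2) mulN1r mulrBr.
move/eqP; rewrite subr_eq0 => /eqP h.
rewrite [LHS](_ : _ = wint lambda (fun z => conjc (f z) * P (pair_term 0 0 0) z))//.
transitivity (wint lambda (fun z => conjc (f z) * pair_term 0 0 0 z)); first exact: esym h.
by apply: wint_ext => z _; rewrite /psi0 -mulrA.
Qed.

End terms.

Theorem theorem9 (R : realType) (lambda : R) (n : nat) (hn : (0 < n)%N) :
  (forall d : nat, (1 <= d)%N -> d%:R < lambda ->
   forall P : (Cspace R d -> R[i]) -> Cspace R d -> R[i],
   is_orthogonal_projection lambda P ->
   forall phi : Cspace R d -> R[i], symbol_class n phi ->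
   forall f g : Cspace R d -> R[i], HL2 lambda f -> HL2 lambda g ->
   let integrand z :=
     opC n lambda (fun w => conjc (f w) * phi w * g w) z *
     (weight (lambda + (2 * n)%:R) z)%:C in
   integrable_tau integrand /\
   inner lambda f (toeplitz P phi g) =
     (cst_c d (lambda + (2 * n)%:R))%:C * integral_tau integrand) /\
  (exists A : nat -> nat -> nat -> nat -> R[i],
   forall d : nat, (1 <= d)%N -> d%:R < lambda ->
   forall P : (Cspace R d -> R[i]) -> Cspace R d -> R[i],
   is_orthogonal_projection lambda P ->
   forall phi : Cspace R d -> R[i], symbol_class n phi ->
   forall f g : Cspace R d -> R[i], HL2 lambda f -> HL2 lambda g ->
   let u j := iter j opN f in
   let v k l m z := iter k opNbar (iter l opN phi) z * iter m opN g z in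
   [/\ forall j, (j <= n)%N -> L2 (lambda + (2 * n)%:R) (u j),
       forall k l m, (k <= n)%N -> (l <= n)%N -> (m <= n)%N ->
         L2 (lambda + (2 * n)%:R) (v k l m) &
       inner lambda f (toeplitz P phi g) =
         \sum_(j < n.+1) \sum_(k < n.+1) \sum_(l < n.+1) \sum_(m < n.+1)
           A j k l m * inner (lambda + (2 * n)%:R) (u j) (v k l m)]).
Proof.
split.
  move=> d d0 dl P hP phi hphi f g hf hg integrand; split.
    by apply: integrable_tau_weight; exact: integrable_opC.
  rewrite (inner_toeplitz d0 dl hphi hf hg hP) (wint_opC d0 dl hphi hf hg).
  by rewrite /integrand integral_tau_weight.
exists (coefA lambda n) => d d0 dl P hP phi hphi f g hf hg u v.
have dln : d%:R < lambda + (2 * n)%:R by apply: lt_le_trans dl _; rewrite lerDl.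
have lexponent_2n (j : nat) : (j <= n)%N -> lambda - d.+1%:R + j.*2%:R <= lambda + (2 * n)%:R - d.+1%:R.
  by move=> jn; rewrite addrAC lerD2r lerD2l ler_nat; lia.
split.
- move=> j jn; apply/(L2_sqint _ dln); exact: sqint_le (lexponent_2n j jn) (sqint_iter d0 dl j hf).
- move=> k l m kn ln mn; apply/(L2_sqint _ dln).
  exact: sqint_le (lexponent_2n m mn) (sqint_pair_term d0 dl hphi hg m kn ln).
- rewrite (inner_toeplitz d0 dl hphi hf hg hP) (wint_opC d0 dl hphi hf hg).
  rewrite (wint_opC_sum d0 dl hphi hf hg).
  do 4 (apply: eq_bigr => ? _).
  by rewrite inner_wint.
Qed.
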